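(* Suppose that the parameters $p,q,r,s,t,v$ satisfy $0<q\le p<\infty$, $0<r\le\infty$, $0<t\le s<\infty$, $0<v\le 1$, $q<t$, $p<s$, and $v<\min(q,r)$. Assume that $\{Q_j\}_{j=1}^\infty\subset\mathcal{Q}(\mathbb{R}^n)$, $\{a_j\}_{j=1}^\infty\subset \mathrm{W}\mathcal{M}^s_t(\mathbb{R}^n)$ and $\{\lambda_j\}_{j=1}^\infty\subset[0,\infty)$ fulfill $$\|a_j\|_{\mathrm{W}\mathcal{M}^s_t}\le|Q_j|^{\frac1s},\quad \mathrm{supp}(a_j)\subset Q_j\quad(j\in\mathbb{N}),\qquad \left\|\left(\sum_{j=1}^\infty(\lambda_j\chi_{Q_j})^v\right)^{\frac1v}\right\|_{\mathcal{M}^p_{q,r}}<\infty.$$ Then $f=\sum_{j=1}^\infty\lambda_ja_j$ converges a.e. and satisfies $$\|f\|_{\mathcal{M}^p_{q,r}}\le C\left\|\left(\sum_{j=1}^\infty(\lambda_j\chi_{Q_j})^v\right)^{\frac1v}\right\|_{\mathcal{M}^p_{q,r}},$$ where the constant $C>0$ depends only on $n,p,q,r,s,t,v$. In particular, $f=\sum_{j=1}^\infty\lambda_ja_j$ converges in $L^{q,r}_{\mathrm{loc}}(\mathbb{R}^n)$ if $r<\infty$, and in $L^{p,r}(\mathbb{R}^n)$ if $p=q$ and $r<\infty$.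
   Context: $L^0(\mathbb{R}^n)$ is the set of all measurable functions on $\mathbb{R}^n$, $\mathcal{Q}(\mathbb{R}^n)$ is the family of all cubes in $\mathbb{R}^n$ with sides parallel to the coordinate axes, $|E|$ is Lebesgue measure, and $\chi_E$ is the indicator function of $E$. For measurable $f$ put $\lambda_f(\alpha)=|\{x:|f(x)|>\alpha\}|$ ($\alpha>0$) and $f^\ast(t)=\inf\{\alpha>0:\lambda_f(\alpha)\le t\}$ ($t>0$). The Lorentz quasi-norm is $\|f\|_{L^{q,r}}=\left(\int_0^\infty(t^{1/q}f^\ast(t))^r\frac{dt}{t}\right)^{1/r}$ for $0<q,r<\infty$ and $\|f\|_{L^{q,\infty}}=\sup_{t>0}t^{1/q}f^\ast(t)$; $L^{q,r}(\mathbb{R}^n)$ is the set of measurable $f$ with $\|f\|_{L^{q,r}}<\infty$. $L^{q,r}_{\mathrm{loc}}(\mathbb{R}^n)$ is the set of $f\in L^0(\mathbb{R}^n)$ with $\|f\chi_K\|_{L^{q,r}}<\infty$ for all compact $K$; convergence in it means convergence of $\|(f-f_J)\chi_K\|_{L^{q,r}}$ to $0$ for every compact $K$. For $0<q\le p<\infty$, $0<r\le\infty$, the Morrey-Lorentz space $\mathcal{M}^p_{q,r}(\mathbb{R}^n)$ is the set of $f\in L^0(\mathbb{R}^n)$ with $\|f\|_{\mathcal{M}^p_{q,r}}=\sup_{Q\in\mathcal{Q}(\mathbb{R}^n)}|Q|^{\frac1p-\frac1q}\|f\chi_Q\|_{L^{q,r}}<\infty$. The Morrey space is $\mathcal{M}^p_q(\mathbb{R}^n)=\mathcal{M}^p_{q,q}(\mathbb{R}^n)$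 (with the same quasi-norm), and the weak Morrey space $\mathrm{W}\mathcal{M}^p_q(\mathbb{R}^n)$ is the set of $f\in L^0(\mathbb{R}^n)$ with $\|f\|_{\mathrm{W}\mathcal{M}^p_q}=\sup_{\lambda>0}\lambda\|\chi_{\{x\in\mathbb{R}^n:|f(x)|>\lambda\}}\|_{\mathcal{M}^p_q}<\infty$. *)

(* Defs.v *)
From HB Require Import structures.
From mathcomp Require Import all_boot all_order all_algebra.
From mathcomp Require Import all_classical all_reals all_analysis.
From mathcomp Require Import complex.

Set Implicit Arguments.
Unset Strict Implicit.
Unset Printing Implicit Defensive.

Import Order.TTheory GRing.Theory Num.Theory.
Import numFieldNormedType.Exports.

Local Open Scope classical_set_scope.
Local Open Scope ring_scope.
Local Open Scope ereal_scope.

Section lebesgue_tuple.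
Context {R : realType}.
Local Notation mR := (measurableTypeR R).

Definition tuple_cons n (x : mR * n.-tuple mR) : n.+1.-tuple mR :=
  [the n.+1.-tuple mR of x.1 :: x.2].

Definition tuple_uncons n (x : n.+1.-tuple mR) : mR * n.-tuple mR :=
  (thead x, [tuple of behead x]).

Lemma tuple_consK n : cancel (@tuple_cons n) (@tuple_uncons n).
Proof. by case=> x t; congr pair; exact: val_inj. Qed.

Lemma measurable_tuple_cons n : measurable_fun setT (@tuple_cons n).
Proof. exact: measurable_cons. Qed.

Lemma measurable_tuple_uncons n : measurable_fun setT (@tuple_uncons n).
Proof.
apply: measurable_fun_pair; [exact: measurable_tnth|exact: measurable_behead].
Qed.

Definition cons_measure n (m : set (n.-tuple mR) -> \bar R) :
    set (n.+1.-tuple mR) -> \bar R :=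
  pushforward (lebesgue_measure \x m) (@tuple_cons n).

(* n-fold product of the one-dimensional Lebesgue measure, on Borel sets *)
Fixpoint lebesgue_tuple n : set (n.-tuple mR) -> \bar R :=
  match n with
  | 0 => \d_[tuple]
  | m.+1 => cons_measure (@lebesgue_tuple m)
  end.

Section cons_measure.
Variables (n : nat) (m : {sigma_finite_measure set (n.-tuple mR) -> \bar R}).

Let p : {measure set (mR * n.-tuple mR)%type -> \bar R} :=
  @lebesgue_measure R \x m.

Let mu : {measure set (n.+1.-tuple mR) -> \bar R} :=
  measure_function_pushforward__canonical__measure_function_Measure
    p (@measurable_tuple_cons n).

Let mu0 : cons_measure m set0 = 0. Proof. exact: (measure0 mu). Qed.

Let mu_ge0 A : 0 <= cons_measure m A. Proof. exact: (measure_ge0 mu). Qed.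

Let mu_sigma_additive : semi_sigma_additive (cons_measure m).
Proof. exact: (@measure_semi_sigma_additive _ _ _ mu). Qed.

HB.instance Definition _ := isMeasure.Build _ _ _ (cons_measure m)
  mu0 mu_ge0 mu_sigma_additive.

Let mu_sigma_finite : sigma_finite setT (cons_measure m).
Proof.
have /sigma_finiteP[F [FT ndF Foo]] := sigma_finiteT (@lebesgue_measure R).
have /sigma_finiteP[G [GT ndG Goo]] := sigma_finiteT m.
have consK k : @tuple_cons n @^-1` (@tuple_uncons n @^-1` (F k `*` G k)) =
    F k `*` G k.
  by apply/funext => x; rewrite /preimage/mkset tuple_consK.
exists (fun k => @tuple_uncons n @^-1` (F k `*` G k)).
  apply/esym; rewrite -subTset => x _.
  have [i _ Fi] : (\bigcup_i F i) (tuple_uncons x).1 by rewrite -FT.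
  have [j _ Gj] : (\bigcup_i G i) (tuple_uncons x).2 by rewrite -GT.
  exists (maxn i j) => //; split.
    by move: Fi; exact/subsetPset/ndF/leq_maxl.
  by move: Gj; exact/subsetPset/ndG/leq_maxr.
move=> k; have [mF Fk] := Foo k; have [mG Gk] := Goo k; split.
  rewrite -[X in measurable X]setTI; apply: measurable_tuple_uncons => //.
  exact: measurableX.
rewrite /cons_measure /pushforward consK product_measure1E//.
by rewrite lte_mul_pinfty// ge0_fin_numE.
Qed.

HB.instance Definition _ := Measure_isSigmaFinite.Build _ _ _ (cons_measure m)
  mu_sigma_finite.

End cons_measure.

Let lebesgue_tuple_spec n :
  exists m : {sigma_finite_measure set (n.-tuple mR) -> \bar R},
    (m : set _ -> \bar R) = @lebesgue_tuple n.
Proof.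
elim: n => [|n [m mE]]; first by exists (\d_[tuple]).
by exists (cons_measure m); rewrite /= -mE.
Qed.

Variable n : nat.

Let lebesgue_tuple0 : @lebesgue_tuple n set0 = 0.
Proof. by have [m <-] := lebesgue_tuple_spec n. Qed.

Let lebesgue_tuple_ge0 A : 0 <= @lebesgue_tuple n A.
Proof. by have [m <-] := lebesgue_tuple_spec n. Qed.

Let lebesgue_tuple_sigma_additive : semi_sigma_additive (@lebesgue_tuple n).
Proof.
have [m <-] := lebesgue_tuple_spec n; exact: measure_semi_sigma_additive.
Qed.

HB.instance Definition _ := isMeasure.Build _ _ _ (@lebesgue_tuple n)
  lebesgue_tuple0 lebesgue_tuple_ge0 lebesgue_tuple_sigma_additive.

Let lebesgue_tuple_sigma_finite : sigma_finite setT (@lebesgue_tuple n).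
Proof. have [m <-] := lebesgue_tuple_spec n; exact: sigma_finiteT. Qed.

HB.instance Definition _ := Measure_isSigmaFinite.Build _ _ _
  (@lebesgue_tuple n) lebesgue_tuple_sigma_finite.

End lebesgue_tuple.

Section lebesgue_rV.
Context {R : realType} {n : nat}.
Local Notation Rn := 'rV[R]_n.

(* Lebesgue outer measure; it is defined on all sets, and its Caratheodory
   measurable sets are the Lebesgue measurable ones. *)
Definition lebesgue_outer (E : set Rn) : \bar R :=
  mu_ext (@lebesgue_tuple R n) [set u | E (\row_i tnth u i)].

Let leb0 : lebesgue_outer set0 = 0.
Proof. exact: outer_measure0. Qed.

Let leb_ge0 E : 0 <= lebesgue_outer E. Proof. exact: outer_measure_ge0. Qed.

Let le_leb : {homo lebesgue_outer : A B / A `<=` B >-> A <= B}.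
Proof. by move=> A B AB; apply: le_outer_measure => u /AB. Qed.

Let leb_sigma_subadditive : sigma_subadditive lebesgue_outer.
Proof.
move=> F; apply: (le_trans _ (outer_measure_sigma_subadditive _ _)).
by apply: le_outer_measure => u [k _ Fk]; exists k.
Qed.

HB.instance Definition _ := isOuterMeasure.Build R Rn lebesgue_outer
  leb0 leb_ge0 le_leb leb_sigma_subadditive.

Definition lebT := caratheodory_type lebesgue_outer.
HB.instance Definition _ := Measurable.on lebT.

Definition lebesgue_rV : set lebT -> \bar R := lebesgue_outer.
HB.instance Definition _ := isMeasure.Build _ lebT R lebesgue_rV
  (@caratheodory_measure0 _ _ lebesgue_outer)
  (@caratheodory_measure_ge0 _ _ lebesgue_outer)
  (@caratheodory_measure_sigma_additive _ _ lebesgue_outer).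

End lebesgue_rV.

Section morrey_lorentz.
Context {R : realType} {n : nat}.
Local Notation Rn := 'rV[R]_n.
Local Notation mu := (@lebesgue_rV R n).
(* The quasi-norms only depend on the modulus of a function. They take
   \bar R-valued functions, since (\sum_j (lambda_j \1_(Q_j))^v)^(1/v) may be
   infinite on a null set; a complex-valued f enters through cmod f. *)
Implicit Types (g : Rn -> \bar R) (f : Rn -> R[i]) (p q s t : R) (r : \bar R).

Definition cmod f (x : Rn) : \bar R := (Normc.normc (f x))%:E.

Definition cutoff g (E : set Rn) (x : Rn) : \bar R := g x * (\1_E x)%:E.

(* Lebesgue (not merely Borel) measurable complex-valued functions *)
Definition L0 f :=
  measurable_fun [set: lebT] (fun x : lebT => complex.Re (f x) : R) /\
  measurable_fun [set: lebT] (fun x : lebT => complex.Im (f x) : R).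

Definition distribution_fun g (a : R) : \bar R :=
  mu [set x | a%:E < `|g x|].

Definition rearrangement g t : \bar R :=
  ereal_inf [set a%:E | a in [set a : R | (0 < a)%R /\
                                          distribution_fun g a <= t%:E]].

Definition lorentz_norm q r g : \bar R :=
  match r with
  | r'%:E => (\int[lebesgue_measure]_(t in `]0%R, +oo[)
      (((t `^ q^-1)%:E * rearrangement g t) `^ r' * (t^-1)%:E)) `^ r'^-1
  | _ => ereal_sup [set (t `^ q^-1)%:E * rearrangement g t
                   | t in [set t : R | (0 < t)%R]]
  end.

(* Cubes are closed and nondegenerate. *)
Definition is_cube (Q : set Rn) :=
  exists (c : Rn) (l : R), (0 < l)%R /\
    Q = [set x | forall i, (c ord0 i <= x ord0 i <= c ord0 i + l)%R].

Definition morrey_norm p q r g : \bar R :=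
  ereal_sup [set mu Q `^ (p^-1 - q^-1) * lorentz_norm q r (cutoff g Q)
            | Q in is_cube].

Definition weak_morrey_norm p q f : \bar R :=
  ereal_sup [set a%:E *
      morrey_norm p q q%:E (fun x => (\1_[set y : Rn | (a < Normc.normc (f y))%R] x)%:E)
    | a in [set a : R | (0 < a)%R]].

Definition weak_morrey p q f := L0 f /\ weak_morrey_norm p q f < +oo.

Definition lorentz q r f := L0 f /\ lorentz_norm q r (cmod f) < +oo.

Definition lorentz_loc q r f := L0 f /\
  forall K : set Rn, compact K -> lorentz_norm q r (cutoff (cmod f) K) < +oo.

Definition supp f : set Rn := closure [set x | f x != 0%R].

Definition cvg_ae (F : nat -> Rn -> R[i]) f :=
  {ae mu, forall x : lebT, (fun J => cmod (f \- F J)%R x) @ \oo --> 0}.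

Definition cvg_lorentz q r (F : nat -> Rn -> R[i]) f :=
  [/\ forall J, lorentz q r (F J), lorentz q r f &
      (fun J => lorentz_norm q r (cmod (f \- F J)%R)) @ \oo --> 0].

Definition cvg_lorentz_loc q r (F : nat -> Rn -> R[i]) f :=
  [/\ forall J, lorentz_loc q r (F J), lorentz_loc q r f &
      forall K : set Rn, compact K ->
        (fun J => lorentz_norm q r (cutoff (cmod (f \- F J)%R) K)) @ \oo --> 0].

End morrey_lorentz.

(* Main.v *)
Require Import Defs.
From mathcomp Require Import all_boot all_order all_algebra.
From mathcomp Require Import all_classical all_reals all_analysis.
From mathcomp Require Import complex.
From mathcomp Require Import measurable_realfun ring lra.

Set Implicit Arguments.
Unset Strict Implicit.
Unset Printing Implicit Defensive.

Import Order.TTheory GRing.Theory Num.Theory.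
Import numFieldNormedType.Exports.

Local Open Scope classical_set_scope.
Local Open Scope ring_scope.
Local Open Scope ereal_scope.

(** The modulus of [f], its partial sums and its remainders are all dominated by
    [T = (sum_j (lam_j |a_j|)^v)^(1/v)] or by the analogous tails, so everything
    follows from [norm T <= C * norm g], [g] being the function of the hypothesis.

    Fix a cube [Q0] of side [L], let [D] be a superlevel set in [Q0] of a partial
    sum of [T^v], let [d] be its measure, and integrate [T^v] over [D].
    - A cube [Q_j] of side less than [L] contributes, by the weak bound on [a_j],
      about [lam_j^v |Q_j| (|D & Q_j| / |Q_j|)^(1 - v/t)].  Group these cubes by
      the density [|D & Q_j| / |Q_j|], about [2^-i].  By Vitali the cubes of a
      class lie in a set of measure about [2^i d], and [sum lam_j^v |Q_j|] over
      the class is at most the integral of [g^v] over that set, which the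
      rearrangement of [g] controls.
    - The cubes of side at least [L] are grouped by their side, about [2^k L]; the
      Morrey bound on [g] makes the series in [k] converge because [p < s].

    With [1/t < al < 1/q < be < 1/v] and [psi] the maximum of the rearrangement of
    [g] on the triple of [Q0] and of a multiple of the indicator of [(0, |Q0|]],
    the outcome is
    [T*(u) <= C sup_(i, k) 2^(i al - k be) psi (2^(i - k) u)].
    Dilation by [2^i] multiplies the Lorentz norm by [2^(- i / q)], so that this
    supremum is bounded on Lorentz spaces: neither a maximal function nor duality
    is needed, and quasi-norms do no harm. *)

(** * Lebesgue measure of cubes and covering *)

(** The two exponents interlock. Density classes sum with ratio [2^(v/t - al v)], whereas dilation
    by [2^i] leaves [2^(i (al - 1/q))], so [al] must exceed [1/t] and stay below [1/q]. Summing the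
    layers of [g^v] requires [be v < 1], while a contraction by [2^k] costs [2^(k/q)], which
    [2^(-be k)] must beat. The room for both choices is [v < q < t].

    The indicator in [psi] stands for the large cubes. At their scale the Morrey norm of [g] only
    yields the size [|Q0|^(-1/p)], and their atoms have on [Q0] a tail like [(|Q0|/d)^(1/t)].
    Dilating the indicator by [2^i] with weight [2^(i al)] produces about [(|Q0|/d)^al], which is
    larger because [al > 1/t].

    All bounds are expressed through the measure [d] of [D] itself and not through the point [u] at
    which the rearrangement is estimated. If [d] exceeded [u], the monotonicity of [psi] would
    transfer every bound from [u] to [d], and the integral of [T^v] over [D] would contradict the
    level that defines [D]. Partial sums leave finitely many cubes in play, so a finite covering
    argument suffices. *)

Section cubes.
Context {R : realType} {n : nat}.
Local Notation Rn := 'rV[R]_n.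
Local Notation mu := (@lebesgue_rV R n).

Definition cube (c : Rn) (l : R) : set Rn :=
  [set x | forall i, (c ord0 i <= x ord0 i <= c ord0 i + l)%R].

(** The outer measure on row vectors is pulled back from tuples, where Borel sets satisfy the
    Caratheodory condition; testing that condition on preimages transports it to rows. *)
Lemma measurable_row (A : set Rn) :
  measurable [set x : n.-tuple (measurableTypeR R) | A (\row_i tnth x i)] ->
  measurable (A : set lebT).
Proof.
move=> mA; have H : (mu_ext (@lebesgue_tuple R n)).-caratheodory
    [set x | A (\row_i tnth x i)].
  by apply: (@sub_caratheodory _ _ _ (@lebesgue_tuple R n)); exact: sub_sigma_algebra.
have : (@lebesgue_outer R n).-caratheodory A.
  by move=> X; exact: (H [set x | X (\row_i tnth x i)]).
exact.
Qed.

Lemma lebesgue_rV_row (A : set Rn) :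
  measurable [set x : n.-tuple (measurableTypeR R) | A (\row_i tnth x i)] ->
  mu A = lebesgue_tuple [set x | A (\row_i tnth x i)].
Proof. by move=> mA; rewrite /lebesgue_rV /lebesgue_outer measurable_mu_extE. Qed.

Lemma le_lebesgue_rV (A B : set Rn) : A `<=` B -> mu A <= mu B.
Proof. exact: le_outer_measure. Qed.

Lemma lebesgue_rV0 : mu set0 = 0.
Proof. exact: outer_measure0. Qed.

Lemma lebesgue_rVU_le (A B : set Rn) : mu (A `|` B) <= mu A + mu B.
Proof. exact: outer_measureU2. Qed.

Lemma lebesgue_rV_null_subset (A B : set Rn) : A `<=` B -> mu B = 0 -> mu A = 0.
Proof.
by move=> AB B0; apply/eqP; rewrite eq_le measure_ge0 andbT -B0 le_lebesgue_rV.
Qed.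

Lemma measurable_null (A : set Rn) : mu A = 0 -> measurable (A : set lebT).
Proof.
move=> A0; have : (@lebesgue_outer R n).-caratheodory A.
  apply: le_caratheodory_measurable => X.
  rewrite [X in X + _](_ : _ = 0) ?add0e; first exact/le_lebesgue_rV.
  by apply: lebesgue_rV_null_subset A0 => x [].
exact.
Qed.

(** The corner is a sequence over [nat], not over ['I_m], so that the induction can peel off the
    first coordinate by a mere shift of indices. *)
Lemma lebesgue_tuple_box (m : nat) (c : nat -> R) (l : R) : (0 <= l)%R ->
  let B := [set x : m.-tuple (measurableTypeR R) |
             forall i : 'I_m, (c i <= tnth x i <= c i + l)%R] in
  measurable B /\ lebesgue_tuple B = (l ^+ m)%:E.
Proof.
move=> l0; elim: m c => [|m IH] c /=.
  set B := [set x | _].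
  have -> : B = setT by rewrite -subTset => x _ [].
  by split; [exact: measurableT|rewrite diracT expr0].
set B := [set x | _]; pose B' := [set x : m.-tuple (measurableTypeR R) |
             forall i : 'I_m, (c i.+1 <= tnth x i <= c i.+1 + l)%R].
have [mB' eB'] := IH (fun i => c i.+1).
have BE : B = @tuple_uncons R m @^-1` ([set` `[c 0%N, (c 0%N + l)%R]] `*` B').
  apply/seteqP; split => x /= Hx.
    split; first by have := Hx ord0; rewrite in_itv /= (tuple_eta x).
    move=> i; have := Hx (lift ord0 i); rewrite [in X in X -> _](tuple_eta x).
    by rewrite tnthS.
  move: Hx => [Hx0 Hx] i; rewrite (tuple_eta x).
  case: (unliftP ord0 i) => [j|] ->; first by rewrite tnthS; exact: Hx.
  by move: Hx0; rewrite in_itv.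
have mX : measurable ([set` `[c 0%N, (c 0%N + l)%R]] `*` B') by exact: measurableX.
split.
  rewrite BE -[X in measurable X]setTI; exact: measurable_tuple_uncons.
rewrite /cons_measure /pushforward.
have -> : @tuple_cons R m @^-1` B = [set` `[c 0%N, (c 0%N + l)%R]] `*` B'.
  by rewrite BE; apply/funext => x; rewrite /preimage /mkset tuple_consK.
rewrite product_measure1E//; move: eB' => /= ->.
rewrite lebesgue_measure_itv/= lte_fin ltrDl.
rewrite lt_neqAle l0 andbT eq_sym; case: eqP => [->|_] /=.
  by rewrite mul0e exprS mul0r.
by rewrite -EFinB -EFinM exprS; congr (_ * _)%:E; ring.
Qed.

Let cube_box c l :
  [set x : n.-tuple (measurableTypeR R) | cube c l (\row_i tnth x i)] =
  [set x | forall i : 'I_n, let c' k := oapp (c ord0) 0%R (insub k) in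
     (c' i <= tnth x i <= c' i + l)%R].
Proof.
by apply/funext => x; apply: eq_forall => i; rewrite mxE /= valK.
Qed.

Lemma measurable_cube c l : (0 <= l)%R -> measurable (cube c l : set lebT).
Proof.
move=> l0; apply: measurable_row; rewrite cube_box.
exact: (lebesgue_tuple_box n _ l0).1.
Qed.

Lemma lebesgue_cube c l : (0 <= l)%R -> mu (cube c l) = (l ^+ n)%:E.
Proof.
move=> l0; rewrite lebesgue_rV_row cube_box.
  exact: (lebesgue_tuple_box n _ l0).2.
exact: (lebesgue_tuple_box n _ l0).1.
Qed.

Lemma cube_is_cube c l : (0 < l)%R -> is_cube (cube c l).
Proof. by move=> l0; exists c, l. Qed.

End cubes.

Section vitali.
Context {R : realType} {n : nat}.
Local Notation Rn := 'rV[R]_n.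
Local Notation mu := (@lebesgue_rV R n).

Lemma seq_argmax (I : choiceType) (f : I -> R) (s : seq I) : s != [::] ->
  exists2 j, j \in s & forall i, i \in s -> (f i <= f j)%R.
Proof.
elim: s => // a s IH _; have [->|/IH[j js jmax]] := eqVneq s [::].
  by exists a => [|i]; rewrite mem_seq1// => /eqP ->.
have [aj|/ltW ja] := leP (f a) (f j).
  by exists j => [|i]; rewrite inE ?js ?orbT// => /predU1P[->|/jmax].
exists a => [|i]; rewrite inE ?eqxx// => /predU1P[->//|/jmax ij].
exact: le_trans ij ja.
Qed.

Lemma cube_sub3 (c d : Rn) (l m : R) : (m <= l)%R ->
  cube c l `&` cube d m !=set0 -> cube d m `<=` cube (c - const_mx l) (l *+ 3).
Proof.
move=> ml [x [cx dx]] y dy i; rewrite !mxE.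
move: (cx i) (dx i) (dy i) => /andP[? ?] /andP[? ?] /andP[? ?].
by apply/andP; split; lra.
Qed.

(* Finite Vitali covering: a cube of maximal side absorbs, after a threefold
   dilation, all the cubes it meets; recurse on the cubes disjoint from it. *)
Lemma vitali_cubes (I : choiceType) (c : I -> Rn) (l : I -> R) (K : R)
    (D : set Rn) (s : seq I) :
  (0 <= K)%R -> measurable (D : set lebT) -> (forall i, i \in s -> (0 < l i)%R) ->
  (forall i, i \in s -> (l i ^+ n)%:E <= K%:E * mu (D `&` cube (c i) (l i))) ->
  let U := \big[setU/set0]_(i <- s) cube (c i) (l i) in
  mu U <= (3 ^+ n * K)%:E * mu (D `&` U).
Proof.
move=> K0 mD; have [N] := ubnP (size s); elim: N s => // N IH s; rewrite ltnS => sN.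
move=> l0 HK.
have [->|/(seq_argmax l)[j js jmax]] := eqVneq s [::].
  by rewrite /= big_nil setI0 lebesgue_rV0 mule0.
pose P i := `[< cube (c j) (l j) `&` cube (c i) (l i) !=set0 >].
pose s' := [seq i <- s | ~~ P i].
have s's i : i \in s' -> i \in s by rewrite mem_filter => /andP[].
have Pj : P j.
  apply/asboolP; exists (c j); split => i; rewrite lexx lerDl ltW//; exact: l0.
have s'N : (size s' < N)%N.
  apply: leq_trans sN; rewrite size_filter -(count_predC P s) addnC -[ltnLHS]addn0.
  by rewrite ltn_add2l -has_count; apply/hasP; exists j.
have {}IH := IH s' s'N (fun i h => l0 i (s's i h)) (fun i h => HK i (s's i h)).
move: IH; set U' := \big[setU/set0]_(i <- s') _ => /= IH.
set U := \big[setU/set0]_(i <- s) _.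
have mcube i : i \in s -> measurable (cube (c i) (l i) : set lebT).
  by move=> /l0 /ltW; exact: measurable_cube.
have mU' : measurable (U' : set lebT).
  by rewrite /U' big_seq; apply: bigsetU_measurable => i /s's/mcube.
have mU : measurable (U : set lebT).
  by rewrite /U big_seq; apply: bigsetU_measurable => i /mcube.
have U'U : U' `<=` U.
  rewrite /U' /U -!bigcup_seq => x [i /= /s's is_ xi].
  by exists i.
have UU : U `<=` cube (c j - const_mx (l j)) (l j *+ 3) `|` U'.
  rewrite /U' /U -!bigcup_seq => x [i /= is_ xi].
  have [Pi|Pi] := boolP (P i).
    left; move: xi; apply: cube_sub3; [exact: jmax|exact/asboolP].
  by right; exists i => //=; rewrite mem_filter Pi.
have jU : cube (c j) (l j) `<=` U.
  by rewrite /U -bigcup_seq => x jx; exists j.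
have jU' : cube (c j) (l j) `&` U' = set0.
  rewrite -subset0 /U' -bigcup_seq => x [jx [i /=]]; rewrite mem_filter => /andP[+ _] ix.
  by move/negP; apply; apply/asboolP; exists x.
have lj3 : (0 <= l j *+ 3)%R by rewrite mulrn_wge0// ltW// l0.
apply: le_trans (le_lebesgue_rV UU) _.
apply: le_trans (lebesgue_rVU_le _ _) _.
rewrite lebesgue_cube//.
have -> : ((l j *+ 3) ^+ n)%:E = (3 ^+ n)%:E * (l j ^+ n)%:E.
  by rewrite -EFinM -exprMn mulr_natl.
(* The density hypothesis pays for the tripled cube with the part of [D] in the chosen cube. The
   latter is disjoint from [U'], so this part adds to the one spent by the recursion. *)
apply: (@le_trans _ _ ((3 ^+ n * K)%:E *
    (mu (D `&` cube (c j) (l j)) + mu (D `&` U')))).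
  rewrite ge0_muleDr// leeD// EFinM -muleA lee_pmul2l ?lte_fin ?exprn_gt0//.
  exact: HK.
apply: lee_wpmul2l; first by rewrite lee_fin mulr_ge0// exprn_ge0.
rewrite -measureU//; last 3 first.
  by apply: measurableI => //; exact: mcube.
  exact: measurableI.
  by rewrite setIACA setIid jU' setI0.
by apply: le_lebesgue_rV; rewrite -setIUr; apply: setIS; rewrite subUset.
Qed.

End vitali.

(** * Integrals of functions with a weak-type bound *)

Section geometric.
Context {R : realType}.

Lemma nneseries_geometric (a r : R) : (0 <= a)%R -> (0 <= r < 1)%R ->
  \sum_(0 <= k <oo) (a * r ^+ k)%:E = (a / (1 - r))%:E.
Proof.
move=> a0 /andP[r0 r1].
have /cvg_lim <-// : (fun m => \sum_(0 <= k < m) (a * r ^+ k)%:E) @ \oo -->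
    (a / (1 - r))%:E.
under eq_fun do rewrite sumEFin.
apply/cvg_EFin; first by near=> m.
by apply: cvg_geometric_series; rewrite ger0_norm.
Unshelve. all: by end_near. Qed.

Lemma geometric_sum_le (a r : R) (m : nat) : (0 <= a)%R -> (0 <= r < 1)%R ->
  (\sum_(k < m) a * r ^+ k <= a / (1 - r))%R.
Proof.
move=> a0 /[dup] /andP[r0 r1] r01; rewrite -lee_fin -nneseries_geometric//.
rewrite -sumEFin -(big_mkord xpredT (fun k => (a * r ^+ k)%:E)).
by apply: nneseries_lim_ge => k _ _; rewrite lee_fin mulr_ge0// exprn_ge0.
Qed.

Lemma powR2_unbounded (s y : R) : (0 < s)%R -> exists k, (y <= 2 `^ (k%:R * s))%R.
Proof.
move=> s0; set i := Num.bound y; pose k := Num.bound (i%:R / s)%R; exists k.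
have /ltW yi := upper_nthrootP (leqnn i).
apply: le_trans yi _; rewrite -powR_mulrn// ler_powR ?ler1n//.
by rewrite -ler_pdivrMr// ltW// archi_boundP// divr_ge0// ltW.
Qed.

Lemma powR2_lt1 (s : R) : (s < 0)%R -> (0 <= (2 : R) `^ s < 1)%R.
Proof.
move=> s0; rewrite powR_ge0/= -[s]opprK powRN invf_lt1 ?powR_gt0//.
have := @gt0_ltr_powR R (- s) _ 1%R 2%R; rewrite powR1 nnegrE; apply;
  rewrite ?oppr_gt0 ?nnegrE ?ler0n ?ltr1n//.
Qed.

End geometric.

Section weak_type.
Context d (T : measurableType d) (R : realType) (m : {measure set T -> \bar R}).

(** The value of [1 + sum_k 2^((k+1)s) 2^-k]: the base level, plus the height of each layer times
    the decay of its measure. It is finite for [s < 1]. *)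
Definition weak_cst (s : R) : R := (1 + 2 `^ s / (1 - 2 `^ (s - 1)))%R.

Lemma weak_cst_gt0 s : (s < 1)%R -> (0 < weak_cst s)%R.
Proof.
move=> s1; have /andP[? ?] := @powR2_lt1 R (s - 1) ltac:(by rewrite subr_lt0).
by rewrite /weak_cst addr_gt0// divr_gt0 ?powR_gt0// subr_gt0.
Qed.

(* Layers: [f <= M + sum_k M 2^((k+1)s) 1_(f > M 2^(k s))]. *)
Lemma integral_weak_type (B : set T) (f : T -> R) (M u s : R) :
  measurable B -> measurable_fun B f -> (forall x, B x -> (0 <= f x)%R) ->
  (0 < M)%R -> (0 <= u)%R -> (0 < s < 1)%R -> m B <= u%:E ->
  (forall k : nat, m (B `&` [set x | (M * 2 `^ (k%:R * s) < f x)%R]) <=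
     (u / 2 ^+ k)%:E) ->
  \int[m]_(x in B) (f x)%:E <= (weak_cst s * M * u)%:E.
Proof.
move=> mB mf f0 M0 u0 /andP[s0 s1] mBu Hk.
pose b k : R := (M * 2 `^ (k%:R * s))%R.
have b0 k : (0 <= b k)%R by rewrite mulr_ge0 ?powR_ge0// ltW.
pose E k : set T := B `&` [set x | (b k < f x)%R].
have mE k : measurable (E k).
  rewrite /E (_ : [set x | _] = f @^-1` [set` `]b k, +oo[%R]).
    by apply: mf => //; exact: measurable_itv.
  by apply/seteqP; split => x /=; rewrite in_itv/= andbT.
pose h k x : \bar R := (b k.+1 * \1_(E k) x)%:E.
have h0 k x : 0 <= h k x by rewrite lee_fin mulr_ge0.
have mh k D : measurable_fun D (h k).
  apply/measurable_EFinP/measurable_funM; first exact: measurable_cst.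
  exact/measurable_indic.
have fh x : B x -> (f x)%:E <= M%:E + \sum_(0 <= k <oo) h k x.
  move=> Bx; have [fM|Mf] := leP (f x) M.
    by apply: lee_paddr; [exact: nneseries_ge0|rewrite lee_fin].
  have ex : exists k, (f x <= b k)%R.
    have [k] := @powR2_unbounded R s (f x / M) s0; exists k.
    by rewrite /b -ler_pdivrMl// mulrC.
  (* At the least index with [f x <= b k.+1] minimality gives [b k < f x], so the single layer [k]
     already dominates [f x]. Index 0 is excluded by [M < f x]. *)
  case: (ex_minnP ex) => -[|k] fk kmin.
    by move: fk; rewrite /b mul0r powRr0 mulr1 leNgt Mf.
  apply: lee_paddl; first by rewrite lee_fin ltW.
  apply: (@le_trans _ _ (\sum_(0 <= i < k.+1) h i x)); last first.
    by apply: nneseries_lim_ge.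
  rewrite big_nat_recr//=; apply: lee_paddl; first exact: sume_ge0.
  rewrite /h lee_fin indicE mem_set ?mulr1//; split => //=.
  by rewrite ltNge; apply/negP => /kmin; rewrite ltnn.
have mS : measurable_fun B (fun x => \sum_(0 <= k <oo) h k x).
  by apply: ge0_emeasurable_sum => // k x _ _; exact: h0.
have S0 x : 0 <= \sum_(0 <= k <oo) h k x by exact: nneseries_ge0.
have M0' : 0 <= M%:E by rewrite lee_fin ltW.
apply: (@le_trans _ _ (\int[m]_(x in B) (M%:E + \sum_(0 <= k <oo) h k x))).
  apply: ge0_le_integral => //; first exact/measurable_EFinP.
  by apply: emeasurable_funD => //; exact: measurable_cst.
rewrite ge0_integralD//.
rewrite integral_cst// integral_nneseries//.
have -> : (weak_cst s * M * u)%:E =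
    M%:E * u%:E + \sum_(0 <= k <oo) (M * 2 `^ s * u * (2 `^ (s - 1)) ^+ k)%:E.
  rewrite nneseries_geometric; last 2 first.
    by rewrite !mulr_ge0 ?powR_ge0// ltW.
    by apply: powR2_lt1; rewrite subr_lt0.
  by rewrite -EFinM -EFinD /weak_cst; congr EFin; ring.
apply: leeD; first by rewrite lee_wpmul2l// lee_fin ltW.
apply: lee_nneseries => [k _ _|k _]; first by apply: integral_ge0 => x _; exact: h0.
rewrite /h; under eq_integral do rewrite EFinM.
rewrite ge0_integralZl ?lee_fin//; last exact/measurable_EFinP/measurable_indic.
rewrite integral_indic//.
have -> : E k `&` B = E k by apply/setIidPl => x [].
apply: (@le_trans _ _ ((b k.+1)%:E * (u / 2 ^+ k)%:E)).
  by apply: lee_wpmul2l; [rewrite lee_fin|exact: Hk].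
have -> : (2 `^ (s - 1) = 2 `^ s / 2 :> R)%R.
  by rewrite powRB ?pnatr_eq0 ?implybT// powRr1.
have -> : (b k.+1 = M * (2 `^ s) ^+ k.+1)%R.
  by rewrite /b mulrC [(_ * s)%R]mulrC powRrM powR_mulrn ?powR_ge0// mulrC.
by rewrite -EFinM lee_fin expr_div_n exprS le_eqVlt; apply/orP; left; apply/eqP; ring.
Qed.

End weak_type.

(** * Rearrangements and Lorentz norms on the half-line *)

Section rearrangement.
Context {R : realType} {n : nat}.
Local Notation Rn := 'rV[R]_n.
Local Notation mu := (@lebesgue_rV R n).
Implicit Types (f g : Rn -> \bar R) (t u : R).

Lemma rearrangement_ge0 g t : 0 <= rearrangement g t.
Proof. by apply: le_ereal_inf_tmp => _ [a [/ltW a0 _] <-]; rewrite lee_fin. Qed.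

Lemma rearrangement_nonincreasing g t u : (t <= u)%R ->
  rearrangement g u <= rearrangement g t.
Proof.
move=> tu; apply: ereal_inf_le_tmp => _ [a [a0 ga] <-]; exists a => //; split => //.
by apply: le_trans ga _; rewrite lee_fin.
Qed.

Lemma distribution_fun_nonincreasing g (a b : R) : (a <= b)%R ->
  distribution_fun g b <= distribution_fun g a.
Proof.
by move=> ab; apply: le_lebesgue_rV => x /=; apply: le_lt_trans; rewrite lee_fin.
Qed.

Lemma rearrangement_lt g t (x : R) : rearrangement g t < x%:E ->
  distribution_fun g x <= t%:E.
Proof.
move=> /ereal_inf_lt[_ [a [a0 ga] <-]]; rewrite lte_fin => /ltW ax.
exact: le_trans (distribution_fun_nonincreasing g ax) ga.
Qed.

Lemma rearrangement_le g t (x : R) : (0 < x)%R -> distribution_fun g x <= t%:E ->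
  rearrangement g t <= x%:E.
Proof. by move=> x0 gx; apply: ereal_inf_lbound; exists x. Qed.

Lemma le_rearrangement_dist f g t :
  (forall a, (0 < a)%R -> distribution_fun f a <= distribution_fun g a) ->
  rearrangement f t <= rearrangement g t.
Proof.
move=> fg; apply: ereal_inf_le_tmp => _ [a [a0 ga] <-]; exists a => //; split => //.
exact: le_trans (fg _ a0) ga.
Qed.

Lemma le_rearrangement_ae (N : set Rn) f g t : mu N = 0 ->
  (forall x, ~ N x -> `|f x| <= `|g x|) ->
  rearrangement f t <= rearrangement g t.
Proof.
move=> N0 fg; apply: le_rearrangement_dist => a a0.
apply: (@le_trans _ _ (mu (N `|` [set x | a%:E < `|g x|]))).
  apply: le_lebesgue_rV => x /= afx; have [Nx|Nx] := pselect (N x); [by left|right].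
  exact: lt_le_trans afx (fg _ Nx).
by apply: le_trans (lebesgue_rVU_le _ _) _; rewrite [X in X + _]N0 add0e.
Qed.

Lemma le_rearrangement f g t : (forall x, `|f x| <= `|g x|) ->
  rearrangement f t <= rearrangement g t.
Proof.
by move=> fg; apply: (@le_rearrangement_ae set0) => [|x _]; first exact: lebesgue_rV0.
Qed.

(** The level-set estimates are available only at real levels strictly above the bound [W], which
    may be 0 or infinite; letting the level decrease to [W] closes the gap. *)
Lemma rearrangement_le_mul g t (C : R) (W : \bar R) : (0 < C)%R -> 0 <= W ->
  (forall w, (0 < w)%R -> W < w%:E -> distribution_fun g (C * w)%R <= t%:E) ->
  rearrangement g t <= C%:E * W.
Proof.
case: W => [w| |] // C0 W0 H; last by rewrite gt0_muley ?lte_fin// leey.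
apply/lee_addgt0Pr => e e0; rewrite -EFinM -EFinD.
have -> : (C * w + e = C * (w + e / C))%R by field; rewrite gt_eqF.
have we : (w < w + e / C)%R by rewrite ltrDl divr_gt0.
have we0 : (0 < w + e / C)%R by rewrite (le_lt_trans _ we).
by apply: rearrangement_le; [rewrite mulr_gt0|apply: H => //; rewrite lte_fin].
Qed.

End rearrangement.

Section dilation.
Context {R : realType}.
Local Notation leb := (@lebesgue_measure R).

(** The rescaled image measure agrees with Lebesgue measure on half-open intervals, so uniqueness
    applies. *)
Lemma lebesgue_measure_dilation (c : R) (A : set R) : (0 < c)%R ->
  measurable A ->
  leb A = c%:E * leb ( *%R c @^-1` A).
Proof.
move=> c0 mA.
have mc : measurable_fun setT ( *%R c : measurableTypeR R -> measurableTypeR R).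
  exact: measurable_funM.
pose pf := measure_function_pushforward__canonical__measure_function_Measure leb mc.
have c0' : (0 <= c)%R by exact: ltW.
have := @lebesgue_measure_unique R (mscale (NngNum c0') pf) _ A mA.
apply => _ [[a b] _ <-]; rewrite -[RHS]/(c%:E * leb ( *%R c @^-1` `]a, b]%classic)).
have -> : *%R c @^-1` `]a, b]%classic = `](a / c)%R, (b / c)%R]%classic.
  by apply/seteqP; split => x /=; rewrite !in_itv/= ltr_pdivrMr// ler_pdivlMr// mulrC.
rewrite !lebesgue_measure_itv/= !lte_fin ltr_pM2r ?invr_gt0//.
case: ifP => _; last by rewrite mule0.
by rewrite -!EFinB -EFinM; congr EFin; field; rewrite gt_eqF.
Qed.

Lemma ge0_integral_dilation (c : R) (F : R -> \bar R) : (0 < c)%R ->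
  measurable_fun (`]0%R, +oo[%classic : set R) F -> (forall x, (0 < x)%R -> 0 <= F x) ->
  \int[leb]_(x in `]0%R, +oo[) F x =
  c%:E * \int[leb]_(x in `]0%R, +oo[) F (c * x)%R.
Proof.
move=> c0 mF F0.
have mc : measurable_fun setT ( *%R c : measurableTypeR R -> measurableTypeR R).
  exact: measurable_funM.
pose pf := measure_function_pushforward__canonical__measure_function_Measure leb mc.
have c0' : (0 <= c)%R by exact: ltW.
have F0' x : (`]0%R, +oo[%classic : set R) x -> 0 <= F x.
  by rewrite /= in_itv/= andbT => /F0.
transitivity (\int[mscale (NngNum c0') pf]_(x in `]0%R, +oo[) F x).
  apply: eq_measure_integral => A mA _.
  exact: (lebesgue_measure_dilation c0 mA).
rewrite ge0_integral_mscale//=; congr (_ * _).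
rewrite (ge0_integral_pushforward mc)//; last first.
  by move=> x; rewrite inE; exact: F0'.
congr (integral _ _ _); apply/seteqP; split => x /=; rewrite !in_itv/= !andbT.
  by rewrite pmulr_rgt0.
by move=> ?; rewrite mulr_gt0.
Qed.

End dilation.

Section lnorm.
Context {R : realType}.
Local Notation leb := (@lebesgue_measure R).
Local Notation Ipos := (`]0%R, +oo[%classic : set R).
Implicit Types (phi psi : R -> \bar R) (q t u : R) (r : \bar R).

(** The Lorentz functional is detached from rearrangements, since the functions that dominate them
    here, suprema of dilates, are not given as rearrangements of functions on [Rn]. *)
Definition lnorm q r phi : \bar R :=
  match r with
  | r'%:E => (\int[leb]_(t in `]0%R, +oo[)
      (((t `^ q^-1)%:E * phi t) `^ r' * (t^-1)%:E)) `^ r'^-1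
  | _ => ereal_sup [set (t `^ q^-1)%:E * phi t | t in [set t : R | (0 < t)%R]]
  end.

Lemma lorentz_normE (n : nat) q r (g : 'rV[R]_n -> \bar R) :
  lorentz_norm q r g = lnorm q r (rearrangement g).
Proof. by case: r. Qed.

Definition npos phi := measurable_fun Ipos phi /\ forall t, (0 < t)%R -> 0 <= phi t.

Lemma Ipos_mem (t : R) : Ipos t <-> (0 < t)%R.
Proof. by rewrite /= in_itv/= andbT. Qed.

(** The superlevel sets of a monotone function are intervals, hence measurable. *)
Lemma nonincreasing_npos phi :
  (forall t, (0 < t)%R -> 0 <= phi t) ->
  (forall t u, (0 < t)%R -> (t <= u)%R -> phi u <= phi t) -> npos phi.
Proof.
move=> phi0 phid; split => //.
move=> mD; apply: (measurability _ (ErealGenOInfty.measurableE R)) => //.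
move=> _ [_ [x ->] <-].
apply: is_interval_measurable => s t /=; rewrite !in_itv/= ![in X in X -> _]andbT.
move=> [s0 xs] [t0 xt] u /andP[su ut].
have u0 : (0 < u)%R by exact: lt_le_trans su.
move: xt; rewrite andbT => xt.
by split; rewrite in_itv/= andbT// (lt_le_trans xt)// phid.
Qed.

Definition lker q (e : R) phi t : \bar R :=
  ((t `^ q^-1)%:E * phi t) `^ e * (t^-1)%:E.

Lemma lker_ge0 q e phi t : (0 < t)%R -> 0 <= lker q e phi t.
Proof.
by move=> t0; apply: mule_ge0; [exact: poweR_ge0|rewrite lee_fin invr_ge0 ltW].
Qed.

Lemma measurable_inv_pos : measurable_fun Ipos (fun t : R => t^-1 : R)%R.
Proof.
apply: (@eq_measurable_fun _ _ _ _ _ (fun t : R => t `^ (-1))%R).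
  by move=> t /[!inE] /Ipos_mem t0; rewrite powR_inv1// ltW.
apply: measurable_funTS; exact: measurable_powR.
Qed.

Lemma measurable_lker q e phi : npos phi -> measurable_fun Ipos (lker q e phi).
Proof.
move=> [mphi _]; apply: emeasurable_funM; last first.
  by apply/measurable_EFinP; exact: measurable_inv_pos.
apply: (@measurableT_comp _ _ _ _ _ _ (fun x : \bar R => x `^ e)).
  exact: measurable_poweR.
apply: emeasurable_funM => //; apply/measurable_EFinP.
apply: measurable_funTS; exact: measurable_powR.
Qed.

Lemma le_lker q e phi psi t : (0 <= e)%R -> (0 < t)%R -> 0 <= phi t ->
  phi t <= psi t -> lker q e phi t <= lker q e psi t.
Proof.
move=> r0 t0 phi0 h; apply: lee_wpmul2r; first by rewrite lee_fin invr_ge0 ltW.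
have := @gt0_ler_poweR R e r0; apply.
- by rewrite in_itv/= leey andbT mule_ge0// lee_fin powR_ge0.
- by rewrite in_itv/= leey andbT mule_ge0// ?lee_fin ?powR_ge0// (le_trans phi0).
- by apply: lee_wpmul2l => //; rewrite lee_fin powR_ge0.
Qed.

Lemma le_poweR (x y : \bar R) (a : R) : (0 <= a)%R -> 0 <= x -> x <= y ->
  x `^ a <= y `^ a.
Proof.
move=> a0 x0 xy; have := @gt0_ler_poweR R a a0; apply => //.
  by rewrite in_itv/= leey andbT.
by rewrite in_itv/= leey andbT (le_trans x0).
Qed.

Lemma poweRK (x : \bar R) (a : R) : (0 < a)%R -> 0 <= x -> (x `^ a^-1) `^ a = x.
Proof. by move=> a0 x0; rewrite -poweRrM mulVf ?poweRe1// gt_eqF. Qed.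

Lemma poweRVK (x : \bar R) (a : R) : (0 < a)%R -> 0 <= x -> (x `^ a) `^ a^-1 = x.
Proof. by move=> a0 x0; rewrite -poweRrM mulfV ?poweRe1// gt_eqF. Qed.

Lemma le_lnorm q r phi psi : 0 < r -> npos phi -> npos psi ->
  (forall t, (0 < t)%R -> phi t <= psi t) -> lnorm q r phi <= lnorm q r psi.
Proof.
case: r => [r| |] //; rewrite ?lte_fin => r0 nphi npsi h; rewrite /lnorm.
  apply: le_poweR; first by rewrite invr_ge0 ltW.
    by apply: integral_ge0 => t /Ipos_mem; exact: lker_ge0.
  apply: ge0_le_integral => //.
  - by move=> t /Ipos_mem; exact: lker_ge0.
  - exact: measurable_lker nphi.
  - exact: measurable_lker npsi.
  - move=> t /Ipos_mem t0; apply: (@le_lker q r) => //; [exact: ltW|exact: nphi.2|exact: h].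
apply: ge_ereal_sup => _ [t t0 <-]; apply: le_ereal_sup_tmp.
exists ((t `^ q^-1)%:E * psi t); first by exists t.
by apply: lee_wpmul2l; [rewrite lee_fin powR_ge0|exact: h].
Qed.

Lemma lnorm_ge0 q r phi : (forall t, (0 < t)%R -> 0 <= phi t) -> 0 <= lnorm q r phi.
Proof.
move=> phi0; have S : 0 <= ereal_sup [set (t `^ q^-1)%:E * phi t | t in [set t : R | (0 < t)%R]].
  apply: le_ereal_sup_tmp; exists ((1 `^ q^-1)%:E * phi 1%R); first by exists 1%R => /=.
  by rewrite mule_ge0 ?lee_fin ?powR_ge0// phi0.
by case: r => [r| |] //=; exact: poweR_ge0.
Qed.

(** The kernel of a maximum is at most the sum of the kernels, whence [2^(1/r)]. For [r = +oo] the
    conventions [fine +oo = 0] and [0^-1 = 0] turn this factor into 1, so one formula serves both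
    cases. *)
Lemma lnorm_max q r phi psi (X : \bar R) : 0 < r -> npos phi -> npos psi ->
  lnorm q r phi <= X -> lnorm q r psi <= X ->
  lnorm q r (fun t => maxe (phi t) (psi t)) <= (2 `^ (fine r)^-1)%:E * X.
Proof.
move=> + nphi npsi; have nmax : npos (fun t => maxe (phi t) (psi t)).
  split; first by apply: measurable_maxe; [exact: nphi.1|exact: npsi.1].
  by move=> t t0; rewrite le_max nphi.2.
case: r => [r| |] //; rewrite ?lte_fin => r0 hphi hpsi; last first.
  rewrite /= invr0 powRr0 mul1e; apply: ge_ereal_sup => _ [t t0 <-].
  rewrite maxe_pMr// ?lee_fin ?powR_ge0// ge_max; apply/andP; split.
    by apply: le_trans hphi; apply: ereal_sup_ubound; exists t.
  by apply: le_trans hpsi; apply: ereal_sup_ubound; exists t.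
have X0 : 0 <= X by apply: le_trans hphi; apply: lnorm_ge0; exact: nphi.2.
have key phi' : npos phi' -> lnorm q r%:E phi' <= X ->
    \int[leb]_(t in `]0%R, +oo[) lker q r phi' t <= X `^ r.
  move=> n' /(le_poweR (ltW r0) (lnorm_ge0 _ _ n'.2)); rewrite /= poweRK//.
  by apply: integral_ge0 => t /Ipos_mem; exact: lker_ge0.
rewrite /= -poweR_EFin -[X in _ * X](poweRVK r0)// -poweRM ?poweR_ge0//.
apply: le_poweR; first by rewrite invr_ge0 ltW.
  apply: integral_ge0 => t /Ipos_mem t0.
  by apply: (@lker_ge0 q r (fun t => maxe (phi t) (psi t))).
apply: (@le_trans _ _ (\int[leb]_(t in `]0%R, +oo[)
    (lker q r phi t + lker q r psi t))).
  apply: ge0_le_integral => //.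
  - move=> t /Ipos_mem t0.
    by apply: (@lker_ge0 q r (fun t => maxe (phi t) (psi t))).
  - exact: (measurable_lker _ _ nmax).
  - by apply: emeasurable_funD; exact: measurable_lker.
  - move=> t /Ipos_mem t0; rewrite -/(lker q r (fun t => maxe (phi t) (psi t)) t).
    rewrite [X in X <= _](_ : _ = maxe (lker q r phi t) (lker q r psi t)).
      by rewrite ge_max leeDl ?lker_ge0// leeDr ?lker_ge0.
    rewrite /lker; case: (leP (phi t) (psi t)) => h.
      by apply/esym/max_idPr; apply: le_lker => //; [exact: ltW|exact: nphi.2].
    by apply/esym/max_idPl; apply: le_lker => //; [exact: ltW|exact: npsi.2|exact: ltW].
rewrite ge0_integralD//; last 4 first.
  by move=> t /Ipos_mem; exact: lker_ge0.
  exact: measurable_lker.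
  by move=> t /Ipos_mem; exact: lker_ge0.
  exact: measurable_lker.
by rewrite mule_natl mule2n leeD// key.
Qed.

End lnorm.

Section lnorm_dilation.
Context {R : realType}.
Local Notation leb := (@lebesgue_measure R).
Local Notation Ipos := (`]0%R, +oo[%classic : set R).
Implicit Types (phi psi : R -> \bar R) (q t u x y : R) (r : \bar R).

(** The last factor [c], coming from [1/t = c/(ct)], is kept apart: it is the Jacobian that
    disappears upon integration. *)
Lemma lker_dil q (e a c : R) phi t : (0 <= a)%R -> (0 < c)%R -> (0 < t)%R ->
  0 <= phi (c * t)%R ->
  lker q e (fun t => a%:E * phi (c * t)%R) t =
  (a `^ e * c `^ (- (e / q)) * c)%:E * lker q e phi (c * t)%R.
Proof.
move=> a0 c0 t0 phi0; rewrite /lker.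
have -> : (t `^ q^-1)%:E * (a%:E * phi (c * t)%R) =
    (a * c `^ (- q^-1))%:E * (((c * t) `^ q^-1)%:E * phi (c * t)%R).
  rewrite !muleA -!EFinM; congr (_%:E * _).
  rewrite powRM ?(ltW c0) ?(ltW t0)// powRN.
  by field; rewrite gt_eqF// powR_gt0.
have k0 : (0 <= a * c `^ (- q^-1))%R by rewrite mulr_ge0 ?powR_ge0.
rewrite poweRM ?lee_fin//; last by rewrite mule_ge0// lee_fin powR_ge0.
rewrite poweR_EFin powRM ?powR_ge0// -powRrM mulNr [(q^-1 * e)%R]mulrC.
rewrite -muleA muleCA [RHS]muleCA; congr (_ * _).
rewrite -!EFinM; congr EFin; field.
by rewrite !gt_eqF.
Qed.

Lemma measurable_dilation phi (c : R) : (0 < c)%R -> measurable_fun Ipos phi ->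
  measurable_fun Ipos (fun t => phi (c * t)%R).
Proof.
move=> c0 mphi; apply: (@measurable_comp _ _ _ _ _ _ Ipos) => //.
  by move=> _ [t /Ipos_mem t0 <-]; apply/Ipos_mem; rewrite mulr_gt0.
Qed.

Lemma npos_dilation phi (a c : R) : (0 <= a)%R -> (0 < c)%R -> npos phi ->
  npos (fun t => a%:E * phi (c * t)%R).
Proof.
move=> a0 c0 [mphi phi0]; split.
  by apply: emeasurable_funM; [exact: measurable_cst|exact: measurable_dilation].
by move=> t t0; rewrite mule_ge0 ?lee_fin// phi0// mulr_gt0.
Qed.

Lemma integral_lker_dil q (e a c : R) phi : (0 <= a)%R -> (0 < c)%R -> npos phi ->
  \int[leb]_(t in `]0%R, +oo[) lker q e (fun t => a%:E * phi (c * t)%R) t =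
  (a `^ e * c `^ (- (e / q)))%:E * \int[leb]_(t in `]0%R, +oo[) lker q e phi t.
Proof.
move=> a0 c0 nphi; have [mphi phi0] := nphi.
rewrite [in RHS](ge0_integral_dilation c0); last 2 first.
  exact: measurable_lker.
  by move=> t; exact: lker_ge0.
rewrite muleA -EFinM -ge0_integralZl//; last 3 first.
  by apply: measurable_dilation => //; exact: measurable_lker.
  by move=> t /Ipos_mem t0; apply: lker_ge0; rewrite mulr_gt0.
  by rewrite lee_fin !mulr_ge0 ?powR_ge0// ltW.
apply: eq_integral => t /[!inE] /Ipos_mem t0.
by rewrite lker_dil// phi0// mulr_gt0.
Qed.

(* [lnorm] is not subadditive, but replacing the supremum by a sum of [e]-th
   powers turns [lnorm_dil] into a geometric series. *)
Definition dil x y phi t : \bar R :=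
  ereal_sup [set (x ^+ i)%:E * phi (y ^+ i * t)%R | i in [set: nat]].

Lemma dil_ubound x y phi t i : (x ^+ i)%:E * phi (y ^+ i * t)%R <= dil x y phi t.
Proof. by apply: ereal_sup_ubound; exists i. Qed.

Lemma npos_dil x y phi : (0 < x)%R -> (0 < y)%R -> npos phi -> npos (dil x y phi).
Proof.
move=> x0 y0 nphi; split.
  have := @measurable_fun_esups _ _ R Ipos
    (fun i t => (x ^+ i)%:E * phi (y ^+ i * t)%R) _ 0%N.
  have -> : (fun t => esups ((fun i t => (x ^+ i)%:E * phi (y ^+ i * t)%R) ^~ t) 0%N)
      = dil x y phi.
    apply/funext => t; rewrite /esups /dil; congr ereal_sup.
    by apply/seteqP; split => [_ [i _ <-]|_ [i _ <-]]; exists i.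
  apply => // i.
  by have [] : npos (fun t => (x ^+ i)%:E * phi (y ^+ i * t)%R)
    by apply: npos_dilation; rewrite ?exprn_ge0 ?exprn_gt0// ltW.
move=> t t0; apply: le_trans (dil_ubound x y phi t 0%N).
by rewrite expr0 mul1e expr0 mul1r nphi.2.
Qed.

Lemma lker_dil_le q (e : R) x y phi t : (0 < e)%R -> (0 < x)%R -> (0 < y)%R ->
  (0 < t)%R -> npos phi ->
  lker q e (dil x y phi) t <=
  \sum_(0 <= i <oo) lker q e (fun t => (x ^+ i)%:E * phi (y ^+ i * t)%R) t.
Proof.
move=> e0 x0 y0 t0 nphi.
pose A i := (x ^+ i)%:E * phi (y ^+ i * t)%R.
have A0 i : 0 <= A i.
  by rewrite mule_ge0 ?lee_fin ?exprn_ge0 ?(ltW x0)// nphi.2// mulr_gt0// exprn_gt0.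
have tq : (0 < t `^ q^-1)%R by rewrite powR_gt0.
have B0 i : 0 <= ((t `^ q^-1)%:E * A i) `^ e by exact: poweR_ge0.
have -> : \sum_(0 <= i <oo) lker q e (fun t => (x ^+ i)%:E * phi (y ^+ i * t)%R) t
    = (\sum_(0 <= i <oo) ((t `^ q^-1)%:E * A i) `^ e) * (t^-1)%:E.
  rewrite muleC -nneseriesZl//.
  by apply: eq_eseriesr => i _; rewrite muleC.
apply: lee_wpmul2r; first by rewrite lee_fin invr_ge0 ltW.
set S := \sum_(0 <= i <oo) _.
have S0 : 0 <= S by exact: nneseries_ge0.
rewrite -[leRHS](poweRK e0 S0); apply: le_poweR; first exact: ltW.
  by rewrite mule_ge0 ?lee_fin ?(ltW tq)// (npos_dil _ _ _).2.
(* Taking [e]-th roots of the series first lets the supremum be bounded term by term, without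
   exchanging it with a power. *)
rewrite -lee_pdivlMl//; apply: ge_ereal_sup => _ [i _ <-].
rewrite lee_pdivlMl// -/(A i) -[leLHS](poweRVK e0).
  apply: le_poweR => //; first by rewrite invr_ge0 ltW.
  rewrite /S; apply: le_trans (nneseries_lim_ge i.+1 _) => //.
  rewrite big_nat_recr//=; apply: lee_paddl => //; exact: sume_ge0.
by rewrite mule_ge0// lee_fin ltW.
Qed.

(** The [i]-th dilate has norm at most [z^i] times that of [phi], where [z = x y^(-1/q)]. For finite
    [r = e] the [e]-th powers form a geometric series, which gives [(1 - z^e)^(-1/e)]; for [r = +oo]
    the largest factor is [z^0 = 1]. *)
Lemma lnorm_dil q r x y : (0 < q)%R -> 0 < r -> (0 < x)%R -> (0 < y)%R ->
  (x * y `^ (- q^-1) < 1)%R ->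
  exists2 C : R, (0 < C)%R & forall phi, npos phi ->
    lnorm q r (dil x y phi) <= C%:E * lnorm q r phi.
Proof.
move=> q0 + x0 y0; set z := (x * _)%R => + z1.
have z0 : (0 < z)%R by rewrite mulr_gt0// powR_gt0.
case: r => [e| |] //; rewrite ?lte_fin => r0; last first.
  exists 1%R => // phi nphi; rewrite mul1e.
  apply: ge_ereal_sup => _ [t t0 <-]; rewrite -lee_pdivlMl ?powR_gt0//.
  apply: ge_ereal_sup => _ [i _ <-]; rewrite lee_pdivlMl ?powR_gt0//.
  have yt0 : (0 < y ^+ i * t)%R by rewrite mulr_gt0// exprn_gt0.
  apply: (@le_trans _ _ (((y ^+ i * t) `^ q^-1)%:E * phi (y ^+ i * t)%R)); last first.
    by apply: ereal_sup_ubound; exists (y ^+ i * t)%R.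
  rewrite muleA; apply: lee_wpmul2r; first exact: nphi.2.
  rewrite -EFinM lee_fin mulrC powRM ?exprn_ge0 ?(ltW y0) ?(ltW t0)//.
  rewrite ler_pM2r ?powR_gt0//.
  have -> : ((y ^+ i) `^ q^-1 = (y `^ q^-1) ^+ i)%R.
    by rewrite -(powR_mulrn i (ltW y0)) -(powR_mulrn i (powR_ge0 y q^-1)) -!powRrM mulrC.
  rewrite lerXn2r ?nnegrE ?powR_ge0 ?(ltW x0)//.
  by move: z1; rewrite /z powRN ltr_pdivrMr ?powR_gt0// mul1r => /ltW.
have ze : (0 <= z `^ e < 1)%R.
  rewrite powR_ge0/=; have := @gt0_ltr_powR R e r0 z 1%R; rewrite powR1.
  by apply; rewrite ?nnegrE ?(ltW z0).
exists (((1 - z `^ e)^-1) `^ e^-1)%R.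
  by rewrite powR_gt0// invr_gt0 subr_gt0; case/andP: ze.
move=> phi nphi; have [mphi phi0] := nphi.
have I0 : 0 <= \int[leb]_(t in `]0%R, +oo[) lker q e phi t.
  by apply: integral_ge0 => t /Ipos_mem; exact: lker_ge0.
rewrite /= -poweR_EFin -poweRM ?lee_fin ?invr_ge0 ?subr_ge0; last 2 first.
  by case/andP: ze => _ /ltW.
  exact: I0.
apply: le_poweR; first by rewrite invr_ge0 ltW.
  by apply: integral_ge0 => t /Ipos_mem t0; apply: (@lker_ge0 _ q e (dil x y phi)).
pose f i t := lker q e (fun t => (x ^+ i)%:E * phi (y ^+ i * t)%R) t.
have nf i : npos (fun t => (x ^+ i)%:E * phi (y ^+ i * t)%R).
  by apply: npos_dilation; rewrite ?exprn_ge0 ?exprn_gt0// ltW.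
have f0 i t : Ipos t -> 0 <= f i t by move=> /Ipos_mem; exact: lker_ge0.
apply: (@le_trans _ _ (\int[leb]_(t in `]0%R, +oo[) \sum_(0 <= i <oo) f i t)).
  apply: ge0_le_integral => //.
  - by move=> t /Ipos_mem t0; apply: (@lker_ge0 _ q e (dil x y phi)).
  - exact: (measurable_lker q e (npos_dil x0 y0 nphi)).
  - by apply: ge0_emeasurable_sum => // [i t + _|i _]; [exact: f0|exact: measurable_lker].
  - by move=> t /Ipos_mem t0; exact: lker_dil_le.
rewrite integral_nneseries//; last by move=> i; exact: measurable_lker.
under eq_eseriesr => i _.
  rewrite integral_lker_dil ?exprn_ge0 ?exprn_gt0 ?(ltW x0)//.
  rewrite [X in X%:E](_ : _ = 1 * (z `^ e) ^+ i)%R; last first.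
    rewrite mul1r -!powR_mulrn ?powR_ge0 ?(ltW x0) ?(ltW y0)// -!powRrM.
    rewrite /z powRM ?powR_ge0 ?(ltW x0)// -!powRrM; congr (_ `^ _ * _ `^ _)%R.
      by rewrite mulrC.
    by field; rewrite gt_eqF.
  over.
case: (\int[leb]_(t in _) _) I0 => [I| |] //; rewrite ?lee_fin => I0.
  under eq_eseriesr do rewrite mul1r muleC.
  rewrite nneseriesZl//; last by move=> i _; rewrite lee_fin exprn_ge0// powR_ge0.
  under eq_eseriesr do rewrite -[X in X%:E]mul1r.
  by rewrite nneseries_geometric// mul1r muleC.
by rewrite gt0_muley ?leey// lte_fin invr_gt0 subr_gt0; case/andP: ze.
Qed.

End lnorm_dilation.

Section lnorm_bounds.
Context {R : realType}.
Local Notation leb := (@lebesgue_measure R).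
Local Notation Ipos := (`]0%R, +oo[%classic : set R).
Implicit Types (phi psi : R -> \bar R) (q t u x y : R) (r : \bar R).

Lemma powR_le1 (t a : R) : (0 <= t <= 1)%R -> (0 <= a)%R -> (t `^ a <= 1)%R.
Proof.
move=> /andP[t0 t1] a0; have := @ge0_ler_powR R a a0 t 1%R.
by rewrite powR1 !nnegrE; apply.
Qed.

Lemma cvge0P (u : nat -> \bar R) : (forall k, 0 <= u k) ->
  u @ \oo --> 0 <-> (forall e, (0 < e)%R -> \forall k \near \oo, u k <= e%:E).
Proof.
move=> u0; split.
  move=> /fine_cvgP[ufin /cvgrPdist_le H] e e0.
  near=> k; have ufk : u k \is a fin_num by near: k.
  rewrite -(fineK ufk) lee_fin.
  have : (`|0 - fine (u k)| <= e)%R by near: k; exact: H.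
  by rewrite sub0r normrN ger0_norm// fine_ge0.
move=> H; apply/fine_cvgP; split.
  near=> k; rewrite ge0_fin_numE//; apply: (@le_lt_trans _ _ 1%:E) => //.
    by near: k; exact: H.
  exact: ltry.
apply/cvgrPdist_le => e e0; near=> k.
have uke : u k <= e%:E by near: k; exact: H.
rewrite sub0r normrN ger0_norm ?fine_ge0// -lee_fin fineK//.
by rewrite ge0_fin_numE// (le_lt_trans uke)// ltry.
Unshelve. all: by end_near. Qed.

Lemma cvge0_poweR (u : nat -> \bar R) (a : R) : (0 < a)%R -> (forall k, 0 <= u k) ->
  u @ \oo --> 0 -> (fun k => u k `^ a) @ \oo --> 0.
Proof.
move=> a0 u0 /(cvge0P u0) H; apply/cvge0P => [k|e e0]; first exact: poweR_ge0.
have := H (e `^ a^-1)%R (powR_gt0 _ e0); apply: filterS => k uk.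
have -> : e%:E = (e `^ a^-1)%:E `^ a.
  by rewrite poweR_EFin -powRrM mulVf ?gt_eqF// powRr1// ltW.
by apply: le_poweR => //; exact: ltW.
Qed.

Lemma cvge0_le (u v : nat -> \bar R) : (forall k, 0 <= u k <= v k) ->
  v @ \oo --> 0 -> u @ \oo --> 0.
Proof.
move=> uv v0.
apply: (@squeeze_cvge _ _ _ _ (fun=> 0) _ v); [exact: nearW|exact: cvg_cst|exact: v0].
Qed.

Lemma lnorm_scale_le q r phi (a c : R) : 0 < r -> (0 <= a)%R -> (0 < c)%R ->
  npos phi ->
  lnorm q r (fun t => a%:E * phi (c * t)%R) <= (a * c `^ (- q^-1))%:E * lnorm q r phi.
Proof.
case: r => [r| |] //; rewrite ?lte_fin => r0 a0 c0 nphi; rewrite /lnorm.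
  rewrite -/(lker q r (fun t => a%:E * phi (c * t)%R)).
  rewrite (integral_lker_dil _ _ a0 c0 nphi).
  have I0 : 0 <= \int[leb]_(t in `]0%R, +oo[) lker q r phi t.
    by apply: integral_ge0 => t /Ipos_mem; apply: lker_ge0.
  rewrite poweRM//; last by rewrite lee_fin mulr_ge0 ?powR_ge0.
  rewrite poweR_EFin powRM ?powR_ge0// -!powRrM mulfV ?gt_eqF// powRr1//.
  by rewrite mulNr mulrAC mulfV ?gt_eqF// mul1r.
apply: ge_ereal_sup => _ [t t0 <-].
have ct : (0 < c * t)%R by rewrite mulr_gt0.
rewrite muleA -EFinM.
rewrite [X in X%:E * _](_ : _ = a * c `^ (- q^-1) * (c * t) `^ q^-1)%R; last first.
  rewrite powRM ?(ltW c0) ?(ltW t0)// powRN; field.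
  by rewrite gt_eqF// powR_gt0.
rewrite EFinM -muleA; apply: lee_wpmul2l; first by rewrite lee_fin mulr_ge0 ?powR_ge0.
by apply: ereal_sup_ubound; exists (c * t)%R.
Qed.

Lemma lnormZ_le q r phi (a : R) : 0 < r -> (0 <= a)%R -> npos phi ->
  lnorm q r (fun t => a%:E * phi t) <= a%:E * lnorm q r phi.
Proof.
move=> r0 a0 nphi; have := lnorm_scale_le q r0 a0 ltr01 nphi.
rewrite powR1 mulr1; congr (lnorm _ _ _ <= _).
by apply/funext => t; rewrite mul1r.
Qed.

Definition step (u t : R) : \bar R := ((t <= u)%R%:R)%:E.

Lemma step_ge0 u t : 0 <= step u t. Proof. by rewrite lee_fin. Qed.

Lemma step_nonincreasing u t t' : (t <= t')%R -> step u t' <= step u t.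
Proof.
rewrite /step lee_fin ler_nat => tt'.
by case: (leP t' u) => // /(le_trans tt') ->.
Qed.

Lemma npos_step u : npos (step u).
Proof.
by apply: nonincreasing_npos => *; [exact: step_ge0|exact: step_nonincreasing].
Qed.

(* [step u] is a dilate of [step 1], and [step 1] is the supremum of the dyadic
   dilates of the indicator of [(1/2, 1]], hence controlled by [lnorm_dil]. *)
Lemma lnorm_step q r : (0 < q)%R -> 0 < r ->
  exists2 C : R, (0 < C)%R & forall u, (0 < u)%R ->
    lnorm q r (step u) <= (C * u `^ q^-1)%:E.
Proof.
move=> q0 r0; pose phi1 t : \bar R := ((2^-1 < t <= 1)%R%:R)%:E.
have phi1E : phi1 = EFin \o \1_(`]2^-1%R, 1%R]%classic : set R).
  apply/funext => t; rewrite /phi1 /= indicE; congr (_%:R)%:E.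
  by apply/esym; rewrite mem_setE /= in_itv.
have nphi1 : npos phi1.
  split; last by move=> t _; rewrite lee_fin.
  by rewrite phi1E; apply/measurable_EFinP; apply: measurable_indic; exact: measurable_itv.
have fin1 : lnorm q r phi1 < +oo.
  case: r r0 => [r| |] //; rewrite ?lte_fin => r0; last first.
    apply: (@le_lt_trans _ _ 1%:E); last exact: ltry.
    apply: ge_ereal_sup => _ [t t0 <-]; rewrite /phi1 -EFinM lee_fin.
    case: andP => [[_ t1]|_]; last by rewrite mulr0.
    by rewrite mulr1 powR_le1 ?invr_ge0 ?(ltW q0)// (ltW t0).
  rewrite /lnorm; apply: poweR_lty.
  apply: (@le_lt_trans _ _ (\int[leb]_(t in `]0%R, +oo[)
      ((2 : R)%:E * (\1_(`]2^-1%R, 1%R]%classic : set R) t)%:E))).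
    apply: ge0_le_integral => //.
    - by move=> t /Ipos_mem; apply: (@lker_ge0 _ q r phi1).
    - exact: (measurable_lker q r nphi1).
    - apply: emeasurable_funM; first exact: measurable_cst.
      by apply/measurable_EFinP; apply: measurable_indic; exact: measurable_itv.
    - move=> t /Ipos_mem t0; rewrite phi1E /lker /=.
      rewrite indicE mem_setE /= in_itv/=; case: andP => [[t2 t1]|_]; last first.
        by rewrite mulr0n mulr0 powR0 ?gt_eqF// mul0e mule0.
      rewrite !mulr1 -!EFinM lee_fin mulr1 -powRrM -[leRHS]mul1r ler_pM ?powR_ge0//.
      + by rewrite invr_ge0 ltW.
      + by rewrite powR_le1 ?mulr_ge0 ?invr_ge0 ?(ltW q0) ?(ltW r0)// (ltW t0).
      + by rewrite invf_ple ?posrE// ltW.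
  rewrite ge0_integralZl//; last first.
    by apply/measurable_EFinP; apply: measurable_indic; exact: measurable_itv.
  rewrite integral_indic//=.
  rewrite lte_mul_pinfty//; apply: (@le_lt_trans _ _ (leb (`]2^-1%R, 1%R]%classic : set R))).
    by apply: le_measure; rewrite ?inE//; apply: measurableI.
  rewrite lebesgue_measure_itv/=; case: ifP => _ //; exact: ltry.
have [C C0 HC] : exists2 C : R, (0 < C)%R & forall phi, npos phi ->
    lnorm q r (dil 1 2 phi) <= C%:E * lnorm q r phi.
  apply: lnorm_dil => //.
  by rewrite mul1r; case/andP: (@powR2_lt1 R (- q^-1) ltac:(by rewrite oppr_lt0 invr_gt0)).
have nd1 : npos (dil 1 2 phi1) by exact: npos_dil.
have l0 : 0 <= lnorm q r phi1 by apply: lnorm_ge0; exact: nphi1.2.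
have lf : lnorm q r phi1 \is a fin_num by rewrite ge0_fin_numE.
exists (C * (fine (lnorm q r phi1) + 1))%R.
  by rewrite mulr_gt0// ltr_wpDl// fine_ge0.
move=> u u0; have u0' : (0 < u^-1)%R by rewrite invr_gt0.
apply: (@le_trans _ _ (lnorm q r (fun t => 1%:E * dil 1 2 phi1 (u^-1 * t)%R))).
  apply: le_lnorm => //; first exact: npos_step.
    exact: npos_dilation.
  move=> t t0; rewrite mul1e /step; have [tu|tu] := leP t u; last first.
    by rewrite nd1.2// mulr_gt0.
  set s := (u^-1 * t)%R.
  have s0 : (0 < s)%R by rewrite mulr_gt0.
  have s1 : (s <= 1)%R by rewrite /s ler_pdivrMl// mulr1.
  (* The least such [k] places [2^k s] in [(1/2, 1]]: by minimality if [k > 0], and by [s <= 1] if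
     [k = 0]. *)
  have ex : exists k, (2^-1 < 2 ^+ k * s)%R.
    exists (Num.bound s^-1); rewrite -ltr_pdivrMr//.
    apply: le_lt_trans (upper_nthrootP (leqnn _)).
    by rewrite ler_piMl ?invr_ge0 ?ltW// invf_lt1// ltr1n.
  case: (ex_minnP ex) => k ks kmin.
  apply: le_trans (dil_ubound 1 2 phi1 s k).
  rewrite expr1n mul1e /phi1 ks /= lee_fin.
  suff -> : (2 ^+ k * s <= 1)%R by [].
  case: k ks kmin => [|k] ks kmin; first by rewrite expr0 mul1r.
  rewrite leNgt; apply/negP => h; have /kmin : (2^-1 < 2 ^+ k * s)%R.
    by move: h; rewrite exprS -mulrA => h; rewrite -[ltLHS]mulr1 ltr_pdivrMl.
  by rewrite ltnn.
apply: le_trans (lnorm_scale_le _ _ _ _ nd1) _ => //.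
rewrite mul1r -(powR_inv1 (ltW u0)) -powRrM mulN1r opprK.
rewrite mulrC EFinM; apply: lee_wpmul2l; first by rewrite lee_fin powR_ge0.
apply: le_trans (HC _ nphi1) _; rewrite EFinM; apply: lee_wpmul2l; first by rewrite lee_fin ltW.
by rewrite EFinD fineK// leeDl.
Qed.

(** On [(u/2, u]] a nonincreasing [phi] is at least [phi u]. Replacing [t^(1/q)] by its value at
    [u/2] costs [2^(1/q)], and the mass at least [1/2] of [dt/t] on this interval costs
    [2^(1/r)]. *)
Lemma lnorm_embed q r : (0 < q)%R -> 0 < r ->
  exists2 C : R, (0 < C)%R & forall phi u, (0 < u)%R ->
    (forall t, (0 < t)%R -> 0 <= phi t) ->
    (forall t t', (0 < t)%R -> (t <= t')%R -> phi t' <= phi t) ->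
    (u `^ q^-1)%:E * phi u <= C%:E * lnorm q r phi.
Proof.
move=> q0; case: r => [r| |] //; rewrite ?lte_fin => r0; last first.
  exists 1%R => // phi u u0 _ _; rewrite mul1e.
  by apply: ereal_sup_ubound; exists u.
exists (2 `^ q^-1 * 2 `^ r^-1)%R; first by rewrite mulr_gt0// powR_gt0.
move=> phi u u0 phi0 phid; have nphi := nonincreasing_npos phi0 phid.
set X := (u `^ q^-1)%:E * phi u.
have X0 : 0 <= X by rewrite mule_ge0 ?lee_fin ?powR_ge0// phi0.
pose Y := ((u / 2) `^ q^-1)%:E * phi u.
have Y0 : 0 <= Y by rewrite mule_ge0 ?lee_fin ?powR_ge0// phi0.
have XY : X = (2 `^ q^-1)%:E * Y.
  rewrite /X /Y muleA -EFinM -powRM//; last by rewrite divr_ge0// ltW.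
  by congr ((_ `^ _)%:E * _); field.
rewrite XY EFinM -muleA; apply: lee_wpmul2l; first by rewrite lee_fin powR_ge0.
have I0 : 0 <= \int[leb]_(t in `]0%R, +oo[) lker q r phi t.
  by apply: integral_ge0 => t /Ipos_mem; apply: lker_ge0.
rewrite /= -poweR_EFin -poweRM ?lee_fin//.
rewrite -[leLHS](poweRVK r0)//; apply: le_poweR; first by rewrite invr_ge0 ltW.
  exact: poweR_ge0.
rewrite -lee_pdivrMl//.
pose J := (`](u / 2)%R, u]%classic : set R).
have mJ : measurable J by exact: measurable_itv.
have JI : J `<=` Ipos.
  move=> t; rewrite /J /= in_itv/= => /andP[ut _]; apply/Ipos_mem.
  by apply: lt_trans ut; rewrite divr_gt0.
apply: (@le_trans _ _ (\int[leb]_(t in J) lker q r phi t)); last first.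
  apply: ge0_subset_integral => //; first exact: measurable_lker.
  by move=> t /Ipos_mem; apply: lker_ge0.
apply: (@le_trans _ _ (\int[leb]_(t in J) (Y `^ r * (u^-1)%:E))).
  have lJ : leb J = (u / 2)%:E.
    rewrite /J lebesgue_measure_itv/= lte_fin ltr_pdivrMr// mulr_natr mulr2n ltrDl u0.
    by rewrite -EFinB; congr EFin; field.
  rewrite integral_cst// [X in _ <= _ * X]lJ -muleA -EFinM muleC.
  rewrite [X in _ <= _ * X%:E](_ : _ = 2^-1)%R//.
  by field; rewrite gt_eqF.
apply: ge0_le_integral => //.
- by move=> t _; rewrite mule_ge0 ?poweR_ge0// lee_fin invr_ge0 ltW.
- by apply: measurable_funS JI _ => //; exact: measurable_lker.
move=> t; rewrite /J /= in_itv/= => /andP[ut tu].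
have t0 : (0 < t)%R by apply: lt_trans ut; rewrite divr_gt0.
apply: lee_pmul.
- exact: poweR_ge0.
- by rewrite lee_fin invr_ge0 ltW.
- apply: le_poweR; [exact: ltW|exact: Y0|].
  apply: lee_pmul; rewrite ?lee_fin ?powR_ge0 ?phi0//; last exact: phid.
  by rewrite ge0_ler_powR ?invr_ge0 ?(ltW q0) ?nnegrE ?(ltW t0) ?divr_ge0 ?(ltW u0) ?(ltW ut).
- by rewrite lee_fin lef_pV2 ?posrE.
Qed.

(** Dominated convergence with the kernel of [phi 0] as majorant; here the finiteness of the second
    Lorentz exponent enters. *)
Lemma lnorm_cvg0 q (e : R) (phi : nat -> R -> \bar R) : (0 < e)%R ->
  (forall k, npos (phi k)) ->
  (forall k t, (0 < t)%R -> phi k t <= phi 0%N t) ->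
  lnorm q e%:E (phi 0%N) < +oo ->
  (forall t, (0 < t)%R -> phi ^~ t @ \oo --> 0) ->
  (fun k => lnorm q e%:E (phi k)) @ \oo --> 0.
Proof.
move=> e0 nphi phile fin0 phicvg.
have I0 k : 0 <= \int[leb]_(t in `]0%R, +oo[) lker q e (phi k) t.
  by apply: integral_ge0 => t /Ipos_mem; apply: lker_ge0.
apply: cvge0_poweR => //; first by rewrite invr_gt0.
have fI : \int[leb]_(t in `]0%R, +oo[) lker q e (phi 0%N) t < +oo.
  by apply: lty_poweRy fin0; rewrite invr_neq0// gt_eqF.
have [] := @dominated_convergence _ _ _ leb Ipos _ (fun k => lker q e (phi k)) (cst 0)
   (lker q e (phi 0%N)).
- exact: measurable_itv.
- by move=> k; exact: measurable_lker.
- exact: measurable_cst.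
- apply: aeW => t /Ipos_mem t0; rewrite /lker.
  rewrite -(mul0e (t^-1)%:E); apply: cvgeZr => //.
  apply: cvge0_poweR => // [k|]; first by rewrite mule_ge0 ?lee_fin ?powR_ge0// (nphi k).2.
  by rewrite -(mule0 (t `^ q^-1)%:E); apply: cvgeZl => //; exact: phicvg.
- apply/integrableP; split; first exact: measurable_lker.
  under eq_integral => t /[!inE] /Ipos_mem t0.
    rewrite gee0_abs ?lker_ge0//; over.
  exact: fI.
- apply: aeW => t k /Ipos_mem t0; rewrite gee0_abs ?lker_ge0//.
  by apply: le_lker => //; [exact: ltW|exact: (nphi k).2|exact: phile].
by move=> _ _; rewrite integral0.
Qed.

(** Monotone convergence applied to the kernels. The kernel of [psi] is compared with their limit by
    inverting the powers, so that only the values of the [phi k] have to be bounded. *)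
Lemma lnorm_sup_le q (e : R) (phi : nat -> R -> \bar R) psi X : (0 < e)%R ->
  (forall k, npos (phi k)) -> npos psi ->
  (forall k t, (0 < t)%R -> phi k t <= phi k.+1 t) ->
  (forall t, (0 < t)%R -> psi t <= ereal_sup [set phi k t | k in setT]) ->
  (forall k, lnorm q e%:E (phi k) <= X) -> lnorm q e%:E psi <= X.
Proof.
move=> e0 nphi npsi phind psile HX.
have I0 f : npos f -> 0 <= \int[leb]_(t in `]0%R, +oo[) lker q e f t.
  by move=> nf; apply: integral_ge0 => t /Ipos_mem; apply: lker_ge0.
have X0 : 0 <= X by apply: le_trans (HX 0%N); apply: lnorm_ge0; exact: (nphi _).2.
have HX' k : \int[leb]_(t in `]0%R, +oo[) lker q e (phi k) t <= X `^ e.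
  rewrite -[leLHS](poweRK e0 (I0 _ (nphi k))).
  by apply: le_poweR; [exact: ltW|exact: poweR_ge0|exact: HX].
have nd k t : (0 < t)%R -> lker q e (phi k) t <= lker q e (phi k.+1) t.
  move=> t0; apply: le_lker => //; [exact: ltW|exact: (nphi k).2|exact: phind].
have ndl t : (0 < t)%R -> {homo (fun k => lker q e (phi k) t) : k m / (k <= m)%N >-> k <= m}.
  by move=> t0; apply/nondecreasing_seqP => k; exact: nd.
rewrite -[leRHS](poweRVK e0 X0) /=; apply: le_poweR; first by rewrite invr_ge0 ltW.
  exact: (I0 _ npsi).
have mc := @monotone_convergence _ _ _ leb Ipos (measurable_itv _)
  (fun k => lker q e (phi k)) (fun k => measurable_lker q e (nphi k))
  (fun k t h => lker_ge0 q e (phi k) ((Ipos_mem t).1 h))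
  (fun t h => ndl t ((Ipos_mem t).1 h)).
apply: (@le_trans _ _ (\int[leb]_(t in Ipos) limn (fun k => lker q e (phi k) t))).
  apply: ge0_le_integral => //.
  - by move=> t /Ipos_mem; apply: (@lker_ge0 _ q e psi).
  - exact: (measurable_lker q e npsi).
  - apply: (emeasurable_fun_cvg (fun k => lker q e (phi k))).
      by move=> k; exact: measurable_lker.
    by move=> t /Ipos_mem t0; exact: ereal_nondecreasing_is_cvgn (ndl t t0).
  - move=> t /Ipos_mem t0.
    set S := limn _.
    have kS k : lker q e (phi k) t <= S.
      rewrite /S (cvg_lim _ (ereal_nondecreasing_cvgn (ndl t t0)))//.
      by apply: ereal_sup_ubound; exists k.
    have tq : (0 < t `^ q^-1)%R by rewrite powR_gt0.
    have tS : 0 <= S * t%:E.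
      by rewrite mule_ge0 ?lee_fin ?(ltW t0)// (le_trans _ (kS 0%N))// lker_ge0.
    rewrite /lker lee_pdivrMr//.
    rewrite -[leRHS](poweRK e0)//; apply: le_poweR; first exact: ltW.
      by rewrite mule_ge0 ?lee_fin ?(ltW tq)// npsi.2.
    rewrite -lee_pdivlMl//; apply: le_trans (psile t t0) _.
    apply: ge_ereal_sup => _ [k _ <-].
    rewrite lee_pdivlMl// -[leLHS](poweRVK e0); last first.
      by rewrite mule_ge0 ?lee_fin ?(ltW tq)// (nphi k).2.
    apply: le_poweR; [by rewrite invr_ge0 ltW|exact: poweR_ge0|].
    by rewrite -lee_pdivrMr//; exact: kS.
rewrite mc; apply: lime_le.
  apply: ereal_nondecreasing_is_cvgn; apply/nondecreasing_seqP => k.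
  apply: ge0_le_integral => //.
  - by move=> t /Ipos_mem; apply: lker_ge0.
  - exact: measurable_lker.
  - exact: measurable_lker.
  - by move=> t /Ipos_mem; exact: nd.
by apply: nearW => k; exact: HX'.
Qed.

End lnorm_bounds.

(** * The level-set estimate *)

Section expR_form.
Context {R : realType}.

(** Writing every positive base as an exponential reduces identities between products of real powers
    to identities between exponents, which [ring] and [field] decide. *)
Lemma pos_expR (x : R) : (0 < x)%R -> exists y, x = expR y.
Proof. by move=> x0; exists (ln x); rewrite lnK. Qed.

Lemma powR_expR (y a : R) : (expR y `^ a = expR (a * y))%R.
Proof. by rewrite /powR gt_eqF ?expR_gt0// expRK. Qed.

Lemma exprn_expR (y : R) (k : nat) : (expR y ^+ k = expR (k%:R * y))%R.
Proof. by rewrite -expRM_natl. Qed.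

Lemma dyadic_level (x : R) : (0 < x <= 1)%R ->
  exists m, (2^-1 ^+ m.+1 < x <= 2^-1 ^+ m)%R.
Proof.
move=> /andP[x0 x1].
have ex : exists m, (2^-1 ^+ m.+1 < x)%R.
  exists (Num.bound x^-1); rewrite exprVn invf_plt ?posrE ?exprn_gt0//.
  by apply: upper_nthrootP; exact: leqnSn.
case: (ex_minnP ex) => -[|m] xm mmin; first by exists 0%N; rewrite expr0 xm.
exists m.+1; rewrite xm/= leNgt; apply/negP => /mmin.
by rewrite ltnn.
Qed.

(** Finitely many indices occupy finitely many classes, but comparison with the full geometric
    series makes the bound independent of [J], as the passage to infinite sums requires. *)
Lemma sum_geometric_classes (J : nat) (P : pred 'I_J) (x : 'I_J -> R)
    (m : 'I_J -> nat) (a r : R) :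
  (forall j, P j -> (0 <= x j)%R) -> (0 <= a)%R -> (0 <= r < 1)%R ->
  (forall k, (\sum_(j < J | P j && (m j == k)) x j <= a * r ^+ k)%R) ->
  (\sum_(j < J | P j) x j <= a / (1 - r))%R.
Proof.
move=> x0 a0 r01 H; pose M := \max_(j < J) m j.
have mM j : (m j < M.+1)%N by rewrite ltnS /M (leq_bigmax j).
rewrite (partition_big (fun j => Ordinal (mM j)) xpredT)//=.
apply: le_trans (geometric_sum_le M.+1 a0 r01); apply: ler_sum => k _.
by apply: le_trans (H k).
Qed.

End expR_form.

Section atoms.
Context d (T : measurableType d) (R : realType) (m : {measure set T -> \bar R}).

Lemma measurable_superlevel (D : set T) (f : T -> R) (y : R) :
  measurable D -> measurable_fun D f -> measurable (D `&` [set x | (y < f x)%R]).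
Proof.
move=> mD mf; rewrite (_ : [set x | _] = f @^-1` [set` `]y, +oo[%R]).
  by apply: mf => //; exact: measurable_itv.
by apply/seteqP; split => x /=; rewrite in_itv/= andbT.
Qed.

(** Kolmogorov's inequality for a weak [L^t] function and a power [v < t]. The base level
    [K u^(-1/t)] is the one at which the weak bound equals [u], the measure of the domain. *)
Lemma integral_powR_weak (D : set T) (f : T -> R) (u v t K : R) :
  measurable D -> measurable_fun D f -> (forall x, D x -> (0 <= f x)%R) ->
  (0 < v)%R -> (v < t)%R -> (0 < K)%R -> (0 < u)%R -> m D = u%:E ->
  (forall y, (0 < y)%R -> m (D `&` [set x | (y < f x)%R]) <= ((K / y) `^ t)%:E) ->
  \int[m]_(x in D) (f x `^ v)%:E <=
    (weak_cst (v / t) * (K * u `^ (- t^-1)) `^ v * u)%:E.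
Proof.
move=> mD mf f0 v0 vt K0 u0 mDu HK; have t0 : (0 < t)%R by exact: lt_trans vt.
apply: integral_weak_type => //.
- by apply: (@measurableT_comp _ _ _ _ _ _ (fun x : R => x `^ v)%R) => //; exact: measurable_powR.
- by move=> x _; exact: powR_ge0.
- by rewrite powR_gt0// mulr_gt0// powR_gt0.
- exact: ltW.
- by rewrite divr_gt0//= ltr_pdivrMr// mul1r.
- by rewrite mDu.
(* At this level the weak bound [(K/y)^t] is exactly [u / 2^k]. *)
move=> k; set y := (K * u `^ (- t^-1) * 2 `^ (k%:R * t^-1))%R.
have y0 : (0 < y)%R by rewrite !mulr_gt0// powR_gt0.
rewrite [X in X%:E](_ : _ = (K / y) `^ t)%R; last first.
  rewrite /y; case: (pos_expR K0) => {HK y y0 K0}K ->; case: (pos_expR u0) => {mDu u0}u ->.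
  case: (@pos_expR R 2) => // L ->.
  rewrite exprn_expR !powR_expR -!expRD -!expRN -!expRD powR_expR; congr expR.
  by field; rewrite gt_eqF.
apply: le_trans (HK y y0); apply: le_measure; rewrite ?inE.
- apply: measurable_superlevel => //.
  by apply: (@measurableT_comp _ _ _ _ _ _ (fun x : R => x `^ v)%R) => //; exact: measurable_powR.
- exact: measurable_superlevel.
move=> x [Dx /=] fx; split => //=; rewrite ltNge; apply/negP => fy.
move: fx; rewrite ltNge => /negP; apply.
rewrite [leRHS](_ : _ = y `^ v)%R; last first.
  by rewrite /y [in RHS]powRM ?powR_ge0 ?mulr_ge0 ?powR_ge0 ?(ltW K0)// -powRrM
    [(k%:R * _ * _)%R]mulrAC mulrA.
by rewrite ge0_ler_powR ?nnegrE ?f0 ?(ltW v0) ?(ltW y0).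
Qed.

(** The left-hand side is the integral over [B] of a finite sum of weighted indicators lying below
    [g^v]. As [g] carries no measurability assumption, its layers are controlled through their
    measurable subsets, such as the layers of that sum. *)
Lemma sum_weights_le (J : nat) (P : pred 'I_J) (Q : nat -> set T)
    (b lam : nat -> R) (g : T -> \bar R) (B : set T) (v sg M u : R) :
  (0 < v)%R -> (0 < sg)%R -> (sg * v < 1)%R -> (0 < M)%R -> (0 <= u)%R ->
  (forall j, measurable (Q j)) -> (forall j, m (Q j) = (b j)%:E) ->
  (forall x, 0 <= g x) ->
  (forall x, \sum_(j < J) ((lam j * \1_(Q j) x) `^ v)%:E <= g x `^ v) ->
  (forall j : 'I_J, P j -> Q j `<=` B) -> measurable B -> m B <= u%:E ->
  (forall (k : nat) (A : set T), measurable A ->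
     A `<=` B `&` [set x | (M * 2 `^ (k%:R * sg))%:E < g x] ->
     m A <= (u / 2 ^+ k)%:E) ->
  (\sum_(j < J | P j) lam j `^ v * b j <= weak_cst (sg * v) * M `^ v * u)%R.
Proof.
move=> v0 sg0 sgv M0 u0 mQ mQb g0 Hg PB mB mBu Hk.
pose w (j : 'I_J) : R := if P j then (lam j `^ v)%R else 0%R.
have w0 j : (0 <= w j)%R by rewrite /w; case: ifP => // _; exact: powR_ge0.
pose f x := (\sum_(j < J) w j * \1_(Q j) x)%R.
have f0 x : (0 <= f x)%R by apply: sumr_ge0 => j _; rewrite mulr_ge0.
have mind (j : 'I_J) D : measurable_fun D (fun x : T => (w j * \1_(Q j) x)%R).
  by apply: measurable_funM; [exact: measurable_cst|exact: measurable_indic].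
have mf D : measurable_fun D f by exact: measurable_sum.
have fg x : (f x)%:E <= g x `^ v.
  apply: le_trans (Hg x); rewrite sumEFin lee_fin /f.
  apply: ler_sum => j _; rewrite indicE /w; case: (_ \in _); case: ifP => _;
    by rewrite ?mulr1 ?mulr0 ?powR_ge0.
have E : (\sum_(j < J | P j) lam j `^ v * b j)%:E = \int[m]_(x in B) (f x)%:E.
  rewrite /f; under eq_integral do rewrite -sumEFin.
  rewrite ge0_integral_sum//; last 2 first.
  - by move=> j; apply/measurable_EFinP; exact: mind.
  - by move=> j x _; rewrite lee_fin mulr_ge0.
  rewrite -sumEFin big_mkcond/=; apply: eq_bigr => j _.
  under eq_integral do rewrite EFinM.
  rewrite ge0_integralZl ?lee_fin//; last exact/measurable_EFinP/measurable_indic.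
  rewrite /w; case: ifPn => Pj; last by rewrite mul0e.
  by rewrite integral_indic// (setIidl (PB _ Pj)) mQb.
rewrite -lee_fin E; apply: integral_weak_type => //.
- by rewrite powR_gt0.
- by rewrite mulr_gt0.
move=> k; apply: Hk; first exact: measurable_superlevel.
move=> x [Bx /= Mf]; split => //=; rewrite ltNge; apply/negP => gM.
have h1 := le_poweR (ltW v0) (g0 x) gM.
have h2 : (M `^ v * 2 `^ (k%:R * (sg * v)))%:E < g x `^ v by apply: lt_le_trans (fg x).
have := lt_le_trans h2 h1; rewrite poweR_EFin powRM ?powR_ge0 ?(ltW M0)//.
by rewrite -powRrM mulrA ltxx.
Qed.

End atoms.

Section core.
Context d0 (T : measurableType d0) (R : realType) (m : {measure set T -> \bar R}).
Variables (n J : nat) (Q : nat -> set T) (l lam : nat -> R) (e : nat -> T -> R).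
Variables (g : T -> \bar R) (p q t s v al be : R).
Hypothesis n_gt0 : (0 < n)%N.
Hypothesis v_gt0 : (0 < v)%R.
Hypothesis q_gt0 : (0 < q)%R.
Hypothesis vq : (v < q)%R.
Hypothesis qp : (q <= p)%R.
Hypothesis qt : (q < t)%R.
Hypothesis ts : (t <= s)%R.
Hypothesis ps : (p < s)%R.
Hypothesis al_gt : (t^-1 < al)%R.
Hypothesis be_gt0 : (0 < be)%R.
Hypothesis be_lt : (be * v < 1)%R.

Let t_gt0 : (0 < t)%R. Proof. exact: lt_trans qt. Qed.
Let s_gt0 : (0 < s)%R. Proof. exact: lt_le_trans ts. Qed.
Let p_gt0 : (0 < p)%R. Proof. exact: lt_le_trans qp. Qed.
Let vt : (v < t)%R. Proof. exact: lt_trans qt. Qed.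

Hypothesis l_gt0 : forall j, (0 < l j)%R.
Hypothesis mQ : forall j, measurable (Q j).
Hypothesis Q_l : forall j, m (Q j) = (l j ^+ n)%:E.
Hypothesis e_ge0 : forall j x, (0 <= e j x)%R.
Hypothesis me : forall j, measurable_fun setT (e j).
Hypothesis e_supp : forall j x, ~ Q j x -> e j x = 0%R.
Hypothesis g_ge0 : forall x, 0 <= g x.
Hypothesis Hg : forall x, \sum_(j < J) ((lam j * \1_(Q j) x) `^ v)%:E <= g x `^ v.

Variables (B0 B3 : set T) (B : nat -> set T) (D : set T) (L d w A : R).
Hypothesis L_gt0 : (0 < L)%R.
Hypothesis d_gt0 : (0 < d)%R.
Hypothesis w_gt0 : (0 < w)%R.
Hypothesis A_gt0 : (0 < A)%R.
Hypothesis mD : measurable D.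
Hypothesis D_d : m D = d%:E.
Hypothesis mB0 : measurable B0.
Hypothesis DB0 : D `<=` B0.

Lemma integral_atom_supp j :
  \int[m]_(x in D) (e j x `^ v)%:E = \int[m]_(x in D `&` Q j) (e j x `^ v)%:E.
Proof.
rewrite integral_mkcondr; apply: eq_integral => x _.
rewrite patchE; case: ifPn => // /negP xQ.
by rewrite e_supp ?powR0 ?gt_eqF// => Qx; apply: xQ; rewrite inE.
Qed.

Let mev j D' : measurable_fun D' (fun x => (e j x `^ v)%R).
Proof.
apply: (@measurableT_comp _ _ _ _ _ _ (fun x : R => x `^ v)%R).
  exact: measurable_powR.
exact: measurable_funTS.
Qed.

Lemma integral_atom0 j : m (D `&` Q j) = 0 ->
  \int[m]_(x in D) (e j x `^ v)%:E = 0.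
Proof.
move=> DQ0; rewrite integral_atom_supp; apply: null_set_integral => //.
- exact: measurableI.
- by apply/measurable_EFinP; exact: mev.
Qed.

Let dj j : R := fine (m (D `&` Q j)).
Let djE j : m (D `&` Q j) = (dj j)%:E.
Proof.
rewrite /dj fineK// ge0_fin_numE//; apply: (@le_lt_trans _ _ (m D)).
  by apply: le_measure; rewrite ?inE//; exact: measurableI.
by rewrite D_d ltry.
Qed.
Let b_gt0 j : (0 < l j ^+ n)%R. Proof. by rewrite exprn_gt0. Qed.

Let dj_le j : (dj j <= l j ^+ n)%R.
Proof.
rewrite -lee_fin -djE -Q_l; apply: le_measure; rewrite ?inE//.
exact: measurableI.
Qed.

Let meets j : (0 < dj j)%R -> D `&` Q j !=set0.
Proof.
move=> dj0; apply/set0P/eqP => DQ0; move: dj0.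
by rewrite /dj DQ0 measure0 ltxx.
Qed.

Section small.
Hypothesis weakQ : forall j y, (0 < y)%R ->
  m (Q j `&` [set x | (y < e j x)%R]) <= (((l j ^+ n) `^ t^-1 / y) `^ t)%:E.
Hypothesis vitali : forall (P : pred 'I_J) (K : R), (0 <= K)%R ->
  (forall j, P j -> (l j ^+ n)%:E <= K%:E * m (D `&` Q j)) ->
  m (\big[setU/set0]_(j < J | P j) Q j) <= (3 ^+ n * K)%:E * m D.
Hypothesis B3_small : forall j, (l j < L)%R -> D `&` Q j !=set0 -> Q j `<=` B3.
Hypothesis H1 : forall (i k : nat) (A' : set T), measurable A' ->
  A' `<=` B3 `&` [set x | (w * 2 `^ (- (i%:R * al)) * 2 `^ (k%:R * be))%:E < g x] ->
  m A' <= (2 ^+ i / 2 ^+ k * d)%:E.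

(** In turn: the integral of one atom, the layers of [g], the covering at density above [2^-(k+1)]
    (which gives [3^n 2^(k+1)]), and the sum over the density classes, convergent since
    [al > 1/t]. *)
Definition small_cst : R :=
  (weak_cst (v / t) * weak_cst (be * v) * 3 ^+ n * 2 / (1 - 2 `^ (v / t - al * v)))%R.

Lemma integral_atom_small j : (0 < dj j)%R ->
  \int[m]_(x in D) (e j x `^ v)%:E <=
  (weak_cst (v / t) * (l j ^+ n * (dj j / l j ^+ n) `^ (1 - v / t)))%:E.
Proof.
move=> dj0; rewrite integral_atom_supp.
apply: le_trans (integral_powR_weak (u := dj j) (t := t)
  (K := ((l j ^+ n) `^ t^-1)%R) _ _ _ _ _ _ _ _ _) _ => //.
- exact: measurableI.
- exact: measurable_funTS.
- by rewrite powR_gt0.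
- move=> y y0; apply: le_trans (weakQ j y0); apply: le_measure; rewrite ?inE.
  + by apply: measurable_superlevel; [exact: measurableI|exact: measurable_funTS].
  + by apply: measurable_superlevel => //; exact: measurable_funTS.
  + by move=> x [[_ ?] ?].
rewrite lee_fin -mulrA le_eqVlt; apply/orP; left; apply/eqP; congr (_ * _)%R.
case: (pos_expR (b_gt0 j)) => b ->; case: (pos_expR dj0) => z ->.
rewrite !powR_expR -!expRN -!expRD !powR_expR -!expRD; congr expR.
by field; rewrite gt_eqF.
Qed.

Lemma sum_small_atoms :
  \sum_(j < J | (l j < L)%R && (0 < dj j)%R)
    ((lam j `^ v)%:E * \int[m]_(x in D) (e j x `^ v)%:E) <=
  (small_cst * w `^ v * d)%:E.
Proof.
pose P (j : 'I_J) := (l j < L)%R && (0 < dj j)%R.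
pose x (j : 'I_J) : R := (lam j `^ v *
  (weak_cst (v / t) * (l j ^+ n * (dj j / l j ^+ n) `^ (1 - v / t))))%R.
have vt1 : (v / t < 1)%R by rewrite ltr_pdivrMr// mul1r.
have C1 : (0 < weak_cst (v / t))%R by exact: weak_cst_gt0.
have C2 : (0 < weak_cst (be * v))%R by exact: weak_cst_gt0.
apply: (@le_trans _ _ (\sum_(j < J | P j) x j)%:E).
  rewrite -sumEFin; apply: lee_sum => j /andP[_ dj0].
  rewrite [leRHS]EFinM; apply: lee_wpmul2l; first by rewrite lee_fin powR_ge0.
  exact: integral_atom_small.
rewrite lee_fin.
have /choice[mm Hmm] : forall j : 'I_J, exists k, P j ->
    (2^-1 ^+ k.+1 < dj j / l j ^+ n <= 2^-1 ^+ k)%R.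
  move=> j; have [Pj|] := boolP (P j); last by exists 0%N.
  have [|k Hk] := @dyadic_level R (dj j / l j ^+ n)%R; last by exists k.
  by case/andP: Pj => _ dj0; rewrite divr_gt0//= ler_pdivrMr// mul1r.
set r := (2 `^ (v / t - al * v))%R.
have r01 : (0 <= r < 1)%R.
  by apply: powR2_lt1; rewrite mulrC -mulrBl pmulr_llt0// subr_lt0.
have -> : (small_cst * w `^ v * d = (weak_cst (v / t) * weak_cst (be * v) * 3 ^+ n * 2
    * w `^ v * d) / (1 - r))%R by rewrite /small_cst -/r; ring.
apply: (@sum_geometric_classes _ _ _ _ mm) => //.
- move=> j _; rewrite !mulr_ge0 ?powR_ge0 ?(ltW C1)//; exact: ltW.
- by rewrite !mulr_ge0 ?powR_ge0 ?exprn_ge0 ?(ltW C1) ?(ltW C2) ?(ltW d_gt0).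
move=> k; set U := \big[setU/set0]_(j < J | P j && (mm j == k)) Q j.
have mU : measurable U by exact: bigsetU_measurable.
have QU (j : 'I_J) : P j && (mm j == k) -> Q j `<=` U.
  by move=> Pj; rewrite /U (bigD1 j)//=; left.
have mU_le : m U <= (3 ^+ n * 2 ^+ k.+1 * d)%:E.
  rewrite EFinM -D_d; apply: vitali; first exact: exprn_ge0.
  move=> j /andP[Pj /eqP jk]; have /andP[+ _] := Hmm j Pj.
  rewrite jk djE -EFinM lee_fin ltr_pdivlMr// exprVn ltr_pdivrMl ?exprn_gt0//.
  exact: ltW.
have UB3 : U `<=` B3.
  rewrite /U; elim/big_ind : _ => // [A1 A2 h1 h2|j /andP[/andP[lj dj0] _]].
    by rewrite subUset.
  by apply: B3_small => //; exact: meets.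
(* In class [k] the layers of [g] start at [w 2^(-k al)]: the set [U] has measure about [2^k d], and
   [H1] with first index [k] controls [g] from this level on. *)
have := @sum_weights_le _ _ _ m J (fun j => P j && (mm j == k)) Q (fun j => l j ^+ n)%R
  lam g U v be (w * 2 `^ (- (k%:R * al)))%R (3 ^+ n * 2 ^+ k.+1 * d)%R.
move=> /(_ v_gt0 be_gt0 be_lt) /=.
rewrite mulr_gt0 ?powR_gt0// => /(_ isT).
rewrite !mulr_ge0 ?exprn_ge0 ?(ltW d_gt0)// => /(_ isT mQ Q_l g_ge0 Hg QU mU mU_le).
have Hk : forall (i : nat) (A' : set T), measurable A' ->
     A' `<=` U `&` [set x0 | (w * 2 `^ (- (k%:R * al)) * 2 `^ (i%:R * be))%:E < g x0] ->
     m A' <= (3 ^+ n * 2 ^+ k.+1 * d / 2 ^+ i)%:E.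
  move=> i A' mA' A'U; apply: (@le_trans _ _ (2 ^+ k / 2 ^+ i * d)%:E).
    apply: H1 => //; apply: subset_trans A'U _; apply: setSI; exact: UB3.
  rewrite lee_fin exprS mulrAC.
  rewrite ler_pM2r ?invr_gt0 ?exprn_gt0// ler_pM2r// mulrCA mulrA ler_peMl ?exprn_ge0//.
  by rewrite -[leLHS]mulr1 ler_pM// ?ler1n// exprn_ege1// ler1n.
move=> /(_ Hk) {Hk} Hsum.
apply: (@le_trans _ _ (weak_cst (v / t) * (2^-1 ^+ k) `^ (1 - v / t) *
    \sum_(j < J | P j && (mm j == k)) lam j `^ v * l j ^+ n)%R).
  rewrite mulr_sumr; apply: ler_sum => j /andP[Pj /eqP jk].
  have /andP[_ djk] := Hmm j Pj; rewrite jk in djk.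
  have dj0 : (0 < dj j)%R by case/andP: Pj.
  rewrite /x [leLHS](_ : _ = (weak_cst (v / t) * (dj j / l j ^+ n) `^ (1 - v / t))
    * (lam j `^ v * l j ^+ n))%R; last by ring.
  rewrite ler_wpM2r ?mulr_ge0 ?powR_ge0 ?exprn_ge0 ?(ltW (l_gt0 _))//.
  rewrite ler_wpM2l ?(ltW C1)// ge0_ler_powR ?subr_ge0 ?(ltW vt1) ?nnegrE//.
    by rewrite divr_ge0 ?(ltW dj0) ?(ltW (b_gt0 _)).
apply: le_trans (ler_wpM2l _ Hsum) _; first by rewrite mulr_ge0 ?powR_ge0 ?(ltW C1).
rewrite le_eqVlt; apply/orP; left; apply/eqP.
rewrite [LHS](_ : _ = weak_cst (v / t) * weak_cst (be * v) * 3 ^+ n * d *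
  ((2^-1 ^+ k) `^ (1 - v / t) * (w * 2 `^ (- (k%:R * al))) `^ v * 2 ^+ k.+1))%R;
  last by ring.
rewrite [RHS](_ : _ = weak_cst (v / t) * weak_cst (be * v) * 3 ^+ n * d *
  (2 * w `^ v * r ^+ k))%R; last by ring.
(* The exponents of 2 that grow with [k] add up to [-(1 - v/t) - al v + 1 = v/t - al v], the
   exponent of [r]. *)
congr (_ * _)%R; rewrite exprS /r.
case: (pos_expR w_gt0) => w' ->; case: (@pos_expR R 2) => // L2 ->.
rewrite -!expRN !exprn_expR !powR_expR -!expRD !powR_expR -!expRD !exprn_expR -!expRD.
congr expR; field; rewrite gt_eqF//.
Qed.

End small.

Section large.
Variable c : R.
Let V : R := (L ^+ n)%R.
Let Vk k : R := ((2 ^+ k.+3 * L) ^+ n)%R.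
Hypothesis weakB0 : forall j y, (0 < y)%R ->
  m (B0 `&` [set x | (y < e j x)%R]) <=
  (((l j ^+ n) `^ s^-1 * V `^ (t^-1 - s^-1) / y) `^ t)%:E.
Hypothesis mB : forall k, measurable (B k).
Hypothesis B_Vk : forall k, m (B k) = (Vk k)%:E.
Hypothesis B_large : forall j k, (l j < 2 ^+ k.+1 * L)%R -> D `&` Q j !=set0 ->
  Q j `<=` B k.
Hypothesis H2 : forall (k i : nat) (A' : set T), measurable A' ->
  A' `<=` B k `&` [set x | (A * Vk k `^ (- p^-1) * 2 `^ (i%:R * q^-1))%:E < g x] ->
  m A' <= (Vk k / 2 ^+ i)%:E.
Hypothesis c_gt0 : (0 < c)%R.
Hypothesis H3 : (A * V `^ (- p^-1) * (V / d) `^ t^-1 <= c * w)%R.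

(** In turn: the integral of one atom, the layers of [g] at exponent [1/q], the dilation constant in
    [|B k| = 8^n 2^(kn) |B0|] (in the application), the constant of [H3], and the sum over the
    sizes, convergent since [p < s]. *)
Definition large_cst : R :=
  (weak_cst (v / t) * weak_cst (q^-1 * v) * (8 ^+ n) `^ (1 - v / p) * c `^ v /
   (1 - 2 `^ (n%:R * (v / s - v / p))))%R.

Let V_gt0 : (0 < V)%R. Proof. by rewrite exprn_gt0. Qed.
Let Vk_gt0 k : (0 < Vk k)%R.
Proof. by rewrite exprn_gt0// mulr_gt0// exprn_gt0. Qed.

(** An atom on a large cube is tested on [B0], not on its own cube: the Morrey scaling at the side
    [L] supplies the factor [V^(1/t - 1/s)], raised to the power [v]. *)
Lemma integral_atom_large j :
  \int[m]_(x in D) (e j x `^ v)%:E <=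
  (weak_cst (v / t) * ((l j ^+ n) `^ (v / s) * V `^ (v / t - v / s) *
     d `^ (1 - v / t)))%:E.
Proof.
apply: le_trans (integral_powR_weak (u := d) (t := t)
  (K := ((l j ^+ n) `^ s^-1 * V `^ (t^-1 - s^-1))%R) _ _ _ _ _ _ _ _ _) _ => //.
- exact: measurable_funTS.
- by rewrite mulr_gt0// powR_gt0.
- move=> y y0; apply: le_trans (weakB0 j y0); apply: le_measure; rewrite ?inE.
  + by apply: measurable_superlevel => //; exact: measurable_funTS.
  + by apply: measurable_superlevel => //; exact: measurable_funTS.
  + by move=> x [Dx ?]; split => //; exact: DB0.
rewrite lee_fin -mulrA le_eqVlt; apply/orP; left; apply/eqP; congr (_ * _)%R.
case: (pos_expR (b_gt0 j)) => b ->; case: (pos_expR V_gt0) => z ->.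
case: (pos_expR d_gt0) => d' ->.
rewrite !powR_expR -!expRD !powR_expR -!expRD; congr expR.
by field; rewrite !gt_eqF.
Qed.

Lemma sum_large_atoms :
  \sum_(j < J | (L <= l j)%R && (0 < dj j)%R)
    ((lam j `^ v)%:E * \int[m]_(x in D) (e j x `^ v)%:E) <=
  (large_cst * w `^ v * d)%:E.
Proof.
pose P (j : 'I_J) := (L <= l j)%R && (0 < dj j)%R.
pose x (j : 'I_J) : R := (lam j `^ v *
  (weak_cst (v / t) * ((l j ^+ n) `^ (v / s) * V `^ (v / t - v / s) *
     d `^ (1 - v / t))))%R.
have vt1 : (v / t < 1)%R by rewrite ltr_pdivrMr// mul1r.
have vs1 : (v / s < 1)%R by rewrite ltr_pdivrMr// mul1r (lt_le_trans vt).
have vq1 : (q^-1 * v < 1)%R by rewrite mulrC ltr_pdivrMr// mul1r.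
have C1 : (0 < weak_cst (v / t))%R by exact: weak_cst_gt0.
have C3 : (0 < weak_cst (q^-1 * v))%R by exact: weak_cst_gt0.
apply: (@le_trans _ _ (\sum_(j < J | P j) x j)%:E).
  rewrite -sumEFin; apply: lee_sum => j _.
  rewrite [leRHS]EFinM; apply: lee_wpmul2l; first by rewrite lee_fin powR_ge0.
  exact: integral_atom_large.
rewrite lee_fin.
have /choice[mm Hmm] : forall j : 'I_J, exists k, P j ->
    (2^-1 ^+ k.+1 < L / l j <= 2^-1 ^+ k)%R.
  move=> j; have [Pj|] := boolP (P j); last by exists 0%N.
  have [|k Hk] := @dyadic_level R (L / l j)%R; last by exists k.
  by case/andP: Pj => Lj _; rewrite divr_gt0//= ler_pdivrMr// mul1r.
set r := (2 `^ (n%:R * (v / s - v / p)))%R.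
have r01 : (0 <= r < 1)%R.
  apply: powR2_lt1; rewrite pmulr_rlt0 ?ltr0n// -mulrBr pmulr_rlt0// subr_lt0.
  by rewrite ltf_pV2 ?posrE.
(* The bound for the class [k = 0]. Its last factor is [(A V^(-1/p) (V/d)^(1/t))^v d], which [H3]
   bounds by [(c w)^v d]. *)
pose a := (weak_cst (v / t) * weak_cst (q^-1 * v) * (8 ^+ n) `^ (1 - v / p) *
   (A `^ v * V `^ (v / t - v / p) * d `^ (1 - v / t)))%R.
have a0 : (0 <= a)%R.
  by rewrite !mulr_ge0 ?powR_ge0 ?(ltW C1) ?(ltW C3).
apply: (@le_trans _ _ (a / (1 - r))%R); last first.
  rewrite /large_cst -/r.
  rewrite [leRHS](_ : _ = weak_cst (v / t) * weak_cst (q^-1 * v) * (8 ^+ n) `^ (1 - v / p)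
     * (c `^ v * w `^ v * d) / (1 - r))%R; last by ring.
  rewrite ler_wpM2r ?invr_ge0 ?subr_ge0 ?(ltW (andP r01).2)//.
  rewrite ler_wpM2l ?mulr_ge0 ?powR_ge0 ?(ltW C1) ?(ltW C3)//.
  rewrite -powRM ?(ltW c_gt0) ?(ltW w_gt0)//.
  rewrite [leLHS](_ : _ = (A * V `^ (- p^-1) * (V / d) `^ t^-1) `^ v * d)%R; last first.
    case: (pos_expR V_gt0) => z ->; case: (pos_expR A_gt0) => A' ->.
    case: (pos_expR d_gt0) => d' ->.
    rewrite -!expRN -!expRD !powR_expR -!expRD !powR_expR -!expRD; congr expR.
    by field; rewrite !gt_eqF.
  rewrite ler_wpM2r ?(ltW d_gt0)// ge0_ler_powR ?(ltW v_gt0) ?nnegrE//.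
    by rewrite !mulr_ge0 ?powR_ge0 ?(ltW A_gt0).
  by rewrite mulr_ge0 ?(ltW c_gt0) ?(ltW w_gt0).
apply: (@sum_geometric_classes _ _ _ _ mm) => //.
  by move=> j _; rewrite !mulr_ge0 ?powR_ge0 ?(ltW C1).
move=> k; pose P' (j : 'I_J) := P j && (mm j == k).
have QB (j : 'I_J) : P' j -> Q j `<=` B k.
  move=> /andP[Pj /eqP jk]; have /andP[+ _] := Hmm j Pj.
  rewrite jk ltr_pdivlMr// exprVn ltr_pdivrMl ?exprn_gt0// => lj.
  by apply: B_large => //; apply: meets; case/andP: Pj.
have := @sum_weights_le _ _ _ m J P' Q (fun j => l j ^+ n)%R
  lam g (B k) v q^-1 (A * Vk k `^ (- p^-1))%R (Vk k).
rewrite invr_gt0 => /(_ v_gt0 q_gt0 vq1) /=.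
rewrite mulr_gt0 ?powR_gt0// => /(_ isT (ltW (Vk_gt0 k)) mQ Q_l g_ge0 Hg QB (mB k)).
rewrite B_Vk lexx => /(_ isT (@H2 k)) Hsum.
apply: (@le_trans _ _ (weak_cst (v / t) * (V `^ (v / t - v / s) * d `^ (1 - v / t)) *
    ((2 ^+ k) ^+ n * V) `^ (v / s - 1) *
    \sum_(j < J | P' j) lam j `^ v * l j ^+ n)%R).
  rewrite mulr_sumr; apply: ler_sum => j /andP[Pj /eqP jk].
  have /andP[_ ljk] := Hmm j Pj; rewrite jk in ljk.
  have lk : (2 ^+ k * L <= l j)%R.
    by move: ljk; rewrite ler_pdivrMr// exprVn ler_pdivlMl ?exprn_gt0.
  rewrite /x [leLHS](_ : _ = (weak_cst (v / t) * (V `^ (v / t - v / s) * d `^ (1 - v / t)))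
    * (l j ^+ n) `^ (v / s - 1) * (lam j `^ v * l j ^+ n))%R; last first.
    have -> : ((l j ^+ n) `^ (v / s) = (l j ^+ n) `^ (v / s - 1) * (l j ^+ n))%R.
      case: (pos_expR (b_gt0 j)) => b ->; rewrite !powR_expR -expRD; congr expR; ring.
    by ring.
  rewrite ler_wpM2r ?mulr_ge0 ?powR_ge0 ?(ltW (b_gt0 _))//.
  rewrite ler_wpM2l ?mulr_ge0 ?powR_ge0 ?(ltW C1)//.
  (* One full power of [|Q_j|] was kept for the integral of [g^v]. The remaining exponent [v/s - 1]
     is negative, so the lower bound on the side gives an upper bound. *)
  rewrite -(opprB 1 (v / s)%R) !powRN lef_pV2 ?posrE ?powR_gt0 ?mulr_gt0 ?exprn_gt0//.
  rewrite ge0_ler_powR ?subr_ge0 ?(ltW vs1) ?nnegrE ?(ltW (b_gt0 _))//.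
    by apply: mulr_ge0; [rewrite !exprn_ge0|exact: ltW].
  by rewrite /V -exprMn lerXn2r ?nnegrE ?mulr_ge0 ?exprn_ge0 ?(ltW L_gt0) ?(ltW (l_gt0 _)).
apply: le_trans (ler_wpM2l _ Hsum) _.
  by rewrite !mulr_ge0 ?powR_ge0 ?(ltW C1).
rewrite le_eqVlt; apply/orP; left; apply/eqP.
rewrite [LHS](_ : _ = weak_cst (v / t) * weak_cst (q^-1 * v) *
  (V `^ (v / t - v / s) * d `^ (1 - v / t) * ((2 ^+ k) ^+ n * V) `^ (v / s - 1) *
   (A * Vk k `^ (- p^-1)) `^ v * Vk k))%R; last by ring.
rewrite /a -2![in RHS]mulrA; congr (_ * _)%R.
have -> : (Vk k = (8 ^+ n) * (2 ^+ k) ^+ n * V)%R.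
  by rewrite /Vk /V -!exprMn; congr (_ ^+ _)%R; rewrite !exprS; ring.
rewrite /r.
case: (pos_expR V_gt0) => z ->; case: (pos_expR A_gt0) => A' ->.
case: (pos_expR d_gt0) => d' ->; case: (@pos_expR R 2) => // L2 ->.
have [L8 ->] : exists y, (8 ^+ n : R)%R = expR y by apply: pos_expR; rewrite exprn_gt0.
rewrite !exprn_expR -!expRD !powR_expR -!expRD !powR_expR !exprn_expR -!expRD.
by congr expR; field; rewrite !gt_eqF.
Qed.

End large.

Lemma integral_sum_atoms (X Y : \bar R) : (forall j, 0 <= lam j)%R ->
  \sum_(j < J | (l j < L)%R && (0 < dj j)%R)
    ((lam j `^ v)%:E * \int[m]_(x in D) (e j x `^ v)%:E) <= X ->
  \sum_(j < J | (L <= l j)%R && (0 < dj j)%R)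
    ((lam j `^ v)%:E * \int[m]_(x in D) (e j x `^ v)%:E) <= Y ->
  \int[m]_(x in D) (\sum_(j < J) ((lam j * e j x) `^ v)%:E) <= X + Y.
Proof.
move=> lam0 HX HY.
rewrite ge0_integral_sum//; last 2 first.
- move=> j; apply/measurable_EFinP.
  apply: (@measurableT_comp _ _ _ _ _ _ (fun x : R => x `^ v)%R).
    exact: measurable_powR.
  by apply: measurable_funM => //; exact: measurable_funTS.
- by move=> j x _; rewrite lee_fin powR_ge0.
apply: le_trans (leeD HX HY).
pose F (j : 'I_J) := (lam j `^ v)%:E * \int[m]_(x in D) (e j x `^ v)%:E.
rewrite (eq_bigr F); last first.
  move=> j _; under eq_integral do rewrite powRM// EFinM.
  rewrite ge0_integralZl ?lee_fin ?powR_ge0//.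
  - by apply/measurable_EFinP; exact: mev.
  - by move=> x _; rewrite lee_fin powR_ge0.
rewrite (bigID (fun j : 'I_J => 0 < dj j)%R)/= [X in _ + X]big1 ?adde0; last first.
  move=> j; rewrite -leNgt => dj0; rewrite /F integral_atom0 ?mule0//.
  by rewrite djE; apply/eqP; rewrite eqe eq_le dj0/= fine_ge0.
rewrite (bigID (fun j : 'I_J => l j < L)%R)/=.
rewrite (eq_bigl (fun j : 'I_J => (l j < L) && (0 < dj j))%R); last first.
  by move=> j; rewrite andbC.
rewrite [X in _ + X <= _](eq_bigl (fun j : 'I_J => (L <= l j) && (0 < dj j))%R)//.
by move=> j; rewrite -leNgt andbC.
Qed.

End core.

(** * Rearrangement and Morrey bounds for the sum of the atoms *)

Section weak_morrey_bounds.
Context {R : realType} {n : nat}.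
Local Notation Rn := 'rV[R]_n.
Local Notation mu := (@lebesgue_rV R n).
Local Notation leb := (@lebesgue_measure R).

Lemma npos_rearrangement (g : Rn -> \bar R) : npos (rearrangement g).
Proof.
apply: nonincreasing_npos => *; first exact: rearrangement_ge0.
exact: rearrangement_nonincreasing.
Qed.

(** The rearrangement of the indicator is at least 1 on [(0, z)], and there the kernel with both
    exponents equal to [t] is at least [(u^(1/t))^t / u = 1]. *)
Lemma lorentz_norm_indic_ge (E : set Rn) (t z : R) : (0 < t)%R -> (0 <= z)%R ->
  mu E = z%:E -> (z `^ t^-1)%:E <= lorentz_norm t t%:E (fun x => (\1_E x)%:E).
Proof.
move=> t0 z0 Ez; rewrite lorentz_normE; set h := rearrangement _.
have nh : npos h by exact: npos_rearrangement.
have h1 u : (u < z)%R -> 1 <= h u.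
  move=> uz; apply: le_ereal_inf_tmp => _ [a [a0 Ha] <-]; rewrite lee_fin leNgt.
  apply/negP => a1; move: Ha; rewrite leNgt => /negP; apply.
  rewrite /distribution_fun (_ : [set x | _] = E) ?Ez ?lte_fin//.
  apply/seteqP; split => x /=.
    by rewrite indicE; case: (boolP (x \in E)) => [/[!inE]//|_];
      rewrite normr0 lte_fin ltNge ltW.
  by move=> Ex; rewrite indicE mem_set//= normr1 lte_fin.
have -> : (z `^ t^-1)%:E = (z%:E) `^ t^-1 by rewrite poweR_EFin.
apply: le_poweR; rewrite ?invr_ge0 ?(ltW t0) ?lee_fin//.
pose J := (`]0%R, z[%classic : set R).
have mJ : measurable J by exact: measurable_itv.
have JI : J `<=` (`]0%R, +oo[%classic : set R).
  by move=> u; rewrite /J /= in_itv/= => /andP[u0 _]; apply/Ipos_mem.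
apply: (@le_trans _ _ (\int[leb]_(u in J) lker t t h u)); last first.
  apply: ge0_subset_integral => //; first exact: measurable_lker.
  by move=> u /Ipos_mem; apply: lker_ge0.
have lJ : leb J = z%:E.
  rewrite /J lebesgue_measure_itv/= lte_fin.
  case: ltP => [_|z0']; first by rewrite -EFinB subr0.
  by congr EFin; apply/eqP; rewrite eq_le z0.
rewrite -(mul1e z%:E) -lJ -integral_cst//.
apply: ge0_le_integral => //.
  by apply: measurable_funS JI _ => //; exact: measurable_lker.
move=> u; rewrite /J /= in_itv/= => /andP[u0 uz].
rewrite /lker -(@divrr _ u) ?unitfE ?gt_eqF// EFinM.
apply: lee_wpmul2r; first by rewrite lee_fin invr_ge0 ltW.
have -> : u%:E = ((u `^ t^-1)%:E) `^ t.
  by rewrite poweR_EFin -powRrM mulVf ?gt_eqF// powRr1// ltW.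
apply: le_poweR; [exact: ltW|by rewrite lee_fin powR_ge0|].
by rewrite -[leLHS]mule1; apply: lee_wpmul2l; [rewrite lee_fin powR_ge0|exact: h1].
Qed.

Lemma weak_morrey_bound (f : Rn -> R[i]) (s t K y l : R) (c : Rn) :
  (0 < t)%R -> (0 < l)%R -> (0 < y)%R -> (0 <= K)%R ->
  weak_morrey_norm s t f <= K%:E ->
  mu (cube c l `&` [set x | (y < Normc.normc (f x))%R]) <=
    ((K * (l ^+ n) `^ (t^-1 - s^-1) / y) `^ t)%:E.
Proof.
move=> t0 l0 y0 K0 HK; set E := _ `&` _.
have V0 : (0 < l ^+ n)%R by rewrite exprn_gt0.
have EV : mu E <= (l ^+ n)%:E.
  by rewrite -(lebesgue_cube c (ltW l0)); apply: le_lebesgue_rV => x [].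
have Efin : mu E \is a fin_num.
  by rewrite ge0_fin_numE ?(le_lt_trans EV) ?ltry//; exact: measure_ge0.
set z := fine (mu E); have Ez : mu E = z%:E by rewrite /z fineK.
have z0 : (0 <= z)%R by rewrite fine_ge0//; exact: measure_ge0.
have := lorentz_norm_indic_ge t0 z0 Ez; set X := lorentz_norm _ _ _ => HX.
have H1 : y%:E * ((l ^+ n)%:E `^ (s^-1 - t^-1) * X) <= K%:E.
  apply: le_trans HK; apply: le_ereal_sup_tmp; eexists; first by exists y.
  apply: lee_wpmul2l; first by rewrite lee_fin ltW.
  apply: ereal_sup_ubound; exists (cube c l); first exact: cube_is_cube.
  have -> : cutoff (fun x => (\1_[set y0 : Rn | (y < Normc.normc (f y0))%R] x)%:E)
      (cube c l) = fun x => (\1_E x)%:E.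
    by apply/funext => x; rewrite /cutoff /E indicI -EFinM mulrC.
  by rewrite lebesgue_cube// ltW.
have H2 : (y * ((l ^+ n) `^ (s^-1 - t^-1) * z `^ t^-1) <= K)%R.
  rewrite -lee_fin; apply: le_trans H1; rewrite !EFinM poweR_EFin.
  apply: lee_wpmul2l; first by rewrite lee_fin ltW.
  by apply: lee_wpmul2l => //; rewrite lee_fin powR_ge0.
rewrite Ez lee_fin.
rewrite [leLHS](_ : _ = (z `^ t^-1) `^ t)%R; last first.
  by rewrite -powRrM mulVf ?gt_eqF// powRr1.
rewrite ge0_ler_powR ?(ltW t0) ?nnegrE ?powR_ge0 ?mulr_ge0 ?invr_ge0 ?powR_ge0 ?(ltW y0)//.
rewrite ler_pdivlMr//; move: H2; rewrite mulrCA.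
rewrite -(opprB t^-1 s^-1)%R powRN ler_pdivrMl ?powR_gt0//.
by rewrite [(y * _)%R]mulrC [(_ * K)%R]mulrC.
Qed.

Lemma cutoff_ge0 (g : Rn -> \bar R) (E : set Rn) x :
  (forall x, 0 <= g x) -> 0 <= cutoff g E x.
Proof. by move=> g0; rewrite mule_ge0. Qed.

Lemma distribution_cutoff (g : Rn -> \bar R) (E : set Rn) (y : R) :
  (forall x, 0 <= g x) -> (0 <= y)%R ->
  distribution_fun (cutoff g E) y = mu (E `&` [set x | y%:E < g x]).
Proof.
move=> g0 y0; congr mu; apply/seteqP; split => x /=.
  rewrite gee0_abs ?cutoff_ge0// /cutoff indicE; case: (boolP (x \in E)) => [/[!inE] Ex|_].
    by rewrite mule1.
  by rewrite mule0 ltNge lee_fin y0.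
by move=> [Ex yg]; rewrite gee0_abs ?cutoff_ge0// /cutoff indicE mem_set// mule1.
Qed.

Lemma lorentz_norm_cutoff_le (p q N l : R) (r : \bar R) (g : Rn -> \bar R) (c : Rn) :
  (0 < l)%R -> morrey_norm p q r g <= N%:E ->
  lorentz_norm q r (cutoff g (cube c l)) <= ((l ^+ n) `^ (q^-1 - p^-1) * N)%:E.
Proof.
move=> l0 HN; have V0 : (0 < l ^+ n)%R by rewrite exprn_gt0.
rewrite EFinM -lee_pdivrMl ?powR_gt0// -powRN opprB.
apply: le_trans HN; apply: ereal_sup_ubound; exists (cube c l).
  exact: cube_is_cube.
by rewrite lebesgue_cube ?(ltW l0)// poweR_EFin.
Qed.

(** The embedding into the weak Lorentz space, read at [u = |Q| / 2^i]. Taking [A] strictly above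
    [C N] gives the strict inequality that a bound on the distribution function demands. *)
Lemma morrey_weak_bound (q : R) (r : \bar R) : (0 < q)%R -> 0 < r ->
  exists2 C : R, (0 < C)%R & forall (p N A l : R) (g : Rn -> \bar R) (c : Rn) (i : nat),
    (0 < l)%R -> (0 <= N)%R -> (forall x, 0 <= g x) ->
    morrey_norm p q r g <= N%:E -> (C * N < A)%R ->
    mu (cube c l `&` [set x |
      (A * (l ^+ n) `^ (- p^-1) * 2 `^ (i%:R * q^-1))%:E < g x]) <=
    (l ^+ n / 2 ^+ i)%:E.
Proof.
move=> q0 r0; have [C C0 HC] := @lnorm_embed R q r q0 r0; exists C => //.
move=> p N A l g c i l0 N0 g0 HN NA.
have A0 : (0 < A)%R by apply: le_lt_trans NA; rewrite mulr_ge0// ltW.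
have V0 : (0 < l ^+ n)%R by rewrite exprn_gt0.
rewrite -distribution_cutoff ?mulr_ge0 ?powR_ge0 ?(ltW A0)//.
apply: rearrangement_lt.
set u := (l ^+ n / 2 ^+ i)%R; have u0 : (0 < u)%R by rewrite divr_gt0// exprn_gt0.
have := HC (rearrangement (cutoff g (cube c l))) u u0
  (fun t _ => rearrangement_ge0 _ t)
  (fun t t' _ tt' => rearrangement_nonincreasing _ tt').
rewrite -lorentz_normE -lee_pdivlMl ?powR_gt0// => H.
apply: (le_lt_trans H); apply: (@le_lt_trans _ _
  (((u `^ q^-1)^-1 * (C * ((l ^+ n) `^ (q^-1 - p^-1) * N)))%:E)).
  rewrite EFinM; apply: lee_wpmul2l; first by rewrite lee_fin invr_ge0 powR_ge0.
  rewrite EFinM; apply: lee_wpmul2l; first by rewrite lee_fin ltW.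
  exact: lorentz_norm_cutoff_le.
rewrite lte_fin.
rewrite [ltLHS](_ : _ = (C * N) * ((l ^+ n) `^ (- p^-1) * 2 `^ (i%:R * q^-1)))%R.
  by rewrite -[ltRHS]mulrA ltr_pM2r// mulr_gt0// powR_gt0.
rewrite /u; case: (pos_expR V0) => z ->; case: (@pos_expR R 2) => // L2 ->.
rewrite exprn_expR -!expRN -!expRD !powR_expR -!expRN.
rewrite [LHS](_ : _ = C * N * (expR (- (q^-1 * (z - i%:R * L2))) * expR ((q^-1 - p^-1) * z)))%R;
  last by ring.
by rewrite -!expRD; congr (_ * expR _)%R; ring.
Qed.

End weak_morrey_bounds.

Section rearrangement_bound.
Context {R : realType} {n : nat}.
Local Notation Rn := 'rV[R]_n.
Local Notation mu := (@lebesgue_rV R n).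

Definition lebesgue_mu : {measure set (@lebT R n) -> \bar R} := mu.

Variables (p q t s v al be : R).
Hypothesis n_gt0 : (0 < n)%N.
Hypothesis v_gt0 : (0 < v)%R.
Hypothesis q_gt0 : (0 < q)%R.
Hypothesis vq : (v < q)%R.
Hypothesis qp : (q <= p)%R.
Hypothesis qt : (q < t)%R.
Hypothesis ts : (t <= s)%R.
Hypothesis ps : (p < s)%R.
Hypothesis al_gt : (t^-1 < al)%R.
Hypothesis be_gt0 : (0 < be)%R.
Hypothesis be_lt : (be * v < 1)%R.
Variables (c : nat -> Rn) (l lam : nat -> R) (e : nat -> @lebT R n -> R).
Variable (g : Rn -> \bar R).
Hypothesis l_gt0 : forall j, (0 < l j)%R.
Hypothesis lam_ge0 : forall j, (0 <= lam j)%R.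
Hypothesis e_ge0 : forall j x, (0 <= e j x)%R.
Hypothesis me : forall j, measurable_fun setT (e j).
Hypothesis e_supp : forall j x, ~ cube (c j) (l j) x -> e j x = 0%R.
Hypothesis g_ge0 : forall x, 0 <= g x.
Hypothesis Hg : forall J x,
  \sum_(j < J) ((lam j * \1_(cube (c j) (l j)) x) `^ v)%:E <= g x `^ v.
Hypothesis weak_e : forall j (c' : Rn) (l' y : R), (0 < l')%R -> (0 < y)%R ->
  mu (cube c' l' `&` [set x | (y < e j x)%R]) <=
  (((l j ^+ n) `^ s^-1 * (l' ^+ n) `^ (t^-1 - s^-1) / y) `^ t)%:E.
Variable A : R.
Hypothesis A_gt0 : (0 < A)%R.
Hypothesis weak_g : forall (c' : Rn) (l' : R) (i : nat), (0 < l')%R ->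
  mu (cube c' l' `&` [set x |
      (A * (l' ^+ n) `^ (- p^-1) * 2 `^ (i%:R * q^-1))%:E < g x]) <=
    (l' ^+ n / 2 ^+ i)%:E.

Variables (c0 : Rn) (L : R).
Hypothesis L_gt0 : (0 < L)%R.
Let V : R := (L ^+ n)%R.
Let Q0 : set Rn := cube c0 L.
Let Q3 : set Rn := cube (c0 - const_mx L) (L *+ 3).
Let Bk k : set Rn := cube (c0 - const_mx (2 ^+ k.+1 * L)%R) (2 ^+ k.+3 * L).

(** The argument [2^al] is what is lost when [|D| / |Q0|] is rounded to a power of 2. *)
Definition core_cst : R :=
  (small_cst n t v al be + large_cst n p q t s v (2 `^ al))%R.

(** Such a cube reaches at most [2^(k+1) L] beyond either face of [Q0]. A side of [3 2^(k+1) L]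
    would do; it is rounded up to a power of 2 times [L]. *)
Lemma large_cube_sub k (d : Rn) (m : R) (x : Rn) : (m < 2 ^+ k.+1 * L)%R ->
  Q0 x -> cube d m x -> cube d m `<=` Bk k.
Proof.
move=> mk Qx dx y dy i; rewrite !mxE.
move: (Qx i) (dx i) (dy i) => /andP[? ?] /andP[? ?] /andP[? ?].
have k1 : (1 <= (2 : R) ^+ k.+1)%R by rewrite exprn_ege1// ler1n.
have LL : (L <= 2 ^+ k.+1 * L)%R by rewrite ler_peMl// ltW.
have -> : (2 ^+ k.+3 * L = 4 * (2 ^+ k.+1 * L))%R by rewrite !exprS; ring.
by apply/andP; split; lra.
Qed.

Section level.
Variables (J : nat) (D : set Rn) (d w : R).
Hypothesis mD : measurable (D : set (@lebT R n)).
Hypothesis DQ0 : D `<=` Q0.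
Hypothesis D_d : mu D = d%:E.
Hypothesis d_gt0 : (0 < d)%R.
Hypothesis w_gt0 : (0 < w)%R.
Hypothesis level3 : forall i k : nat,
  mu (Q3 `&` [set x | (w * 2 `^ (- (i%:R * al)) * 2 `^ (k%:R * be))%:E < g x]) <=
  (2 ^+ i / 2 ^+ k * d)%:E.
Hypothesis levelA : (A * V `^ (- p^-1) * (V / d) `^ t^-1 <= 2 `^ al * w)%R.

Lemma integral_level :
  \int[lebesgue_mu]_(x in D) (\sum_(j < J) ((lam j * e j x) `^ v)%:E) <=
  (core_cst * w `^ v * d)%:E.
Proof.
have t_gt0 : (0 < t)%R by exact: lt_trans qt.
have mQ j : measurable (cube (c j) (l j) : set (@lebT R n)).
  by apply: measurable_cube; exact: ltW.
have Q_l j : lebesgue_mu (cube (c j) (l j)) = (l j ^+ n)%:E.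
  by apply: lebesgue_cube; exact: ltW.
have mB k : measurable (Bk k : set (@lebT R n)).
  by apply: measurable_cube; rewrite mulr_ge0 ?exprn_ge0 ?(ltW L_gt0).
have B_Vk k : lebesgue_mu (Bk k) = ((2 ^+ k.+3 * L) ^+ n)%:E.
  by apply: lebesgue_cube; rewrite mulr_ge0 ?exprn_ge0 ?(ltW L_gt0).
have mQ0 : measurable (Q0 : set (@lebT R n)) by apply: measurable_cube; exact: ltW.
have le_mu (X Y : set (@lebT R n)) : X `<=` Y -> lebesgue_mu X <= lebesgue_mu Y.
  exact: le_lebesgue_rV.
have -> : (core_cst * w `^ v * d)%:E = (small_cst n t v al be * w `^ v * d)%:E +
    (large_cst n p q t s v (2 `^ al) * w `^ v * d)%:E.
  by rewrite -EFinD /core_cst; congr EFin; ring.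
have Hvitali (P : pred 'I_J) (K : R) : (0 <= K)%R ->
    (forall j, P j -> (l j ^+ n)%:E <= K%:E * lebesgue_mu (D `&` cube (c j) (l j))) ->
    lebesgue_mu (\big[setU/set0]_(j < J | P j) cube (c j) (l j)) <=
      (3 ^+ n * K)%:E * lebesgue_mu D.
  move=> K0 HK; rewrite -big_filter.
  set r := [seq _ <- _ | _].
  have rP (j : 'I_J) : j \in r -> P j by rewrite mem_filter => /andP[].
  apply: le_trans (@vitali_cubes R n 'I_J (fun j => c j) (fun j => l j) K D r K0 mD
    (fun j _ => l_gt0 j) (fun j jr => HK j (rP j jr))) _.
  apply: lee_wpmul2l; first by rewrite lee_fin mulr_ge0// exprn_ge0.
  by apply: le_mu => x [].
apply: (integral_sum_atoms (T := @lebT R n) (m := lebesgue_mu) (L := L)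
  v_gt0 mQ e_ge0 me e_supp mD D_d lam_ge0).
- apply: (sum_small_atoms (T := @lebT R n) (m := lebesgue_mu) (B3 := Q3)
    v_gt0 q_gt0 vq qt al_gt be_gt0 be_lt l_gt0 mQ Q_l e_ge0 me e_supp g_ge0 (Hg J) d_gt0 w_gt0 mD D_d) => //.
  (* On the atom's own cube the exponents [1/s] and [1/t - 1/s] merge into [1/t]. *)
  + move=> j y y0; apply: le_trans (weak_e j (c j) (l_gt0 j) y0) _.
    rewrite lee_fin le_eqVlt; apply/orP; left; apply/eqP; congr (_ `^ _)%R.
    rewrite -powRD; last by rewrite (gt_eqF (exprn_gt0 _ _))//= implybT.
    by congr (_ `^ _ / _)%R; ring.
  + move=> j lj [x [Dx Qx]]; apply: (@cube_sub3 R n c0 (c j) L (l j)); first exact: ltW.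
    by exists x; split => //; exact: DQ0.
  + by move=> i k A' _ /le_mu hA'; apply: le_trans hA' (level3 i k).
- apply: (sum_large_atoms (T := @lebT R n) (m := lebesgue_mu) (B0 := Q0) (B := Bk)
    n_gt0 v_gt0 q_gt0 vq qp qt ts ps l_gt0 mQ Q_l e_ge0 me g_ge0 (Hg J) L_gt0 d_gt0 w_gt0 A_gt0 mD D_d mQ0 DQ0) => //.
  + by move=> j y y0; exact: weak_e.
  + move=> j k lj [x [Dx Qx]]; apply: (large_cube_sub lj _ Qx); exact: DQ0.
  + move=> k i A' _ /le_mu hA'; apply: le_trans hA' _; apply: weak_g.
    by rewrite mulr_gt0// exprn_gt0.
Qed.

End level.

Lemma core_cst_gt0 : (0 < core_cst)%R.
Proof.
have t_gt0 : (0 < t)%R by exact: lt_trans qt.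
have s_gt0 : (0 < s)%R by exact: lt_le_trans ts.
have p_gt0 : (0 < p)%R by exact: lt_le_trans qp.
have vt1 : (v / t < 1)%R by rewrite ltr_pdivrMr// mul1r (lt_trans vq).
have vq1 : (q^-1 * v < 1)%R by rewrite mulrC ltr_pdivrMr// mul1r.
have /andP[_ r1] : (0 <= (2 : R) `^ (v / t - al * v) < 1)%R.
  by apply: powR2_lt1; rewrite mulrC -mulrBl pmulr_llt0// subr_lt0.
have /andP[_ r2] : (0 <= (2 : R) `^ (n%:R * (v / s - v / p)) < 1)%R.
  apply: powR2_lt1; rewrite pmulr_rlt0 ?ltr0n// -mulrBr pmulr_rlt0// subr_lt0.
  by rewrite ltf_pV2 ?posrE.
rewrite /core_cst addr_gt0//.
  by rewrite /small_cst divr_gt0 ?subr_gt0// !mulr_gt0 ?exprn_gt0 ?weak_cst_gt0.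
by rewrite /large_cst divr_gt0 ?subr_gt0// !mulr_gt0 ?weak_cst_gt0 ?powR_gt0 ?exprn_gt0.
Qed.

Definition envelope (u : R) : \bar R :=
  maxe (rearrangement (cutoff g Q3) u) ((A * V `^ (- p^-1))%:E * step V u).

(** The supremum over pairs [(i, k)], arranged as two nested one-parameter suprema so that
    [lnorm_dil] applies to each. *)
Definition dominant : R -> \bar R :=
  dil (2 `^ al) 2 (dil (2 `^ (- be)) 2^-1 envelope).

Definition vsum (x : Rn) : \bar R :=
  (\sum_(0 <= j <oo) ((lam j * e j x) `^ v)%:E) `^ v^-1.

Lemma envelope_ge0 u : 0 <= envelope u.
Proof. by rewrite /envelope le_max rearrangement_ge0. Qed.

Lemma envelope_nonincreasing u u' : (u <= u')%R -> envelope u' <= envelope u.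
Proof.
move=> uu'; apply: le_max2.
  exact: rearrangement_nonincreasing.
apply: lee_wpmul2l; last exact: step_nonincreasing.
by rewrite lee_fin mulr_ge0 ?powR_ge0// ltW.
Qed.

Lemma npos_envelope : npos envelope.
Proof.
by apply: nonincreasing_npos => *; [exact: envelope_ge0|exact: envelope_nonincreasing].
Qed.

Lemma npos_dominant_inner : npos (dil (2 `^ (- be)) 2^-1 envelope).
Proof. by apply: npos_dil; rewrite ?powR_gt0 ?invr_gt0//; exact: npos_envelope. Qed.

Lemma npos_dominant : npos dominant.
Proof. by apply: npos_dil; rewrite ?powR_gt0//; exact: npos_dominant_inner. Qed.

Lemma vsum_ge0 x : 0 <= vsum x. Proof. exact: poweR_ge0. Qed.

Lemma envelope_lt (u d w : R) (i k : nat) : (u <= d)%R -> dominant u < w%:E ->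
  envelope (2 ^+ i / 2 ^+ k * d)%R < (w * 2 `^ (- (i%:R * al)) * 2 `^ (k%:R * be))%:E.
Proof.
move=> ud Hw; apply: (@le_lt_trans _ _ (envelope (2^-1 ^+ k * (2 ^+ i * u))%R)).
  apply: envelope_nonincreasing; rewrite exprVn mulrA [(_^-1 * _)%R]mulrC.
  by rewrite ler_wpM2l// divr_ge0// exprn_ge0.
have a0 : (0 < (2 : R) `^ al ^+ i)%R by rewrite exprn_gt0// powR_gt0.
have b0 : (0 < (2 : R) `^ (- be) ^+ k)%R by rewrite exprn_gt0// powR_gt0.
have h1 := dil_ubound (2 `^ (- be)) 2^-1 envelope (2 ^+ i * u)%R k.
have h2 := dil_ubound (2 `^ al) 2 (dil (2 `^ (- be)) 2^-1 envelope) u i.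
have h3 : ((2 `^ al ^+ i)%:E * ((2 `^ (- be) ^+ k)%:E *
    envelope (2^-1 ^+ k * (2 ^+ i * u))%R)) < w%:E.
  apply: le_lt_trans Hw; apply: le_trans h2; apply: lee_wpmul2l h1.
  by rewrite lee_fin ltW.
move: h3; rewrite muleA -EFinM -lte_pdivlMl ?mulr_gt0// => h3.
apply: lt_le_trans h3 _; rewrite -EFinM lee_fin le_eqVlt; apply/orP; left; apply/eqP.
rewrite mulrC -mulrA; congr (_ * _)%R.
case: (@pos_expR R 2) => // L2 ->.
by rewrite !powR_expR !exprn_expR -!expRD -expRN; congr expR; ring.
Qed.

Let E_ (y : R) (J : nat) : set (@lebT R n) :=
  Q0 `&` [set x | y%:E < \sum_(j < J) ((lam j * e j x) `^ v)%:E].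

Let measurable_E y J : measurable (E_ y J).
Proof.
have mF : measurable_fun (setT : set (@lebT R n))
    (fun x => \sum_(j < J) (lam j * e j x) `^ v)%R.
  apply: measurable_sum => j.
  apply: (@measurableT_comp _ _ _ _ _ _ (fun x : R => x `^ v)%R).
    exact: measurable_powR.
  by apply: measurable_funM.
rewrite /E_ (_ : [set x | _] = [set x | (y < \sum_(j < J) (lam j * e j x) `^ v)%R]).
  apply: measurable_superlevel; last exact: measurable_funTS mF.
  by apply: measurable_cube; exact: ltW.
by apply/seteqP; split => x /=; rewrite sumEFin lte_fin.
Qed.

Lemma measure_level_le (u w : R) (J : nat) : (0 < u)%R -> (0 < w)%R ->
  dominant u < w%:E -> lebesgue_mu (E_ (2 * core_cst * w `^ v)%R J) <= u%:E.
Proof.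
move=> u0 w0 Hw; set y := (2 * core_cst * w `^ v)%R; set D := E_ y J.
have mD : measurable D by exact: measurable_E.
have DQ0 : D `<=` Q0 by move=> x [].
have VE : lebesgue_mu Q0 = V%:E by apply: lebesgue_cube; exact: ltW.
have V0 : (0 < V)%R by rewrite exprn_gt0.
have DV : lebesgue_mu D <= V%:E by rewrite -VE; exact: le_lebesgue_rV.
have Dfin : lebesgue_mu D \is a fin_num by rewrite ge0_fin_numE// (le_lt_trans DV)// ltry.
set d := fine (lebesgue_mu D); have D_d : lebesgue_mu D = d%:E by rewrite /d fineK.
rewrite D_d lee_fin leNgt; apply/negP => ud.
have d0 : (0 < d)%R by exact: lt_trans ud.
have dV : (d <= V)%R by rewrite -lee_fin -D_d.
have Hlev : forall i k : nat,
  mu (Q3 `&` [set x | (w * 2 `^ (- (i%:R * al)) * 2 `^ (k%:R * be))%:E < g x]) <=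
  (2 ^+ i / 2 ^+ k * d)%:E.
  move=> i k; rewrite -distribution_cutoff ?mulr_ge0 ?powR_ge0 ?(ltW w0)//.
  apply: rearrangement_lt; apply: le_lt_trans (envelope_lt i k (ltW ud) Hw).
  by rewrite /envelope le_max lexx.
have HA : (A * V `^ (- p^-1) * (V / d) `^ t^-1 <= 2 `^ al * w)%R.
  (* With [2^i d <= V < 2^(i+1) d], the step function equals 1 at [2^i d], so the envelope there is
     at least [A V^(-1/p)]; moreover [(V/d)^(1/t) <= (V/d)^al <= 2^al 2^(i al)]. *)
  have [|i /andP[i1 i2]] := @dyadic_level R (d / V)%R.
    by rewrite divr_gt0//= ler_pdivrMr// mul1r.
  have : (A * V `^ (- p^-1))%:E < (w * 2 `^ (- (i%:R * al)))%:E.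
    have := envelope_lt i 0 (ltW ud) Hw.
    rewrite expr0 divr1 mul0r powRr0 mulr1; apply: le_lt_trans.
    rewrite /envelope le_max; apply/orP; right; rewrite /step.
    suff -> : (2 ^+ i * d <= V)%R by rewrite mule1.
    by move: i2; rewrite ler_pdivrMr// exprVn ler_pdivlMl ?exprn_gt0.
  rewrite lte_fin => /ltW HA.
  have Vd : (1 <= V / d)%R by rewrite ler_pdivlMr// mul1r.
  have t0 : (0 < t)%R by exact: lt_trans qt.
  apply: (@le_trans _ _ (w * 2 `^ (- (i%:R * al)) * (2 ^+ i.+1) `^ al)%R).
    apply: ler_pM => //; rewrite ?powR_ge0 ?mulr_ge0 ?powR_ge0 ?(ltW A_gt0)//.
    apply: (@le_trans _ _ ((V / d) `^ al)%R); first by rewrite ler_powR// ltW.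
    have al0 : (0 < al)%R by apply: lt_trans al_gt; rewrite invr_gt0.
    rewrite ge0_ler_powR ?(ltW al0) ?nnegrE ?exprn_ge0 ?divr_ge0 ?(ltW V0) ?(ltW d0)//.
    move: i1; rewrite ltr_pdivlMr// exprVn ltr_pdivrMl ?exprn_gt0// => i1.
    by rewrite ler_pdivrMr// ltW.
  have -> : ((2 ^+ i.+1) `^ al = 2 `^ al * 2 `^ (i%:R * al) :> R)%R.
    case: (@pos_expR R 2) => // L2 ->; rewrite exprn_expR !powR_expR -expRD.
    by rewrite -natr1; congr expR; ring.
  rewrite powRN le_eqVlt; apply/orP; left; apply/eqP; field.
  by rewrite gt_eqF// powR_gt0.
have := integral_level J mD DQ0 D_d d0 w0 Hlev HA.
apply/negP; rewrite -ltNge.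
(* The integrand exceeds [y] on [D], and the factor 2 in [y] makes [y d] strictly larger than the
   upper bound just obtained. *)
apply: (@lt_le_trans _ _ (\int[lebesgue_mu]_(x in D) (cst y%:E) x)).
  rewrite integral_cst// D_d -EFinM lte_fin /y -!mulrA mulr_natl mulr2n ltrDl.
  by rewrite !mulr_gt0 ?core_cst_gt0 ?powR_gt0.
apply: ge0_le_integral; first exact: mD.
- by move=> x _; rewrite lee_fin !mulr_ge0 ?powR_ge0// ltW// core_cst_gt0.
- exact: measurable_cst.
- apply: emeasurable_sum => j; apply/measurable_EFinP.
  apply: (@measurableT_comp _ _ _ _ _ _ (fun x : R => x `^ v)%R).
    exact: measurable_powR.
  by apply: measurable_funM => //; exact: measurable_funTS.
- by move=> x [_ /ltW].
Qed.

(** The level set of the infinite sum lies in the increasing union of those of the partial sums,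
    whose measures are bounded by [u] uniformly in [J]. *)
Lemma rearrangement_vsum_le u : (0 < u)%R ->
  rearrangement (cutoff vsum Q0) u <= ((2 * core_cst) `^ v^-1)%:E * dominant u.
Proof.
move=> u0; have c2 : (0 < 2 * core_cst)%R by rewrite mulr_gt0// core_cst_gt0.
apply: rearrangement_le_mul; [by rewrite powR_gt0|exact: npos_dominant.2|].
move=> w w0 Hw; set y := (2 * core_cst * w `^ v)%R.
have y0 : (0 <= y)%R by rewrite mulr_ge0 ?powR_ge0// ltW.
have yE : ((2 * core_cst) `^ v^-1 * w = y `^ v^-1)%R.
  by rewrite /y [RHS]powRM ?powR_ge0 ?(ltW c2)// -powRrM mulfV ?gt_eqF// powRr1// ltW.
rewrite yE distribution_cutoff ?powR_ge0//; last exact: vsum_ge0.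
have sub : Q0 `&` [set x | (y `^ v^-1)%:E < vsum x] `<=` \bigcup_J E_ y J.
  move=> x [Qx /= yx]; apply: contrapT => nE.
  move: yx; rewrite ltNge => /negP; apply; rewrite -poweR_EFin.
  apply: le_poweR; first by rewrite invr_ge0 ltW.
    by apply: nneseries_ge0 => *; rewrite lee_fin powR_ge0.
  apply: lime_le.
    by apply: is_cvg_nneseries => *; rewrite lee_fin powR_ge0.
  apply: nearW => J; rewrite leNgt; apply/negP => yJ; apply: nE; exists J => //.
  by split => //=; rewrite -(big_mkord xpredT (fun j => ((lam j * e j x) `^ v)%:E)).
apply: le_trans (le_lebesgue_rV sub) _.
have cv := @nondecreasing_cvg_mu _ _ _ lebesgue_mu (E_ y) (fun J => measurable_E y J)
  (bigcup_measurable (fun J _ => measurable_E y J)).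
have nd : nondecreasing_seq (E_ y).
  apply/nondecreasing_seqP => J; apply/subsetPset => x [Qx /= yx]; split => //=.
  rewrite big_ord_recr/=; apply: (lt_le_trans yx); rewrite leeDl// lee_fin powR_ge0//.
have /cvg_lim <- // := cv nd.
apply: lime_le; first by apply/cvg_ex; eexists; exact: (cv nd).
by apply: nearW => J; exact: measure_level_le.
Qed.

End rearrangement_bound.

Section morrey_bound.
Context {R : realType} {n : nat}.
Local Notation Rn := 'rV[R]_n.
Local Notation mu := (@lebesgue_rV R n).

(** Provides the slack for the strict inequality in [morrey_weak_bound], and a positive [A] even
    when the norm of [g] is 0. *)
Lemma lee_mul_gt (x : \bar R) (C N : R) : (0 < C)%R ->
  (forall N', (N < N')%R -> x <= (C * N')%:E) -> x <= (C * N)%:E.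
Proof.
move=> C0 H; apply/lee_addgt0Pr => e e0; rewrite -EFinD.
have -> : (C * N + e = C * (N + e / C))%R by field; rewrite gt_eqF.
by apply: H; rewrite ltrDl divr_gt0.
Qed.

Lemma morrey_norm_vsum_le (p q s t v : R) (r : \bar R) :
  (0 < n)%N -> (0 < v)%R -> (v < q)%R -> (q <= p)%R -> (q < t)%R -> (t <= s)%R ->
  (p < s)%R -> 0 < r ->
  exists2 C : R, (0 < C)%R &
  forall (c : nat -> Rn) (l lam : nat -> R) (e : nat -> @lebT R n -> R)
    (g : Rn -> \bar R),
  (forall j, 0 < l j)%R -> (forall j, 0 <= lam j)%R ->
  (forall j x, (0 <= e j x)%R) -> (forall j, measurable_fun setT (e j)) ->
  (forall j x, ~ cube (c j) (l j) x -> e j x = 0%R) ->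
  (forall x, 0 <= g x) ->
  (forall J x, \sum_(j < J) ((lam j * \1_(cube (c j) (l j)) x) `^ v)%:E <= g x `^ v) ->
  (forall j (c' : Rn) (l' y : R), (0 < l')%R -> (0 < y)%R ->
    mu (cube c' l' `&` [set x | (y < e j x)%R]) <=
    (((l j ^+ n) `^ s^-1 * (l' ^+ n) `^ (t^-1 - s^-1) / y) `^ t)%:E) ->
  morrey_norm p q r g < +oo ->
  morrey_norm p q r (vsum v lam e) <= C%:E * morrey_norm p q r g.
Proof.
move=> n0 v0 vq qp qt ts ps r0.
have q0 : (0 < q)%R by exact: lt_trans vq.
have t0 : (0 < t)%R by exact: lt_trans qt.
have p0 : (0 < p)%R by exact: lt_le_trans qp.
pose al := ((t^-1 + q^-1) / 2)%R; pose be := ((q^-1 + v^-1) / 2)%R.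
have tq' : (t^-1 < q^-1)%R by rewrite ltf_pV2 ?posrE.
have qv' : (q^-1 < v^-1)%R by rewrite ltf_pV2 ?posrE.
have q'0 : (0 < q^-1)%R by rewrite invr_gt0.
have al_t : (t^-1 < al)%R by rewrite /al; lra.
have al_q : (al < q^-1)%R by rewrite /al; lra.
have be_q : (q^-1 < be)%R by rewrite /be; lra.
have be0 : (0 < be)%R by exact: lt_trans be_q.
have be_v : (be * v < 1)%R.
  by rewrite -ltr_pdivlMr// mul1r /be; lra.
have [C1 C10 HC1] : exists2 C1 : R, (0 < C1)%R & forall phi, npos phi ->
    lnorm q r (dil (2 `^ (- be)) 2^-1 phi) <= C1%:E * lnorm q r phi.
  apply: lnorm_dil => //; rewrite ?powR_gt0 ?invr_gt0//.
  have -> : (2^-1 `^ (- q^-1) = 2 `^ q^-1 :> R)%R.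
    by rewrite -(powR_inv1 (ler0n _ 2)) -powRrM mulN1r opprK.
  rewrite -powRD ?pnatr_eq0 ?implybT//.
  by case/andP: (@powR2_lt1 R (- be + q^-1) ltac:(by lra)).
have [C2 C20 HC2] : exists2 C2 : R, (0 < C2)%R & forall phi, npos phi ->
    lnorm q r (dil (2 `^ al) 2 phi) <= C2%:E * lnorm q r phi.
  apply: lnorm_dil => //; rewrite ?powR_gt0//.
  rewrite -powRD ?pnatr_eq0 ?implybT//.
  by case/andP: (@powR2_lt1 R (al - q^-1) ltac:(by lra)).
have [Cs Cs0 HCs] := @lnorm_step R q r q0 r0.
have [CE CE0 HCE] := @morrey_weak_bound R n q r q0 r0.
pose K := ((2 * @core_cst R n p q t s v al be) `^ v^-1)%R.
have K0 : (0 < K)%R.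
  by rewrite powR_gt0// mulr_gt0// core_cst_gt0.
pose M2 := (2 `^ (fine r)^-1 : R)%R.
have M20 : (0 < M2)%R by rewrite powR_gt0.
(* The first term is the Morrey bound on the tripled cube, the second the norm of the step function.
   Both carry the factor [V^(1/q - 1/p)] that the Morrey normalization on the given cube cancels. *)
pose Xc := ((3 ^+ n) `^ (q^-1 - p^-1) + CE * Cs)%R.
have Xc0 : (0 < Xc)%R by rewrite addr_gt0 ?powR_gt0 ?exprn_gt0// mulr_gt0.
exists (K * C2 * C1 * M2 * Xc)%R; first by rewrite !mulr_gt0.
move=> c l lam e g l0 lam0 e0 me e_supp g0 Hg weak_e gfin.
have N0 : 0 <= morrey_norm p q r g.
  apply: le_ereal_sup_tmp; eexists.
    by exists (cube 0 1) => //; exact: cube_is_cube.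
  apply: mule_ge0; first exact: poweR_ge0.
  by rewrite lorentz_normE; apply: lnorm_ge0 => *; exact: rearrangement_ge0.
have Nfin : morrey_norm p q r g \is a fin_num by rewrite ge0_fin_numE.
set N := fine (morrey_norm p q r g).
have NE : morrey_norm p q r g = N%:E by rewrite /N fineK.
have N0' : (0 <= N)%R by rewrite fine_ge0.
rewrite NE -EFinM; apply: lee_mul_gt; first by rewrite !mulr_gt0.
move=> N' NN'; have N'0 : (0 < N')%R by exact: le_lt_trans NN'.
pose A := (CE * N')%R; have A0 : (0 < A)%R by rewrite mulr_gt0.
have weak_g (c' : Rn) (l' : R) (i : nat) : (0 < l')%R ->
  mu (cube c' l' `&` [set x |
      (A * (l' ^+ n) `^ (- p^-1) * 2 `^ (i%:R * q^-1))%:E < g x]) <=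
    (l' ^+ n / 2 ^+ i)%:E.
  by move=> l'0; apply: (HCE p N) => //; rewrite ?NE// ltr_pM2l.
apply: ge_ereal_sup => _ [_ [c0 [L [L0 ->]]] <-].
rewrite -/(cube c0 L) lebesgue_cube ?(ltW L0)//.
set V := (L ^+ n)%R; have V0 : (0 < V)%R by rewrite exprn_gt0.
rewrite poweR_EFin -(opprB q^-1 p^-1)%R powRN lee_pdivrMl ?powR_gt0//.
pose env := @envelope R n p g A c0 L.
have nenv : npos env by exact: npos_envelope.
have Xle : lnorm q r env <= M2%:E * (V `^ (q^-1 - p^-1) * Xc * N')%:E.
  apply: (@lnorm_max R q r (rearrangement (cutoff g (cube (c0 - const_mx L) (L *+ 3))))
    (fun u => (A * V `^ (- p^-1))%:E * step V u)) => //.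
  - exact: npos_rearrangement.
  - split; last by move=> *; rewrite mule_ge0 ?step_ge0// lee_fin mulr_ge0 ?powR_ge0 ?(ltW A0).
    by apply: emeasurable_funM; [exact: measurable_cst|exact: (npos_step V).1].
  - rewrite -lorentz_normE; apply: (@le_trans _ _ (((L *+ 3) ^+ n) `^ (q^-1 - p^-1) * N)%:E).
      by apply: lorentz_norm_cutoff_le; rewrite ?NE// pmulrn_rgt0.
    rewrite lee_fin -mulr_natl exprMn powRM ?exprn_ge0 ?(ltW L0)// -/V.
    rewrite [(_ * V `^ _)%R]mulrC ler_pM ?mulr_ge0 ?powR_ge0 ?(ltW NN')//.
    by rewrite ler_wpM2l ?powR_ge0// lerDl mulr_ge0// ltW.
  - apply: le_trans (lnormZ_le q r0 _ (npos_step V)) _.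
      by rewrite mulr_ge0 ?powR_ge0 ?(ltW A0).
    apply: (@le_trans _ _ ((A * V `^ (- p^-1))%:E * (Cs * V `^ q^-1)%:E)).
      by apply: lee_wpmul2l (HCs _ V0); rewrite lee_fin mulr_ge0 ?powR_ge0 ?(ltW A0).
    rewrite -EFinM lee_fin.
    have -> : (V `^ (q^-1 - p^-1) = V `^ (- p^-1) * V `^ q^-1)%R.
      by rewrite -powRD ?(gt_eqF V0) ?implybT// addrC.
    rewrite [leLHS](_ : _ = V `^ (- p^-1) * V `^ q^-1 * (CE * Cs) * N')%R; last first.
      by rewrite /A; ring.
    by rewrite ler_wpM2r ?(ltW N'0)// ler_wpM2l ?mulr_ge0 ?powR_ge0// lerDr powR_ge0.
rewrite lorentz_normE; apply: (@le_trans _ _ (K%:E * (C2%:E * (C1%:E *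
    (M2%:E * (V `^ (q^-1 - p^-1) * Xc * N')%:E))))); last first.
  by rewrite -!EFinM lee_fin le_eqVlt; apply/orP; left; apply/eqP; ring.
pose dom := @dominant R n p al be g A c0 L.
have ndom : npos dom by exact: npos_dominant.
apply: (@le_trans _ _ (lnorm q r (fun u => K%:E * dom u))).
  apply: le_lnorm => //; first exact: npos_rearrangement.
    split; last by move=> u u0; rewrite mule_ge0 ?lee_fin ?(ltW K0)// ndom.2.
    by apply: emeasurable_funM; [exact: measurable_cst|exact: ndom.1].
  move=> u u0; apply: (rearrangement_vsum_le n0 v0 q0 vq qp qt ts ps al_t be0 be_v
    (c := c) (l := l)) => //.
apply: le_trans (lnormZ_le q r0 (ltW K0) ndom) _.
apply: lee_wpmul2l; first by rewrite lee_fin ltW.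
apply: le_trans (HC2 _ _) _; first exact: npos_dominant_inner.
apply: lee_wpmul2l; first by rewrite lee_fin ltW.
apply: le_trans (HC1 _ nenv) _.
by apply: lee_wpmul2l => //; rewrite lee_fin ltW.
Qed.

End morrey_bound.

(** * Monotone limits in Lorentz spaces *)

Section powR_sum.
Context {R : realType}.

(** The ratios [a/(a+b)] and [b/(a+b)] lie in [[0, 1]], hence are at most their [v]-th powers, and
    they add up to 1. *)
Lemma powR_add_le (a b v : R) : (0 <= a)%R -> (0 <= b)%R -> (0 < v <= 1)%R ->
  ((a + b) `^ v <= a `^ v + b `^ v)%R.
Proof.
move=> a0 b0 /andP[v0 v1]; have [ab0|ab0] := eqVneq (a + b)%R 0%R.
  by rewrite ab0 powR0 ?gt_eqF// addr_ge0 ?powR_ge0.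
have s0 : (0 < a + b)%R by rewrite lt_neqAle eq_sym ab0 addr_ge0.
have key x : (0 <= x)%R -> (x <= a + b)%R ->
    (x / (a + b) * (a + b) `^ v <= x `^ v)%R.
  move=> x0 xs; have [->|xn0] := eqVneq x 0%R; first by rewrite !mul0r powR_ge0.
  have xp : (0 < x)%R by rewrite lt_neqAle eq_sym xn0.
  have -> : (x `^ v = (x / (a + b)) `^ v * (a + b) `^ v)%R.
    by rewrite -powRM ?divr_ge0 ?(ltW s0)// mulfVK.
  rewrite ler_wpM2r ?powR_ge0// ger1_powR// divr_gt0//=.
  by rewrite ler_pdivrMr// mul1r.
have -> : ((a + b) `^ v = a / (a + b) * (a + b) `^ v + b / (a + b) * (a + b) `^ v)%R.
  by rewrite -mulrDl -mulrDl divff// mul1r.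
by apply: lerD; apply: key; rewrite ?lerDl ?lerDr.
Qed.

Lemma powR_sum_le (I : Type) (r : seq I) (x : I -> R) (v : R) :
  (forall i, 0 <= x i)%R -> (0 < v <= 1)%R ->
  ((\sum_(i <- r) x i) `^ v <= \sum_(i <- r) x i `^ v)%R.
Proof.
move=> x0 v01; elim: r => [|i r IH].
  by rewrite !big_nil powR0// gt_eqF//; case/andP: v01.
rewrite !big_cons; apply: le_trans (powR_add_le _ _ v01) _ => //.
  exact: sumr_ge0.
by rewrite lerD2l.
Qed.

End powR_sum.

Section lorentz_lemmas.
Context {R : realType} {n : nat}.
Local Notation Rn := 'rV[R]_n.
Local Notation mu := (@lebesgue_rV R n).
Local Notation lebmu := (@lebesgue_mu R n).
Implicit Types (g h : Rn -> \bar R) (q u : R) (r : \bar R).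

Lemma lorentz_norm_ge0 q r g : 0 <= lorentz_norm q r g.
Proof. by rewrite lorentz_normE; apply: lnorm_ge0 => *; exact: rearrangement_ge0. Qed.

Lemma le_lorentz_norm_ae (N : set Rn) q r g h : 0 < r -> mu N = 0 ->
  (forall x, ~ N x -> `|g x| <= `|h x|) -> lorentz_norm q r g <= lorentz_norm q r h.
Proof.
move=> r0 N0 gh; rewrite !lorentz_normE; apply: le_lnorm => //;
  [exact: npos_rearrangement|exact: npos_rearrangement|].
by move=> u u0; exact: (le_rearrangement_ae _ N0).
Qed.

Lemma le_lorentz_norm q r g h : 0 < r ->
  (forall x, `|g x| <= `|h x|) -> lorentz_norm q r g <= lorentz_norm q r h.
Proof.
move=> r0 gh; apply: (@le_lorentz_norm_ae set0) => //; exact: lebesgue_rV0.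
Qed.

Lemma lorentz_distribution q r g a : (0 < q)%R -> 0 < r -> (0 < a)%R ->
  lorentz_norm q r g < +oo -> exists2 u, (0 < u)%R & distribution_fun g a <= u%:E.
Proof.
move=> q0 r0 a0 gfin; have [C C0 HC] := @lnorm_embed R q r q0 r0.
set X := fine (lorentz_norm q r g).
have XE : lorentz_norm q r g = X%:E by rewrite /X fineK// ge0_fin_numE// lorentz_norm_ge0.
have X0 : (0 <= X)%R by rewrite fine_ge0// lorentz_norm_ge0.
(* Chosen so that [u^(-1/q) C X < a]; the summand 1 makes the inequality strict and keeps [u]
   positive when [X = 0]. *)
pose u := ((C * X / a + 1) `^ q)%R.
have b0 : (0 < C * X / a + 1)%R.
  by rewrite ltr_wpDl// divr_ge0 ?mulr_ge0// ltW.
have u0 : (0 < u)%R by rewrite powR_gt0.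
exists u => //; apply: rearrangement_lt.
have := HC (rearrangement g) u u0 (fun t _ => rearrangement_ge0 _ t)
  (fun t t' _ tt' => rearrangement_nonincreasing _ tt').
rewrite -lorentz_normE XE -EFinM -lee_pdivlMl ?powR_gt0// => H.
apply: le_lt_trans H _; rewrite -EFinM lte_fin /u -powRrM mulfV ?gt_eqF// powRr1 ?(ltW b0)//.
rewrite ltr_pdivrMl// mulrDl mul1r divfK ?gt_eqF//.
by rewrite ltrDl.
Qed.

Lemma lorentz_rearrangement_fin q r g u : (0 < q)%R -> 0 < r -> (0 < u)%R ->
  lorentz_norm q r g < +oo -> rearrangement g u < +oo.
Proof.
move=> q0 r0 u0 gfin; have [C C0 HC] := @lnorm_embed R q r q0 r0.
have := HC (rearrangement g) u u0 (fun t _ => rearrangement_ge0 _ t)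
  (fun t t' _ tt' => rearrangement_nonincreasing _ tt').
rewrite -lorentz_normE -lee_pdivlMl ?powR_gt0// => H; apply: le_lt_trans H _.
rewrite lte_mul_pinfty ?lee_fin ?invr_ge0 ?powR_ge0//.
by rewrite lte_mul_pinfty ?lee_fin// ltW.
Qed.

Lemma measurable_superlevel_ereal (h : @lebT R n -> \bar R) (a : R) :
  measurable_fun setT h -> measurable [set x : @lebT R n | a%:E < h x].
Proof.
move=> mh; rewrite (_ : [set x | _] = setT `&` h @^-1` `]a%:E, +oo]%classic).
  by apply: mh => //; exact: emeasurable_itv.
by apply/seteqP; split => x /=; rewrite in_itv/= ?leey ?andbT//; case.
Qed.

(** The superlevel sets of the [h k] decrease to a null set, and the first has finite measure, so
    their measures tend to 0. Hence the rearrangements tend to 0 at every [u > 0], and dominated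
    convergence on the half-line concludes. *)
Lemma lorentz_norm_cvg0 q (e : R) (h : nat -> @lebT R n -> \bar R) (N : set Rn) :
  (0 < q)%R -> (0 < e)%R ->
  (forall k, measurable_fun setT (h k)) -> (forall k x, 0 <= h k x) ->
  (forall k x, h k.+1 x <= h k x) -> mu N = 0 ->
  (forall x, ~ N x -> h ^~ x @ \oo --> 0) ->
  lorentz_norm q e%:E (h 0%N) < +oo ->
  (fun k => lorentz_norm q e%:E (h k)) @ \oo --> 0.
Proof.
move=> q0 e0 mh h0 hd N0 hcvg hfin.
have hle k m x : (k <= m)%N -> h m x <= h k x.
  move=> km; apply: (@nonincreasing_seqP _ _ (fun k => h k x)).1 => //.
rewrite (_ : (fun k => _) = fun k => lnorm q e%:E (rearrangement (h k))); last first.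
  by apply/funext => k; rewrite lorentz_normE.
apply: lnorm_cvg0 => //.
- by move=> k; exact: npos_rearrangement.
- move=> k t t0; apply: le_rearrangement => x; rewrite !gee0_abs//; exact: hle.
move=> u u0; apply/cvge0P => [k|a a0]; first exact: rearrangement_ge0.
pose B k : set (@lebT R n) := [set x | a%:E < h k x].
have mB k : measurable (B k) by exact: measurable_superlevel_ereal.
have BE k : lebmu (B k) = distribution_fun (h k) a.
  by congr mu; apply/seteqP; split => x /=; rewrite gee0_abs.
have B0 : lebmu (B 0%N) < +oo.
  have [|w w0 Hw] := @lorentz_distribution q e%:E (h 0%N) a q0 _ a0 hfin; first by rewrite lte_fin.
  by rewrite BE (le_lt_trans Hw)// ltry.
have mI : measurable (\bigcap_k B k) by exact: bigcap_measurable.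
have nB : nonincreasing_seq B.
  apply/nonincreasing_seqP => k; apply/subsetPset => x /= ax.
  exact: lt_le_trans ax (hd k x).
have := nonincreasing_cvg_mu B0 mB mI nB.
have -> : lebmu (\bigcap_k B k) = 0.
  apply: lebesgue_rV_null_subset N0 => x Bx; apply: contrapT => Nx.
  have /cvge0P H := hcvg x Nx.
  have [k _ Hk] := H (fun k => h0 k x) (a / 2)%R ltac:(by rewrite divr_gt0).
  have := Bx k I; rewrite /B /= => ah.
  have := lt_le_trans ah (Hk k (leqnn k)).
  by rewrite lte_fin ltr_pdivlMr// mulr_natr mulr2n gtrDl ltNge (ltW a0).
move=> /cvge0P H; have := H (fun k => measure_ge0 _ _) u u0.
apply: filterS => k Hk; apply: rearrangement_le => //.
by rewrite -BE.
Qed.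

(** The successor keeps every box nondegenerate, as [is_cube] demands. *)
Definition box (k : nat) : set Rn := cube (const_mx (- k.+1%:R)%R) (k.+1%:R *+ 2).

Lemma box_side_gt0 k : (0 < (k.+1%:R : R) *+ 2)%R.
Proof. by rewrite pmulrn_rgt0. Qed.

Lemma norm_le_box (M : R) (k : nat) (x : Rn) : (M <= k.+1%:R)%R ->
  (`|x| <= M)%R -> box k x.
Proof.
move=> Mk xM i; rewrite mxE.
have : (`|x ord0 i| <= k.+1%:R)%R.
  apply: le_trans Mk; apply: le_trans xM.
  rewrite [leRHS]mx_normrE.
  exact: (le_bigmax_cond _ (fun ij : 'I_1 * 'I_n => `|x ij.1 ij.2|%R) (j := (ord0, i))).
by rewrite ler_norml => /andP[? ?]; apply/andP; split; lra.
Qed.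

Lemma box_cover (x : Rn) : exists k, box k x.
Proof.
exists (Num.bound `|x|); apply: norm_le_box (lexx _).
have /ltW := @archi_boundP R `|x| (normr_ge0 _); move/le_trans; apply.
by rewrite ler_nat.
Qed.

Lemma box_nondecreasing k : box k `<=` box k.+1.
Proof.
move=> x bx i; move: (bx i); rewrite !mxE => /andP[h1 h2].
have k1 : (k.+2%:R = k.+1%:R + 1 :> R)%R by rewrite natr1.
by rewrite k1; apply/andP; split; lra.
Qed.

Lemma compact_sub_box (K : set Rn) : compact K -> exists k, K `<=` box k.
Proof.
move=> /compact_bounded [M [_ HM]].
exists (Num.bound `|M + 1|%R) => x Kx.
apply: norm_le_box (HM (M + 1)%R _ x Kx); last by rewrite ltrDl.
apply: le_trans (ler_norm _) _.
have /ltW := @archi_boundP R `|M + 1|%R (normr_ge0 _); move/le_trans; apply.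
by rewrite ler_nat.
Qed.

Lemma lebesgue_null_boxes (N : set Rn) :
  (forall k, mu (box k `&` N) = 0) -> mu N = 0.
Proof.
move=> H; apply/eqP; rewrite eq_le; apply/andP; split; last exact: outer_measure_ge0.
apply: (@le_trans _ _ (mu (\bigcup_k (box k `&` N)))).
  by apply: le_lebesgue_rV => x Nx; have [k bx] := box_cover x; exists k.
apply: le_trans (outer_measure_sigma_subadditive _ _) _.
by rewrite eseries0// => k _ _; exact: H.
Qed.

(** On a box the rearrangement is finite at every [u > 0], so the infinity set has measure at most
    [u] there. *)
Lemma infinity_null q r h : (0 < q)%R -> 0 < r -> (forall x, 0 <= h x) ->
  (forall k, lorentz_norm q r (cutoff h (box k)) < +oo) ->
  mu [set x | h x = +oo] = 0.
Proof.
move=> q0 r0 h0 hfin; apply: lebesgue_null_boxes => k.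
apply/eqP; rewrite eq_le; apply/andP; split; last exact: outer_measure_ge0.
apply/lee_addgt0Pr => u u0; rewrite add0e.
have rf := lorentz_rearrangement_fin q0 r0 u0 (hfin k).
have rfin : rearrangement (cutoff h (box k)) u \is a fin_num.
  by rewrite ge0_fin_numE// rearrangement_ge0.
pose y := (fine (rearrangement (cutoff h (box k)) u) + 1)%R.
have y0 : (0 <= y)%R by rewrite addr_ge0// fine_ge0// rearrangement_ge0.
have Hy : rearrangement (cutoff h (box k)) u < y%:E.
  by rewrite -(fineK rfin) lte_fin ltrDl.
apply: le_trans (rearrangement_lt Hy); rewrite distribution_cutoff//.
by apply: le_lebesgue_rV => x [bx /= hx]; split => //=; rewrite hx ltry.
Qed.

(** Meant for [p = q], where the volume factor of the Morrey norm is 1 and that norm bounds all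
    boxes uniformly; the bound passes to the whole space by monotone exhaustion. *)
Lemma lorentz_norm_boxes q (e : R) (h : @lebT R n -> \bar R) (X : \bar R) :
  (0 < e)%R -> measurable_fun setT h -> (forall x, 0 <= h x) ->
  (forall k, lorentz_norm q e%:E (cutoff h (box k)) <= X) ->
  lorentz_norm q e%:E h <= X.
Proof.
move=> e0 mh h0 HX; rewrite lorentz_normE.
apply: (@lnorm_sup_le R q e (fun k => rearrangement (cutoff h (box k))) _ _ e0
  (fun k => npos_rearrangement _) (npos_rearrangement _)); last by move=> k; exact: HX.
- move=> k t t0; apply: le_rearrangement => x.
  rewrite !gee0_abs; try exact: cutoff_ge0.
  apply: lee_wpmul2l => //; rewrite lee_fin !indicE ler_nat.
  case: (boolP (x \in box k)) => // /[!inE] /box_nondecreasing bx.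
  by rewrite mem_set.
- move=> u u0; set c := ereal_sup _.
  have c0 : 0 <= c.
    apply: le_ereal_sup_tmp; exists (rearrangement (cutoff h (box 0)) u); first by exists 0%N.
    exact: rearrangement_ge0.
  rewrite -[leRHS]mul1e; apply: rearrangement_le_mul => // w w0 cw; rewrite mul1r.
  pose B k : set (@lebT R n) := box k `&` [set x | w%:E < h x].
  have mB k : measurable (B k).
    apply: measurableI; last exact: measurable_superlevel_ereal.
    by apply: measurable_cube; apply: ltW; exact: box_side_gt0.
  have sub : [set x | w%:E < `|h x|] `<=` \bigcup_k B k.
    move=> x /=; rewrite gee0_abs// => wx; have [k bx] := box_cover x; by exists k.
  apply: le_trans (le_lebesgue_rV sub) _.
  have nd : nondecreasing_seq B.
    apply/nondecreasing_seqP => k; apply/subsetPset => x [bx wx]; split => //.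
    exact: box_nondecreasing.
  have cv := @nondecreasing_cvg_mu _ _ _ lebmu B mB
    (bigcup_measurable (fun k _ => mB k)) nd.
  have /cvg_lim <- // := cv.
  apply: lime_le; first by apply/cvg_ex; eexists; exact: cv.
  apply: nearW => k.
  have := @rearrangement_lt _ _ (cutoff h (box k)) u w.
  rewrite distribution_cutoff ?(ltW w0)//; apply.
  by apply: le_lt_trans cw; apply: ereal_sup_ubound; exists k.
Qed.

End lorentz_lemmas.

(** * The limit function *)

Section complex_modulus.
Context {R : realType}.
Local Notation normc := (@Normc.normc R).
Implicit Types z : R[i].

Lemma normc_sqrt z : normc z = Num.sqrt (complex.Re z ^+ 2 + complex.Im z ^+ 2)%R.
Proof. by case: z. Qed.

Lemma normc_nonneg z : (0 <= normc z)%R.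
Proof. by rewrite normc_sqrt sqrtr_ge0. Qed.

Lemma normc_le z (y : R) : (0 <= y)%R ->
  (normc z <= y)%R = (complex.Re z ^+ 2 + complex.Im z ^+ 2 <= y ^+ 2)%R.
Proof.
move=> y0; rewrite normc_sqrt -[X in (_ <= X)%R = _](ger0_norm y0) -sqrtr_sqr.
by rewrite ler_sqrt// sqr_ge0.
Qed.

Lemma Re_le_normc z : (`|complex.Re z| <= normc z)%R.
Proof. by rewrite normc_sqrt -sqrtr_sqr ler_sqrt ?addr_ge0 ?sqr_ge0// lerDl sqr_ge0. Qed.

Lemma Im_le_normc z : (`|complex.Im z| <= normc z)%R.
Proof. by rewrite normc_sqrt -sqrtr_sqr ler_sqrt ?addr_ge0 ?sqr_ge0// lerDr sqr_ge0. Qed.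

Lemma normc_realM (x : R) z : (0 <= x)%R -> normc (x%:C%C * z)%R = (x * normc z)%R.
Proof.
move=> x0; rewrite Normc.normcM; congr (_ * _)%R.
by rewrite normc_sqrt /= expr0n/= addr0 sqrtr_sqr ger0_norm.
Qed.

Lemma normc_sum (I : Type) (r : seq I) (F : I -> R[i]) :
  (normc (\sum_(i <- r) F i) <= \sum_(i <- r) normc (F i))%R.
Proof.
elim: r => [|i r IH]; first by rewrite !big_nil normc_sqrt /= expr0n/= addr0 sqrtr0.
by rewrite !big_cons; apply: le_trans (le_normcD _ _) _; rewrite lerD2l.
Qed.

Lemma Re_sum (I : Type) (r : seq I) (F : I -> R[i]) :
  (complex.Re (\sum_(i <- r) F i) = \sum_(i <- r) complex.Re (F i))%R.
Proof. by apply: (big_morph (@complex.Re R)) => // -[? ?] [? ?]. Qed.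

Lemma Im_sum (I : Type) (r : seq I) (F : I -> R[i]) :
  (complex.Im (\sum_(i <- r) F i) = \sum_(i <- r) complex.Im (F i))%R.
Proof. by apply: (big_morph (@complex.Im R)) => // -[? ?] [? ?]. Qed.

Lemma Re_realM (x : R) z : complex.Re (x%:C%C * z)%R = (x * complex.Re z)%R.
Proof. by case: z => a b /=; rewrite mul0r subr0. Qed.

Lemma Im_realM (x : R) z : complex.Im (x%:C%C * z)%R = (x * complex.Im z)%R.
Proof. by case: z => a b /=; rewrite mul0r addr0. Qed.

Lemma cvgn_abs_sum (x : nat -> R) (Y : R) :
  (forall M, (\sum_(0 <= j < M) `|x j| <= Y)%R) ->
  cvgn (fun M => \sum_(0 <= j < M) x j)%R.
Proof.
move=> HY; apply: (@normed_cvg R R x).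
apply: nondecreasing_is_cvgn.
  by apply: nondecreasing_series => *; exact: normr_ge0.
by exists Y => _ [M _ <-]; exact: HY.
Qed.

Lemma measurable_normc d (T : measurableType d) (f : T -> R[i]) :
  measurable_fun setT (fun x => complex.Re (f x)) ->
  measurable_fun setT (fun x => complex.Im (f x)) ->
  measurable_fun setT (fun x => normc (f x)).
Proof.
move=> mR mI; under eq_fun do rewrite normc_sqrt.
apply: (@measurableT_comp _ _ _ _ _ _ (@Num.sqrt R)).
  by apply: continuous_measurable_fun; exact: sqrt_continuous.
by apply: measurable_funD; apply: measurable_funX.
Qed.

End complex_modulus.

Section vsum_lemmas.
Context {R : realType} {n : nat}.
Local Notation Rn := 'rV[R]_n.
Variables (v : R) (e : nat -> @lebT R n -> R).
Hypothesis v_gt0 : (0 < v)%R.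
Hypothesis v_le1 : (v <= 1)%R.
Hypothesis e_ge0 : forall j x, (0 <= e j x)%R.
Implicit Type lam : nat -> R.

(** Zeroing coefficients, rather than shifting indices, keeps the majorant of a remainder of the
    form [vsum], with the same functions [e]. *)
Definition tail_coef lam (J j : nat) : R := if (j < J)%N then 0%R else lam j.

Lemma tail_coef_ge0 lam J j : (forall j, 0 <= lam j)%R -> (0 <= tail_coef lam J j)%R.
Proof. by rewrite /tail_coef; case: ifP. Qed.

Let term_ge0 lam (x : Rn) j : 0 <= ((lam j * e j x) `^ v)%:E.
Proof. by rewrite lee_fin powR_ge0. Qed.

Lemma le_vsum lam lam' (x : Rn) : (forall j, 0 <= lam j <= lam' j)%R ->
  vsum v lam e x <= vsum v lam' e x.
Proof.
move=> H; apply: le_poweR; first by rewrite invr_ge0 ltW.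
  by apply: nneseries_ge0 => *; exact: term_ge0.
apply: lee_nneseries => [j _ _|j _]; first exact: term_ge0.
have /andP[h1 h2] := H j.
rewrite lee_fin ge0_ler_powR ?(ltW v_gt0) ?nnegrE ?mulr_ge0 ?(le_trans h1 h2)//.
exact: ler_wpM2r.
Qed.

(** The inclusion of [l^v] in [l^1] for [v <= 1], through which [vsum] controls absolute
    convergence. *)
Lemma sum_le_vsum lam (x : Rn) (M : nat) : (forall j, 0 <= lam j)%R ->
  (\sum_(0 <= j < M) lam j * e j x)%:E <= vsum v lam e x.
Proof.
move=> lam0; have S0 : (0 <= \sum_(0 <= j < M) lam j * e j x)%R.
  by apply: sumr_ge0 => j _; rewrite mulr_ge0.
rewrite -[leLHS](@poweRVK _ _ v)// ?lee_fin//.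
apply: le_poweR; [by rewrite invr_ge0 ltW|exact: poweR_ge0|].
rewrite poweR_EFin; apply: (@le_trans _ _ (\sum_(0 <= j < M) ((lam j * e j x) `^ v)%:E)).
  rewrite sumEFin lee_fin; apply: powR_sum_le; last by rewrite v_gt0.
  by move=> j; rewrite mulr_ge0.
by apply: nneseries_lim_ge => *; exact: term_ge0.
Qed.

Lemma vsum_tail_cvg0 lam (x : Rn) : vsum v lam e x < +oo ->
  (fun J => vsum v (tail_coef lam J) e x) @ \oo --> 0.
Proof.
move=> fin; apply: cvge0_poweR => //; first by rewrite invr_gt0.
  by move=> J; apply: nneseries_ge0 => *; exact: term_ge0.
have -> : (fun J => \sum_(0 <= j <oo) ((tail_coef lam J j * e j x) `^ v)%:E) =
    (fun J => \sum_(J <= j <oo) ((lam j * e j x) `^ v)%:E).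
  apply/funext => J.
  rewrite (@nneseries_split _ _ 0 J) ?add0n => [|k _]; last exact: term_ge0.
  rewrite big1_seq ?add0e; last first.
    move=> j; rewrite mem_index_iota/= => jJ.
    by rewrite /tail_coef jJ mul0r powR0// gt_eqF.
  rewrite -nneseries_addn; last by move=> *; exact: term_ge0.
  rewrite -[RHS]nneseries_addn; last by move=> *; exact: term_ge0.
  by apply: eq_eseriesr => i _; rewrite /tail_coef ltnNge leq_addl.
apply: nneseries_tail_cvg => //.
by apply: lty_poweRy fin; rewrite invr_neq0// gt_eqF.
Qed.

Lemma measurable_vsum lam : (forall j, measurable_fun setT (e j)) ->
  measurable_fun (setT : set (@lebT R n)) (vsum v lam e).
Proof.
move=> me; apply: (@measurableT_comp _ _ _ _ _ _ (fun x : \bar R => x `^ v^-1)).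
  exact: measurable_poweR.
apply: ge0_emeasurable_sum => [j x _ _|j _]; first exact: term_ge0.
apply/measurable_EFinP.
apply: (@measurableT_comp _ _ _ _ _ _ (fun x : R => x `^ v)%R).
  exact: measurable_powR.
by apply: measurable_funM.
Qed.

End vsum_lemmas.

Lemma measurable_lincomb d (T : measurableType d) (R : realType) (J : nat)
    (lam : nat -> R) (h : nat -> T -> R) : (forall j, measurable_fun setT (h j)) ->
  measurable_fun setT (fun x => \sum_(0 <= j < J) lam j * h j x)%R.
Proof. by move=> mh; apply: measurable_sum => j; exact: measurable_funM. Qed.

Lemma measurable_lty d (T : measurableType d) (R : realType) (h : T -> \bar R) :
  measurable_fun setT h -> measurable [set x | h x < +oo].
Proof.
move=> mh; rewrite (_ : [set x | _] = setT `&` h @^-1` `[-oo%E, +oo%E[%classic).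
  by apply: mh => //; exact: emeasurable_itv.
by apply/seteqP; split => x /=; rewrite in_itv/= leNye/=; [split|case].
Qed.

Lemma measurable_limn_indic d (T : measurableType d) (R : realType) (E : set T)
    (h : nat -> T -> R) : measurable E -> (forall M, measurable_fun setT (h M)) ->
  (forall x, cvgn (fun M => h M x * \1_E x)%R) ->
  measurable_fun setT (fun x => limn (fun M => h M x * \1_E x)%R).
Proof.
move=> mE mh hcvg; apply: (@measurable_fun_cvg _ T R setT
  (fun M x => h M x * \1_E x)%R) => [M|x _]; last exact: hcvg.
by apply: measurable_funM => //; exact: measurable_indic.
Qed.

Section limit_function.
Context {R : realType} {n : nat}.
Local Notation Rn := 'rV[R]_n.
Variables (v : R) (a : nat -> Rn -> R[i]) (lam : nat -> R).
Hypothesis v_gt0 : (0 < v)%R.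
Hypothesis v_le1 : (v <= 1)%R.
Hypothesis lam_ge0 : forall j, (0 <= lam j)%R.
Hypothesis L0a : forall j, L0 (a j).

Let e j (x : @lebT R n) : R := Normc.normc (a j x).
Let e_ge0 j x : (0 <= e j x)%R. Proof. exact: normc_nonneg. Qed.
Let me j : measurable_fun setT (e j).
Proof. by have [? ?] := L0a j; exact: measurable_normc. Qed.
Let T J := vsum v (tail_coef lam J) e.
Let S J (x : Rn) : R[i] := (\sum_(0 <= j < J) (lam j)%:C%C * a j x)%R.
Let E : set (@lebT R n) := [set x | vsum v lam e x < +oo].

Let measurable_E : measurable E.
Proof. by apply: measurable_lty; exact: measurable_vsum. Qed.

Let tail0 : tail_coef lam 0 = lam. Proof. by apply/funext. Qed.

Let T_le J x : T J x <= vsum v lam e x.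
Proof.
apply: le_vsum => // j; rewrite tail_coef_ge0//= /tail_coef.
by case: ifP.
Qed.

Let T_fin J x : E x -> T J x \is a fin_num.
Proof. by move=> Ex; rewrite ge0_fin_numE ?vsum_ge0// (le_lt_trans (T_le J x)). Qed.

Lemma partial_sum_tail_le J M x : E x -> (J <= M)%N ->
  (Normc.normc (S M x - S J x) <= fine (T J x))%R.
Proof.
move=> Ex JM; rewrite /S (@big_cat_nat _ _ _ J 0 M)//= addrAC subrr add0r.
apply: le_trans (normc_sum _ _) _; rewrite -lee_fin (fineK (T_fin J Ex)).
apply: le_trans (sum_le_vsum (e := e) v_gt0 v_le1 e_ge0 x M (tail_coef_ge0 J ^~ lam_ge0)).
rewrite lee_fin (@big_cat_nat _ _ _ J 0 M)//= ler_wpDl//.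
  by apply: sumr_ge0 => j _; rewrite mulr_ge0// tail_coef_ge0.
rewrite le_eqVlt; apply/orP; left; apply/eqP.
rewrite big_nat_cond [RHS]big_nat_cond; apply: eq_bigr => j /andP[/andP[Jj _] _].
by rewrite normc_realM// /tail_coef ltnNge Jj.
Qed.

Lemma partial_sum_le J x : (Normc.normc (S J x))%:E <= vsum v lam e x.
Proof.
apply: le_trans (sum_le_vsum (e := e) v_gt0 v_le1 e_ge0 x J lam_ge0).
rewrite lee_fin; apply: le_trans (normc_sum _ _) _.
by apply: ler_sum => j _; rewrite normc_realM.
Qed.

Lemma L0_partial_sum J : L0 (S J).
Proof.
split.
- have -> : (fun x : @lebT R n => complex.Re (S J x)) =
      (fun x => \sum_(0 <= j < J) lam j * complex.Re (a j x))%R.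
    by apply/funext => x; rewrite /S Re_sum; apply: eq_bigr => j _; rewrite Re_realM.
  exact: (measurable_lincomb J lam (fun j => (L0a j).1)).
- have -> : (fun x : @lebT R n => complex.Im (S J x)) =
      (fun x => \sum_(0 <= j < J) lam j * complex.Im (a j x))%R.
    by apply/funext => x; rewrite /S Im_sum; apply: eq_bigr => j _; rewrite Im_realM.
  exact: (measurable_lincomb J lam (fun j => (L0a j).2)).
Qed.

Let part_cvg (part : R[i] -> R) : (forall z, `|part z| <= Normc.normc z)%R ->
  (forall I (r : seq I) (F : I -> R[i]),
    part (\sum_(i <- r) F i) = \sum_(i <- r) part (F i))%R ->
  forall x, cvgn (fun M => part (S M x) * \1_E x)%R.
Proof.
move=> partle partsum x; have [Ex|Ex] := pselect (E x); last first.
  rewrite (_ : (fun M => _) = fun=> 0%R); first exact: is_cvg_cst.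
  by apply/funext => M; rewrite indicE memNset// mulr0.
under eq_fun do rewrite indicE mem_set// mulr1 /S partsum.
apply: (@cvgn_abs_sum R _ (fine (vsum v lam e x))) => M.
have fin : vsum v lam e x \is a fin_num by rewrite ge0_fin_numE ?vsum_ge0.
rewrite -lee_fin fineK//.
apply: le_trans (sum_le_vsum (e := e) v_gt0 v_le1 e_ge0 x M lam_ge0).
rewrite lee_fin; apply: ler_sum => j _; apply: le_trans (partle _) _.
by rewrite normc_realM.
Qed.

(** The indicator of the set where the majorant is finite makes the limit exist at every point,
    which gives measurability and the value 0 elsewhere. *)
Let fR x : R := limn (fun M => complex.Re (S M x) * \1_E x)%R.
Let fI x : R := limn (fun M => complex.Im (S M x) * \1_E x)%R.
Definition limit_fun (x : Rn) : R[i] := (fR x +i* fI x)%C.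

Let cvgR := part_cvg (@Re_le_normc R) (@Re_sum R).
Let cvgI := part_cvg (@Im_le_normc R) (@Im_sum R).

Lemma L0_limit_fun : L0 limit_fun.
Proof.
split.
- exact: (measurable_limn_indic measurable_E (fun M => (L0_partial_sum M).1) cvgR).
- exact: (measurable_limn_indic measurable_E (fun M => (L0_partial_sum M).2) cvgI).
Qed.

Lemma limit_fun_out x : ~ E x -> limit_fun x = 0%R.
Proof.
move=> Ex; rewrite /limit_fun /fR /fI.
have z (h : nat -> R) : limn (fun M => h M * \1_E x)%R = 0%R.
  by under eq_fun do rewrite indicE memNset// mulr0; exact: lim_cst.
by rewrite !z.
Qed.

Lemma limit_fun_tail_le J x : E x -> cmod (limit_fun \- S J)%R x <= T J x.
Proof.
move=> Ex; rewrite /cmod -(fineK (T_fin J Ex)) lee_fin.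
have y0 : (0 <= fine (T J x))%R by rewrite fine_ge0// vsum_ge0.
(* The bound passes to the limit on the squared modulus, a polynomial in the two convergent
   parts. *)
rewrite normc_le//.
set u := complex.Re (S J x); set w := complex.Im (S J x).
have -> : complex.Re ((limit_fun \- S J)%R x) = (fR x - u)%R.
  by rewrite /u /=; case: (S J x).
have -> : complex.Im ((limit_fun \- S J)%R x) = (fI x - w)%R.
  by rewrite /w /=; case: (S J x).
have unit_indic (h : nat -> R) : (fun M => h M * \1_E x)%R = h.
  by apply/funext => M; rewrite indicE mem_set// mulr1.
have cR : (fun M => complex.Re (S M x))%R @ \oo --> fR x.
  by have := @cvgR x; rewrite /fR unit_indic.
have cI : (fun M => complex.Im (S M x))%R @ \oo --> fI x.
  by have := @cvgI x; rewrite /fI unit_indic.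
have cRI : (fun M => (complex.Re (S M x) - u) ^+ 2 + (complex.Im (S M x) - w) ^+ 2)%R
    @ \oo --> ((fR x - u) ^+ 2 + (fI x - w) ^+ 2)%R.
  rewrite !expr2; under eq_fun do rewrite !expr2.
  by apply: cvgD; apply: cvgM; apply: cvgB => //; exact: cvg_cst.
rewrite -(cvg_lim _ cRI)//; apply: limr_le; first by apply/cvg_ex; eexists; exact: cRI.
near=> M; have JM : (J <= M)%N by near: M; exists J.
have := partial_sum_tail_le Ex JM; rewrite normc_le//.
by rewrite /u /w; case: (S M x) => ? ?; case: (S J x).
Unshelve. all: by end_near. Qed.

Lemma limit_fun_le x : cmod limit_fun x <= vsum v lam e x.
Proof.
have [Ex|Ex] := pselect (E x); last first.
  by rewrite /cmod limit_fun_out// normc_sqrt /= expr0n/= addr0 sqrtr0 vsum_ge0.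
have := limit_fun_tail_le 0 Ex; rewrite /T tail0; apply: le_trans.
rewrite /cmod lee_fin /= /S big_geq// subr0; exact: lexx.
Qed.

Lemma vsum_tail_succ J x : T J.+1 x <= T J x.
Proof.
apply: le_vsum => // j; rewrite tail_coef_ge0//= /tail_coef ltnS.
by case: ltngtP => // _; exact: lam_ge0.
Qed.

End limit_function.

(** * Norm bound and convergence of the series of atoms *)

Lemma measurable_mul_indic d (T : measurableType d) (R : realType)
    (h : T -> \bar R) (K : set T) : measurable_fun setT h -> measurable K ->
  measurable_fun setT (fun x => h x * (\1_K x)%:E).
Proof.
move=> mh mK; apply: emeasurable_funM => //; apply/measurable_EFinP.
exact: measurable_indic.
Qed.

Lemma measurable_cutoff {R : realType} {n : nat} (h : @lebT R n -> \bar R)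
    (K : set (@lebT R n)) : measurable_fun setT h -> measurable K ->
  measurable_fun (setT : set (@lebT R n)) (cutoff h K).
Proof. by move=> mh mK; exact: (measurable_mul_indic mh mK). Qed.

Theorem theorem1p1 (R : realType) (n : nat) (p q s t v : R) (r : \bar R)
    (n_gt0 : (0 < n)%N)
    (q_gt0 : (0 < q)%R) (q_le_p : (q <= p)%R) (r_gt0 : 0 < r)
    (t_gt0 : (0 < t)%R) (t_le_s : (t <= s)%R)
    (v_gt0 : (0 < v)%R) (v_le1 : (v <= 1)%R)
    (q_lt_t : (q < t)%R) (p_lt_s : (p < s)%R)
    (v_lt : v%:E < Order.min q%:E r) :
  exists2 C : R, (0 < C)%R &
  forall (Q : nat -> set 'rV[R]_n) (a : nat -> 'rV[R]_n -> R[i])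
    (lambda : nat -> R),
  let g := fun x : 'rV[R]_n =>
    (\sum_(0 <= j <oo) ((lambda j * \1_(Q j) x) `^ v)%:E) `^ v^-1 in
  let S := fun (J : nat) (x : 'rV[R]_n) =>
    (\sum_(0 <= j < J) (lambda j)%:C%C * a j x)%R in
  (forall j, is_cube (Q j)) ->
  (forall j, weak_morrey s t (a j)) ->
  (forall j, (0 <= lambda j)%R) ->
  (forall j, weak_morrey_norm s t (a j) <= lebesgue_rV (Q j) `^ s^-1) ->
  (forall j, supp (a j) `<=` Q j) ->
  morrey_norm p q r g < +oo ->
  exists f : 'rV[R]_n -> R[i],
  [/\ L0 f,
      cvg_ae S f,
      morrey_norm p q r (cmod f) <= C%:E * morrey_norm p q r g,
      r < +oo -> cvg_lorentz_loc q r S f &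
      p = q -> r < +oo -> cvg_lorentz p r S f].
Proof.
have v_lt_q : (v < q)%R by move: v_lt; rewrite lt_min lte_fin => /andP[].
have [C C0 HC] := @morrey_norm_vsum_le R n p q s t v r n_gt0 v_gt0 v_lt_q q_le_p
  q_lt_t t_le_s p_lt_s r_gt0.
exists C => // Q a lambda g S cubeQ Wa lam0 normQ suppQ gfin.
have /choice[cl Hcl] : forall j, exists cl : 'rV[R]_n * R,
    (0 < cl.2)%R /\ Q j = cube cl.1 cl.2.
  by move=> j; have [c [l [l0 ->]]] := cubeQ j; exists (c, l).
pose c j := (cl j).1; pose l j := (cl j).2.
have l0 j : (0 < l j)%R := (Hcl j).1.
have QE j : Q j = cube (c j) (l j) := (Hcl j).2.
have L0a j : L0 (a j) := (Wa j).1.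
pose e j (x : @lebT R n) : R := Normc.normc (a j x).
have e0 j x : (0 <= e j x)%R by exact: normc_nonneg.
have me j : measurable_fun setT (e j).
  by have [? ?] := L0a j; exact: measurable_normc.
have esupp j x : ~ cube (c j) (l j) x -> e j x = 0%R.
  rewrite -QE => Qx; rewrite /e; case: (eqVneq (a j x) 0%R) => [->|ax].
    by rewrite normc_sqrt /= expr0n/= addr0 sqrtr0.
  by exfalso; apply/Qx/suppQ/subset_closure.
have g0 x : 0 <= g x by exact: poweR_ge0.
have Hg J x : \sum_(j < J) ((lambda j * \1_(cube (c j) (l j)) x) `^ v)%:E <= g x `^ v.
  rewrite /g poweRK//; last by apply: nneseries_ge0 => *; rewrite lee_fin powR_ge0.
  rewrite -(big_mkord xpredT (fun j => ((lambda j * \1_(cube (c j) (l j)) x) `^ v)%:E)).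
  under eq_bigr do rewrite -QE.
  by apply: nneseries_lim_ge => *; rewrite lee_fin powR_ge0.
have weak_e j (c' : 'rV[R]_n) (l' y : R) : (0 < l')%R -> (0 < y)%R ->
    lebesgue_rV (cube c' l' `&` [set x | (y < e j x)%R]) <=
    (((l j ^+ n) `^ s^-1 * (l' ^+ n) `^ (t^-1 - s^-1) / y) `^ t)%:E.
  move=> l'0 y0; apply: weak_morrey_bound => //; first exact: powR_ge0.
  by have := normQ j; rewrite QE lebesgue_cube ?(ltW (l0 j))// poweR_EFin.
pose T J := vsum v (tail_coef lambda J) e.
have HT : morrey_norm p q r (vsum v lambda e) <= C%:E * morrey_norm p q r g.
  exact: (HC c l lambda e g).
have T0E : T 0%N = vsum v lambda e by congr vsum; apply/funext.
have T0fin : morrey_norm p q r (T 0%N) < +oo.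
  rewrite T0E; apply: le_lt_trans HT _.
  by rewrite lte_mul_pinfty// lee_fin ltW.
have T_ge0 J x : 0 <= T J x by exact: vsum_ge0.
have Tcube (c' : 'rV[R]_n) l' : (0 < l')%R ->
    lorentz_norm q r (cutoff (T 0%N) (cube c' l')) < +oo.
  move=> l'0; have M0 : 0 <= morrey_norm p q r (T 0%N).
    apply: le_ereal_sup_tmp; eexists.
      by exists (cube c' l') => //; exact: cube_is_cube.
    by rewrite mule_ge0 ?poweR_ge0// lorentz_norm_ge0.
  apply: le_lt_trans (lorentz_norm_cutoff_le (p := p)
    (N := fine (morrey_norm p q r (T 0%N))) c' l'0 _) (ltry _).
  by rewrite fineK// ge0_fin_numE.
have Tbox k : lorentz_norm q r (cutoff (T 0%N) (box k)) < +oo.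
  exact: (Tcube _ _ (box_side_gt0 k)).
(* This single null set serves every almost-everywhere statement below: off it, the tails [T J] tend
   to 0 and dominate the remainders. *)
pose N := [set x : 'rV[R]_n | T 0%N x = +oo].
have N0 : lebesgue_rV N = 0.
  exact: (infinity_null q_gt0 r_gt0 (T_ge0 0%N) Tbox).
pose f := limit_fun v a lambda.
have nN x : ~ N x -> vsum v lambda e x < +oo by rewrite -T0E ltey => /eqP.
have fT J x : ~ N x -> cmod (f \- S J)%R x <= T J x.
  by move=> /nN; exact: limit_fun_tail_le.
have ST J x : cmod (S J) x <= T 0%N x.
  by rewrite T0E; exact: partial_sum_le.
have fT0 x : cmod f x <= T 0%N x by rewrite T0E; exact: limit_fun_le.
have L0f : L0 f by exact: L0_limit_fun.
have L0S J : L0 (S J) by exact: L0_partial_sum.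
have cmod_ge0 h x : 0 <= cmod h x by rewrite lee_fin normc_nonneg.
have tail_cvg x : ~ N x -> T ^~ x @ \oo --> 0.
  by move=> /nN; exact: vsum_tail_cvg0.
have mT J : measurable_fun (setT : set (@lebT R n)) (T J) by exact: measurable_vsum.
have Tsucc J x : T J.+1 x <= T J x by exact: vsum_tail_succ.
have cut_le (h k : 'rV[R]_n -> \bar R) (K K' : set 'rV[R]_n) x :
    0 <= h x -> h x <= k x -> K `<=` K' ->
    `|cutoff h K x| <= `|cutoff k K' x|.
  move=> h0 hk KK'; have k0 : 0 <= k x by exact: le_trans hk.
  rewrite !gee0_abs ?mule_ge0// /cutoff; apply: lee_pmul => //.
  rewrite lee_fin !indicE ler_nat; case: (boolP (x \in K)) => // /[!inE] /KK' xK'.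
  by rewrite mem_set.
exists f; split; first exact: L0f.
- exists N; split; [exact: measurable_null|exact: N0|].
  move=> x /= ncv; apply: contrapT => Nx; apply: ncv.
  apply: cvge0_le (tail_cvg x Nx) => J.
  by rewrite cmod_ge0 fT.
(* The domination of [f] holds at every point, because [limit_fun] is 0 where the majorant is
   infinite. *)
- apply: le_trans HT; apply: ge_ereal_sup => _ [K cK <-].
  apply: (@le_trans _ _ (lebesgue_rV K `^ (p^-1 - q^-1) *
    lorentz_norm q r (cutoff (vsum v lambda e) K))).
    apply: lee_wpmul2l; first exact: poweR_ge0.
    apply: le_lorentz_norm => // x; rewrite -T0E; exact: cut_le.
  by apply: ereal_sup_ubound; exists K.
- case: r r_gt0 {v_lt HC gfin HT T0fin Tcube} Tbox => [r| |]//; rewrite ?lte_fin => r_gt0 Tbox _.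
  have r_gt0' : 0 < r%:E by rewrite lte_fin.
  have loc h : L0 h -> (forall x, cmod h x <= T 0%N x) -> lorentz_loc q r%:E h.
    move=> L0h hT; split => // K /compact_sub_box [k Kk].
    apply: le_lt_trans (Tbox k); apply: le_lorentz_norm => // x.
    by apply: cut_le; [exact: cmod_ge0|exact: hT|exact: Kk].
  split; [by move=> J; exact: loc|exact: loc|].
  move=> K /compact_sub_box [k Kk].
  (* The moduli of the remainders need not decrease with [J], but the tails do; a box replaces [K]
     because it is a cube, on which the Morrey norm gives finiteness. *)
  apply: (@cvge0_le _ _ (fun J => lorentz_norm q r%:E (cutoff (T J) (box k)))).
    move=> J; apply/andP; split; first exact: lorentz_norm_ge0.
    apply: (@le_lorentz_norm_ae R n N q r%:E (cutoff (cmod (f \- S J)%R) K)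
      (cutoff (T J) (box k)) r_gt0' N0) => x Nx.
    by apply: cut_le; [exact: cmod_ge0|exact: fT|exact: Kk].
  have mbox : measurable (box k : set (@lebT R n)).
    by apply: measurable_cube; apply: ltW; exact: box_side_gt0.
  have mh J := measurable_cutoff (mT J) mbox.
  have h0 J x : 0 <= cutoff (T J) (box k) x by exact: cutoff_ge0.
  have hd J x : cutoff (T J.+1) (box k) x <= cutoff (T J) (box k) x.
    by apply: lee_wpmul2r (Tsucc J x); rewrite lee_fin.
  have hcvg x : ~ N x -> (fun J => cutoff (T J) (box k) x) @ \oo --> 0.
    move=> Nx; apply: cvge0_le (tail_cvg x Nx) => J.
    rewrite h0 /cutoff indicE; case: (_ \in _); first by rewrite mule1 lexx.
    by rewrite mulr0n mule0/= T_ge0.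
  exact: (lorentz_norm_cvg0 q_gt0 r_gt0 mh h0 hd N0 hcvg (Tbox k)).
- move=> pq; subst p.
  case: r r_gt0 {v_lt HC gfin HT Tcube Tbox} T0fin => [r| |]//; rewrite ?lte_fin => r_gt0 T0fin _.
  have r_gt0' : 0 < r%:E by rewrite lte_fin.
  have Tfin : lorentz_norm q r%:E (T 0%N) < +oo.
    apply: le_lt_trans T0fin; apply: (lorentz_norm_boxes r_gt0 (mT 0%N) (T_ge0 0%N)) => k.
    apply: ereal_sup_ubound; exists (box k); first exact/cube_is_cube/box_side_gt0.
    by rewrite subrr poweRe0 mul1e.
  have glob h : L0 h -> (forall x, cmod h x <= T 0%N x) -> lorentz q r%:E h.
    move=> L0h hT; split; first exact: L0h.
    apply: le_lt_trans Tfin.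
    apply: (@le_lorentz_norm R n q r%:E (cmod h) (T 0%N) r_gt0') => x.
    by rewrite !gee0_abs ?T_ge0 ?cmod_ge0//; exact: hT.
  split; [by move=> J; exact: glob|exact: glob|].
  apply: (@cvge0_le _ _ (fun J => lorentz_norm q r%:E (T J))).
    move=> J; apply/andP; split; first exact: lorentz_norm_ge0.
    apply: (@le_lorentz_norm_ae R n N q r%:E (cmod (f \- S J)%R)
      (T J) r_gt0' N0) => x Nx.
    by rewrite !gee0_abs ?T_ge0 ?cmod_ge0//; exact: fT.
  exact: (lorentz_norm_cvg0 q_gt0 r_gt0 mT T_ge0 Tsucc N0 tail_cvg Tfin).
Qed.
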